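(* Let $G$ be a finite group and let $X$ be a complete non-singular toric variety over $\mathbb{C}$ equipped with a faithful $G$-action. Let $E=\pi^{-1}(G)\subset\widetilde{\operatorname{Aut}}(X)$ and $K=\operatorname{Hom}(\operatorname{Pic}(X),\mathbb{C}^\times)$. Then $X$ is $G$-versal if and only if the exact sequence of groups $$1\to K\to E\to G\to 1$$ splits (i.e. $E\to G$ admits a section that is a group homomorphism).
   Context: All varieties are irreducible and, together with group actions and maps, are defined over $\mathbb{C}$. A faithful $G$-variety is a variety with a faithful $G$-action. An irreducible $G$-variety $X$ is $G$-versal if it is faithful and, for any faithful $G$-variety $Y$ and any non-empty $G$-invariant open subset $U\subset X$, there exists a $G$-equivariant rational map $Y\dashrightarrow U$. Toric setup. Let $X=X(\Delta)$ be the complete non-singular toric variety of a fan $\Delta$ in a lattice $N\simeq\mathbb{Z}^n$, with torus $T=N\otimes\mathbb{C}^\times$; the $G$-action on $X$ is by arbitrary variety automorphisms and need not preserve $T$. Let $M=\operatorname{Hom}(N,\mathbb{Z})$, let $\Delta(1)$ be the set of rays of $\Delta$, and let $\operatorname{Div}_T(X)$ be the group of $T$-invariant divisors, which is free on the prime divisors $D_\rho$, $\rho\in\Delta(1)$. Applying $\operatorname{Hom}(\cdot,\mathbb{C}^\times)$ to the exact sequence $1\to M\to\operatorname{Div}_T(X)\to\operatorname{Pic}(X)\to1$ gives $1\to K\to(\mathbb{C}^\times)^{\Delta(1)}\to T\to1$ with $K=\operatorname{Hom}(\operatorname{Pic}(X),\mathbb{C}^\times)$. The Cox ring is the $\operatorname{Pic}(X)$-graded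 polynomial ring $\operatorname{Cox}(X)=\mathbb{C}[x_\rho:\rho\in\Delta(1)]$ with $\deg x_\rho=[D_\rho]$, and $K$ acts on $V=\operatorname{Spec}(\operatorname{Cox}(X))\simeq\mathbb{C}^{\Delta(1)}$ via the grading, i.e. through $K\subset(\mathbb{C}^\times)^{\Delta(1)}$. Let $Z\subset V$ be the closed subset defined by the irrelevant ideal generated by the monomials $\prod_{\rho\not\subset\sigma}x_\rho$, $\sigma\in\Delta$. Then $V-Z\to X$ is a $K$-torsor. Let $\widetilde{\operatorname{Aut}}(X)$ be the normaliser of $K$ in the automorphism group of $V-Z$; there is an exact sequence $1\to K\to\widetilde{\operatorname{Aut}}(X)\xrightarrow{\pi}\operatorname{Aut}(X)\to1$ (Cox). The faithful action embeds $G$ in $\operatorname{Aut}(X)$. *)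

(* Defs.v *)
From HB Require Import structures.
From mathcomp Require Import all_boot all_order all_algebra all_fingroup.
From mathcomp Require Import boolp classical_sets topology reals.
From mathcomp.multinomials Require mpoly.
Import -(notations) mpoly.

Set Implicit Arguments.
Unset Strict Implicit.
Unset Printing Implicit Defensive.

Import Order.TTheory GRing.Theory Num.Theory.

Local Open Scope classical_set_scope.
Local Open Scope ring_scope.

(* Varieties are treated in the classical language: a variety is its set of
   closed points with the Zariski topology and its sheaf of regular functions
   ("spaces with functions").  A function regular on U is given as a total
   function on the space of which only the restriction to U matters. *)

Record is_function_sheaf (C : fieldType) (T : topologicalType)
    (O : set T -> set (T -> C)) : Prop := FunctionSheaf {
  sheaf_cst : forall U c, open U -> O U (fun=> c);
  sheaf_add : forall U f g, open U ->
    O U f -> O U g -> O U (fun x => f x + g x);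
  sheaf_mul : forall U f g, open U ->
    O U f -> O U g -> O U (fun x => f x * g x);
  sheaf_res : forall U V f, open U -> open V -> V `<=` U -> O U f -> O V f;
  sheaf_glue : forall U f, open U ->
    (forall x, U x -> exists V g,
       [/\ open V, V x, V `<=` U, O V g & forall y, V y -> f y = g y]) ->
    O U f;
  sheaf_inv : forall U f, open U -> O U f ->
    open (U `&` [set x | f x != 0]) /\
    O (U `&` [set x | f x != 0]) (fun x => (f x)^-1)
}.

Record fspace (C : fieldType) := FSpace {
  carrier :> topologicalType;
  regular : set carrier -> set (carrier -> C);
  regular_sheaf : is_function_sheaf regular
}.

(* Spaces with functions glued from charts, each with a ring of coordinate
   functions: open sets are unions of principal open sets in every chart, and
   regular functions are locally quotients of coordinate functions. *)

Record atlas (C : fieldType) := Atlas {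
  apoint : Type;
  aindex : Type;
  chart : aindex -> set apoint;
  coordf : aindex -> set (apoint -> C);
  coordf_cst : forall i c, coordf i (fun=> c);
  coordf_add : forall i f g, coordf i f -> coordf i g ->
    coordf i (fun x => f x + g x);
  coordf_mul : forall i f g, coordf i f -> coordf i g ->
    coordf i (fun x => f x * g x)
}.

Definition glued (C : fieldType) (A : atlas C) : Type := apoint A.

Section Glued.
Variables (C : fieldType) (A : atlas C).

Definition glued_open (W : set (glued A)) : Prop :=
  forall (i : aindex A) (x : glued A), W x -> chart i x ->
    exists f, [/\ coordf i f, f x != 0 &
      forall y, chart i y -> f y != 0 -> W y].

Definition glued_regular (W : set (glued A)) (f : glued A -> C) : Prop :=
  forall (i : aindex A) (x : glued A), W x -> chart i x ->
    exists a b, [/\ coordf i a, coordf i b, b x != 0 &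
      forall y, W y -> chart i y -> b y != 0 -> f y = a y / b y].

Fact glued_openT : glued_open setT.
Proof.
move=> i x _ _; exists (fun=> 1); split=> //; first exact: coordf_cst.
exact: oner_neq0.
Qed.

Fact glued_openI : setI_closed glued_open.
Proof.
move=> U V oU oV i x [Ux Vx] ix.
have [f [fA fx fU]] := oU i x Ux ix; have [g [gA gx gV]] := oV i x Vx ix.
exists (fun y => f y * g y); split; first exact: coordf_mul.
  by rewrite mulf_neq0.
move=> y iy; rewrite mulf_eq0 negb_or => /andP[fy gy].
by split; [exact: fU | exact: gV].
Qed.

Fact glued_open_bigU (I : Type) (F : I -> set (glued A)) :
  (forall j, glued_open (F j)) -> glued_open (\bigcup_j F j).
Proof.
move=> oF i x [j _ Fx] ix; have [f [fA fx fF]] := oF j i x Fx ix.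
by exists f; split=> // y iy fy; exists j => //; exact: fF.
Qed.

HB.instance Definition _ := gen_eqMixin (glued A).
HB.instance Definition _ := gen_choiceMixin (glued A).
HB.instance Definition _ := isOpenTopological.Build (glued A)
  glued_openT glued_openI glued_open_bigU.

Fact glued_openE (U : set (glued A)) : open U <-> glued_open U.
Proof. by []. Qed.

Fact glued_sheaf : is_function_sheaf glued_regular.
Proof.
split.
- move=> U c _ i x Ux ix; exists (fun=> c), (fun=> 1).
  split; do ?exact: coordf_cst; first exact: oner_neq0.
  by move=> y _ _ _; rewrite divr1.
- move=> U f g _ rf rg i x Ux ix.
  have [a [b [aA bA bx fE]]] := rf i x Ux ix.
  have [c [d [cA dA dx gE]]] := rg i x Ux ix.
  exists (fun y => a y * d y + c y * b y), (fun y => b y * d y).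
  split; do ?[exact: coordf_mul | exact: mulf_neq0].
    by apply: coordf_add; exact: coordf_mul.
  move=> y Uy iy; rewrite mulf_eq0 negb_or => /andP[b0 d0].
  by rewrite (fE y) // (gE y) // addf_div.
- move=> U f g _ rf rg i x Ux ix.
  have [a [b [aA bA bx fE]]] := rf i x Ux ix.
  have [c [d [cA dA dx gE]]] := rg i x Ux ix.
  exists (fun y => a y * c y), (fun y => b y * d y).
  split; do ?[exact: coordf_mul | exact: mulf_neq0].
  move=> y Uy iy; rewrite mulf_eq0 negb_or => /andP[b0 d0].
  by rewrite (fE y) // (gE y) // mulf_div.
- move=> U V f _ _ VU rf i x Vx ix.
  have [a [b [aA bA bx fE]]] := rf i x (VU x Vx) ix.
  by exists a, b; split=> // y Vy; apply: fE; exact: VU.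
- move=> U f oU loc i x Ux ix.
  have [V [g [oV Vx VU rg fg]]] := loc x Ux.
  have [a [b [aA bA bx gE]]] := rg i x Vx ix.
  have [h [hA hx hV]] := (glued_openE V).1 oV i x Vx ix.
  exists (fun y => a y * h y), (fun y => b y * h y).
  split; do ?[exact: coordf_mul | exact: mulf_neq0].
  move=> y Uy iy; rewrite mulf_eq0 negb_or => /andP[b0 h0].
  have Vy : V y by exact: hV.
  by rewrite fg // (gE y) // -mulf_div divff // mulr1.
- move=> U f oU rf; split.
    apply/glued_openE => i x [Ux fx] ix.
    have [a [b [aA bA bx fE]]] := rf i x Ux ix.
    have [h [hA hx hU]] := (glued_openE U).1 oU i x Ux ix.
    exists (fun y => (a y * b y) * h y); split.
    + by do 2?[apply: coordf_mul => //].
    + rewrite mulf_neq0 // mulf_neq0 //; apply: contraNneq fx => a0.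
      by rewrite /= (fE x) // a0 mul0r.
    + move=> y iy; rewrite !mulf_eq0 !negb_or => /andP[/andP[a0 b0] h0].
      have Uy : U y by exact: hU.
      by split=> //=; rewrite (fE y) // mulf_neq0 // invr_neq0.
  move=> i x [Ux /= fx] ix.
  have [a [b [aA bA bx fE]]] := rf i x Ux ix.
  exists (fun y => b y * b y), (fun y => a y * b y).
  split; do ?exact: coordf_mul.
    rewrite mulf_neq0 //; apply: contraNneq fx => a0.
    by rewrite (fE x) // a0 mul0r.
  move=> y [Uy _] iy; rewrite mulf_eq0 negb_or => /andP[a0 b0].
  by rewrite (fE y) // invf_div -mulf_div divff // mulr1.
Qed.

Definition glued_space : fspace C := FSpace glued_sheaf.

End Glued.

(* A (locally closed) subset of affine space, with the functions that are
   locally quotients of polynomials. *)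

Section SubAffine.
Variables (C : fieldType) (n : nat) (S : set 'rV[C]_n).

Definition sub_point : Type := {x : 'rV[C]_n | S x}.

Definition peval (p : mpoly n C) (x : 'rV[C]_n) : C :=
  meval (fun i => x 0 i) p.

Definition polynomial_fun (f : sub_point -> C) : Prop :=
  exists p, forall x, f x = peval p (sval x).

Fact polynomial_cst (i : unit) c : polynomial_fun (fun=> c).
Proof. by exists (mpolyC n c) => x; rewrite /peval mevalC. Qed.

Fact polynomial_add (i : unit) f g : polynomial_fun f -> polynomial_fun g ->
  polynomial_fun (fun x => f x + g x).
Proof.
move=> [p pE] [q qE]; exists (p + q) => x.
by rewrite pE qE /peval mevalD.
Qed.

Fact polynomial_mul (i : unit) f g : polynomial_fun f -> polynomial_fun g ->
  polynomial_fun (fun x => f x * g x).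
Proof.
move=> [p pE] [q qE]; exists (p * q) => x.
by rewrite pE qE /peval mevalM.
Qed.

Definition sub_affine : fspace C := glued_space
  (@Atlas C sub_point unit (fun=> setT) (fun=> polynomial_fun)
     polynomial_cst polynomial_add polynomial_mul).

End SubAffine.

Definition zero_locus (C : fieldType) n (I : set (mpoly n C)) :
    set 'rV[C]_n :=
  [set x | forall p, I p -> peval p x = 0].

Section Varieties.
Variable C : fieldType.

(* Morphism from the open subspace D of X (openness of D is the case V = setT)
   to Y; the values of f outside D are irrelevant. *)
Definition regular_map_on (X Y : fspace C) (D : set X) (f : X -> Y) : Prop :=
  forall V : set Y, open V ->
    open (D `&` f @^-1` V) /\
    forall h, regular V h -> regular (D `&` f @^-1` V) (h \o f).

Definition regular_map (X Y : fspace C) (f : X -> Y) : Prop :=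
  regular_map_on setT f.

Definition affine_open (X : fspace C) (U : set X) : Prop :=
  exists (n : nat) (I : set (mpoly n C))
    (f : X -> sub_affine (zero_locus I)) (g : sub_affine (zero_locus I) -> X),
    [/\ regular_map_on U f, regular_map g,
        forall x, U x -> g (f x) = x &
        forall z, U (g z) /\ f (g z) = z].

Definition irreducible_set (T : topologicalType) (A : set T) : Prop :=
  A !=set0 /\
  forall U V : set T, open U -> open V ->
    A `&` U !=set0 -> A `&` V !=set0 -> A `&` (U `&` V) !=set0.

(* The Zariski topology of the product variety X x Y: a basis is given by the
   principal open subsets of U x V defined by elements of the image of
   O(U) (x) O(V). *)
Definition prod_fun (X Y : fspace C) (U : set X) (V : set Y)
    (h : X -> Y -> C) : Prop :=
  exists (k : nat) (f : 'I_k -> X -> C) (g : 'I_k -> Y -> C),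
    [/\ forall i, regular U (f i), forall i, regular V (g i) &
        forall x y, h x y = \sum_i f i x * g i y].

Definition prod_open (X Y : fspace C) (W : set (X * Y)) : Prop :=
  forall x y, W (x, y) ->
    exists (U : set X) (V : set Y) (h : X -> Y -> C),
      [/\ open U /\ U x, open V /\ V y, prod_fun U V h, h x y != 0 &
          forall x' y', U x' -> V y' -> h x' y' != 0 -> W (x', y')].

Definition prod_closed (X Y : fspace C) (W : set (X * Y)) : Prop :=
  prod_open (~` W).

Definition separated_variety (X : fspace C) : Prop :=
  prod_closed [set xy : X * X | xy.1 = xy.2].

Record variety (X : fspace C) : Prop := Variety {
  variety_irreducible : irreducible_set [set: X];
  variety_affine_cover : exists (k : nat) (U : 'I_k -> set X),
    (forall i, affine_open (U i)) /\ forall x, exists i, U i x;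
  variety_separated : separated_variety X
}.

Definition complete (X : fspace C) : Prop :=
  forall Y : fspace C, variety Y ->
  forall W : set (X * Y), prod_closed W -> closed (snd @` W).

Definition closed_chain (X : fspace C) (e : nat) : Prop :=
  exists Z : nat -> set X,
    (forall i, (i <= e)%N -> closed (Z i) /\ irreducible_set (Z i)) /\
    (forall i, (i < e)%N -> Z i `<` Z i.+1).

Definition krull_dim (X : fspace C) (d : nat) : Prop :=
  closed_chain X d /\ forall e, closed_chain X e -> (e <= d)%N.

(* Representatives of germs in the maximal ideal m_x of the local ring at x. *)
Definition max_ideal (X : fspace C) (x : X) (f : X -> C) : Prop :=
  (exists U : set X, [/\ open U, U x & regular U f]) /\ f x = 0.

Definition max_ideal_sq (X : fspace C) (x : X) (f : X -> C) : Prop :=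
  exists (k : nat) (a b : 'I_k -> X -> C),
    [/\ forall i, max_ideal x (a i), forall i, max_ideal x (b i) &
        \forall y \near x, f y = \sum_i a i y * b i y].

(* The cotangent space m_x / m_x^2 has dimension d. *)
Definition cotangent_dim (X : fspace C) (x : X) (d : nat) : Prop :=
  exists b : 'I_d -> X -> C,
    (forall i, max_ideal x (b i)) /\
    forall f, max_ideal x f ->
      exists! c : 'rV[C]_d,
        max_ideal_sq x (fun y => f y - \sum_i c 0 i * b i y).

Definition nonsingular (X : fspace C) : Prop :=
  exists d, krull_dim X d /\ forall x : X, cotangent_dim x d.

End Varieties.

Section Versality.
Variables (C : fieldType) (gT : finGroupType).

Record faithful_variety (X : fspace C) (act : gT -> X -> X) : Prop :=
  FaithfulVariety {
  gvariety_variety : variety X;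
  gvariety_regular : forall g, regular_map (act g);
  gvariety_act1 : forall x, act 1%g x = x;
  gvariety_actM : forall g h x, act (g * h)%g x = act g (act h x);
  gvariety_faithful : forall g, (forall x, act g x = x) -> g = 1%g
}.

(* A G-equivariant rational map from Y to the G-invariant open subset U of X,
   represented by a morphism f defined on a nonempty open subset D of Y. *)
Definition equivariant_rational_map (Y X : fspace C)
    (actY : gT -> Y -> Y) (actX : gT -> X -> X) (U : set X)
    (D : set Y) (f : Y -> X) : Prop :=
  [/\ open D /\ D !=set0, regular_map_on D f, forall y, D y -> U (f y) &
      forall g y, D y -> D (actY g y) -> f (actY g y) = actX g (f y)].

Definition versal (X : fspace C) (act : gT -> X -> X) : Prop :=
  faithful_variety act /\
  forall (Y : fspace C) (actY : gT -> Y -> Y), faithful_variety actY ->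
  forall U : set X, open U -> U !=set0 ->
    (forall g x, U x -> U (act g x)) ->
    exists (D : set Y) (f : Y -> X),
      equivariant_rational_map actY act U D f.

End Versality.

(* Pairing between M = Hom(N, Z) and N = Z^n, both written as row vectors
   (and its extension to real scalars). *)
Definition pairing (A : pzRingType) n (m v : 'rV[A]_n) : A :=
  \sum_i m 0 i * v 0 i.

Section ConeGeometry.
Variables (R : realType) (n : nat).

Definition cone_span (r : nat) (u : 'I_r -> 'rV[int]_n) (S : {set 'I_r}) :
    set 'rV[R]_n :=
  [set v | exists c : 'I_r -> R, (forall i, 0 <= c i) /\
     v = \sum_(i in S) c i *: map_mx intr (u i)].


Definition strongly_convex (s : set 'rV[R]_n) : Prop :=
  forall v, s v -> s (- v) -> v = 0.

Definition is_face (t s : set 'rV[R]_n) : Prop :=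
  exists m : 'rV[R]_n, (forall v, s v -> 0 <= pairing m v) /\
    t = s `&` [set v | pairing m v = 0].

End ConeGeometry.

Arguments cone_span R {n r} u S.

(* A fan in N = Z^n.  The set of rays Delta(1) is enumerated by 'I_nrays via
   primitive generators, and a cone is encoded by the set of its rays. *)
Record fan (R : realType) (n : nat) := Fan {
  nrays : nat;
  ray : 'I_nrays -> 'rV[int]_n;
  cones : {set {set 'I_nrays}};
  ray_primitive : forall i (d : int) w, ray i = d *: w -> `|d| = 1;
  ray_inj : injective ray;
  cones_neq0 : cones != finset.set0;
  cones_ray : forall i, finset.set1 i \in cones;
  cones_strongly_convex : forall S, S \in cones ->
    strongly_convex (cone_span R ray S);
  cones_face : forall S (t : set 'rV[R]_n), S \in cones ->
    is_face t (cone_span R ray S) ->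
    exists2 S', S' \in cones & t = cone_span R ray S';
  cones_inter : forall S S', S \in cones -> S' \in cones ->
    is_face (cone_span R ray S `&` cone_span R ray S') (cone_span R ray S)
}.

Arguments ray {R n} f i.

Section Toric.
Variables (C : fieldType) (R : realType) (n : nat) (D : fan R n).

Definition in_dual (S : {set 'I_(nrays D)}) (m : 'rV[int]_n) : bool :=
  [forall i in S, 0 <= pairing m (ray D i)].

Definition in_perp (S : {set 'I_(nrays D)}) (m : 'rV[int]_n) : bool :=
  [forall i in S, pairing m (ray D i) == 0].

(* By the orbit-cone correspondence a point of X(Delta) lies in a unique torus
   orbit O(tau) = Hom(tau^perp /\ M, C^x), and X(Delta) is the disjoint union
   of the orbits.  The homomorphism is extended by zero to M, so that for every
   cone sigma having tau as a face its restriction to sigma^vee /\ M is the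
   monoid homomorphism sigma^vee /\ M -> (C, .) given by the point of
   U_sigma = Spec C[sigma^vee /\ M]. *)
Record toric_point := ToricPoint {
  tcone : {set 'I_(nrays D)};
  tval : 'rV[int]_n -> C;
  tcone_in : tcone \in cones D;
  tval_neq0 : forall m, (tval m != 0) = in_perp tcone m;
  tval_mul : forall m m', in_perp tcone m -> in_perp tcone m' ->
    tval (m + m') = tval m * tval m'
}.

Definition toric_index : Type := {S : {set 'I_(nrays D)} | S \in cones D}.

Definition toric_chart (s : toric_index) : set toric_point :=
  [set x | tcone x \subset sval s].

Definition toric_coord (s : toric_index) (f : toric_point -> C) : Prop :=
  exists l : seq (C * 'rV[int]_n), all (fun cm => in_dual (sval s) cm.2) l /\
    forall x, toric_chart s x -> f x = \sum_(cm <- l) cm.1 * tval x cm.2.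

Lemma pairingDl m m' (v : 'rV[int]_n) :
  pairing (m + m') v = pairing m v + pairing m' v.
Proof.
by rewrite /pairing -big_split; apply: eq_bigr => i _; rewrite mxE mulrDl.
Qed.

Fact in_perp0 S : in_perp S 0.
Proof.
apply/forall_inP => i _; apply/eqP; rewrite /pairing big1 // => j _.
by rewrite mxE mul0r.
Qed.

Fact tval0 x : tval x 0 = 1.
Proof.
have t0 : tval x 0 != 0 by rewrite tval_neq0 in_perp0.
apply: (mulfI t0).
by rewrite -tval_mul ?in_perp0 // addr0 mulr1.
Qed.

Fact in_perpD (S S' : {set 'I_(nrays D)}) m m' : S' \subset S ->
  in_dual S m -> in_dual S m' ->
  in_perp S' (m + m') = in_perp S' m && in_perp S' m'.
Proof.
move=> /fintype.subsetP S'S /forall_inP m0 /forall_inP m'0.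
apply/idP/andP => [/forall_inP h|[/forall_inP h /forall_inP h']].
  split; apply/forall_inP => i iS'; have := h i iS';
  by rewrite pairingDl paddr_eq0 ?m0 ?m'0 ?S'S // => /andP[].
apply/forall_inP => i iS'.
by rewrite pairingDl (eqP (h i iS')) (eqP (h' i iS')) addr0.
Qed.

Fact tvalD (s : toric_index) x m m' : toric_chart s x ->
  in_dual (sval s) m -> in_dual (sval s) m' ->
  tval x (m + m') = tval x m * tval x m'.
Proof.
move=> sx sm sm'; have [/andP[p p']|] :=
  boolP (in_perp (tcone x) m && in_perp (tcone x) m'); first exact: tval_mul.
move=> np; have : tval x (m + m') == 0.
  by rewrite -[_ == _]negbK tval_neq0 (in_perpD sx).
move/eqP->; apply/esym/eqP; rewrite mulf_eq0.
by rewrite -[tval x m == 0]negbK -[tval x m' == 0]negbK !tval_neq0 -negb_and.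
Qed.

Fact toric_coord_cst s c : toric_coord s (fun=> c).
Proof.
exists [:: (c, 0)]; split.
  rewrite /= andbT; apply/forall_inP => i iS.
  by rewrite (eqP (forall_inP (in_perp0 (sval s)) i iS)).
by move=> x _; rewrite big_seq1 tval0 mulr1.
Qed.

Fact toric_coord_add s f g : toric_coord s f -> toric_coord s g ->
  toric_coord s (fun x => f x + g x).
Proof.
move=> [l [lS fE]] [k [kS gE]]; exists (l ++ k); split.
  by rewrite all_cat lS.
by move=> x sx; rewrite big_cat /= fE // gE.
Qed.

Fact toric_coord_mul s f g : toric_coord s f -> toric_coord s g ->
  toric_coord s (fun x => f x * g x).
Proof.
move=> [l [lS fE]] [k [kS gE]].
exists [seq (a.1 * b.1, a.2 + b.2) | a <- l, b <- k]; split.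
  apply/allP => _ /allpairsP[[a b] [/= al bk ->]] /=.
  have /forall_inP a0 := allP lS a al; have /forall_inP b0 := allP kS b bk.
  by apply/forall_inP => i iS; rewrite pairingDl addr_ge0 ?a0 ?b0.
move=> x sx; rewrite fE // gE // big_allpairs_dep /= mulr_suml.
apply: eq_big_seq => a al; rewrite mulr_sumr; apply: eq_big_seq => b bk.
by rewrite (tvalD sx (allP lS a al) (allP kS b bk)) mulrACA.
Qed.

Definition toric_variety : fspace C := glued_space
  (@Atlas C toric_point toric_index toric_chart toric_coord
     toric_coord_cst toric_coord_add toric_coord_mul).

(* V - Z, with V = C^{Delta(1)} and Z the zero set of the irrelevant ideal. *)
Definition irrelevant_compl : set 'rV[C]_(nrays D) :=
  [set z | exists2 S, S \in cones D & \prod_(i | i \notin S) z 0 i != 0].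

Definition cox_space : fspace C := sub_affine irrelevant_compl.

Definition cox_coord (z : cox_space) (i : 'I_(nrays D)) : C := sval z 0 i.

(* The torus quotient map V - Z -> X(Delta), as a graph: on the chart of sigma
   it is dual to chi^m |-> prod_rho x_rho ^ <m, u_rho>. *)
Definition cox_quotient (z : cox_space) (x : toric_variety) : Prop :=
  forall s : toric_index, (forall i, i \notin sval s -> cox_coord z i != 0) ->
    toric_chart s x /\
    forall m, in_dual (sval s) m ->
      tval x m = \prod_i cox_coord z i ^ pairing m (ray D i).

(* K = Hom(Pic(X), C^x): as Pic(X) is Div_T(X) = Z^{Delta(1)} modulo the
   divisors div(chi^m) = sum_rho <m, u_rho> D_rho, an element of K is given by
   the images t_rho of the classes [D_rho]. *)
Definition pic_dual (t : 'I_(nrays D) -> C) : Prop :=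
  (forall i, t i != 0) /\
  forall m : 'rV[int]_n, \prod_i t i ^ pairing m (ray D i) = 1.

Definition K_action (k : cox_space -> cox_space) : Prop :=
  exists2 t, pic_dual t &
    forall z i, cox_coord (k z) i = t i * cox_coord z i.

(* The normaliser of K in the automorphism group of V - Z. *)
Definition aut_tilde (phi : cox_space -> cox_space) : Prop :=
  exists psi : cox_space -> cox_space,
    [/\ regular_map phi /\ regular_map psi, cancel phi psi /\ cancel psi phi &
        forall k, K_action k ->
          K_action (phi \o k \o psi) /\ K_action (psi \o k \o phi)].

(* pi phi = a, i.e. phi lifts the automorphism a of X. *)
Definition aut_proj (phi : cox_space -> cox_space)
    (a : toric_variety -> toric_variety) : Prop :=
  forall z x, cox_quotient z x -> cox_quotient (phi z) (a x).

Section Extension.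
Variables (gT : finGroupType) (act : gT -> toric_variety -> toric_variety).

Definition cox_ext (phi : cox_space -> cox_space) : Prop :=
  aut_tilde phi /\ exists g, aut_proj phi (act g).

Definition cox_ext_splits : Prop :=
  exists s : gT -> cox_space -> cox_space,
    [/\ forall g, cox_ext (s g),
        forall g h, s (g * h)%g = s g \o s h &
        forall g, aut_proj (s g) (act g)].

End Extension.
End Toric.

(* Main.v *)
(* Completeness and non-singularity are used only through the fan: every lattice
   vector lies in a cone whose rays form a basis of N.  Completeness puts every
   lattice vector in some cone, by taking limits of one-parameter subgroups; the
   cotangent spaces at the torus-fixed points then show that a full-dimensional
   cone is smooth.

   A regular map to X, defined on a dense open set of affine space and meeting
   the torus, lifts to a tuple of polynomials, whose orders along each prime p
   are read off from the orders of the characters: they give a lattice vector,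
   written in the basis of a cone containing it.  The lift is unique up to K.

   If X is versal, lift an equivariant map from the regular representation to the
   open set of points whose orbit stays in the torus.  Each g in G has a unique
   lift to V - Z compatible with this polynomial tuple, and uniqueness makes these
   lifts a homomorphism.

   Conversely, a splitting acts on V by polynomial maps.  Averaging a positive
   grading of V coming from a cocharacter of K makes it G-invariant.  For this
   grading the coordinates of weight w are transformed affinely modulo those of
   smaller weight, so an equivariant partition of unity on Y, with weights summing
   to 1, yields an equivariant rational map from Y to V, weight by weight, with a
   prescribed value at one point; its composite with V - Z -> X meets U. *)

Require Import Defs.
From mathcomp Require Import all_boot all_order all_algebra all_fingroup.
From mathcomp Require Import boolp classical_sets topology reals.
From mathcomp.multinomials Require mpoly.
From mathcomp.real_closed Require Import complex.
From mathcomp Require Import ring zify.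
Import -(notations) mpoly.
Import Defs.

Set Implicit Arguments.
Unset Strict Implicit.
Unset Printing Implicit Defensive.

Import Order.TTheory GRing.Theory Num.Theory.

Local Open Scope ring_scope.

(** * Unique factorization in polynomial rings *)

(** The action need not preserve the torus, so its lifts to V - Z are polynomial rather than linear,
    and one average over the group does not make a map equivariant. A grading replaces linearity:
    when all weights are positive and the group respects them, a component of weight w contains the
    variables of weight w only linearly, next to a polynomial in lighter ones. Positivity comes from
    completeness, through a relation among the rays with strictly positive coefficients. Polynomial
    tuples can stand for maps because polynomial rings are factorial: the order along p of a
    character composed with f is additive in the character, hence a vector of N, and smoothness
    makes its expression by rays of one cone unique. Tuples are controlled only away from
    codimension 2, so each prime must have a zero that lands in V - Z. This weak Nullstellensatz,
    for principal primes only, is obtained from resultants; it also cancels the denominators of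
    regular functions on V - Z. *)

Section Divisibility.
Variable R : idomainType.
Implicit Types (a b c p : R) (s : seq R).

Definition divides p a := exists c, a = c * p.

Definition prime_element p :=
  [/\ p != 0, p \isn't a GRing.unit &
      forall a b, divides p (a * b) -> divides p a \/ divides p b].

Definition factorial_ring :=
  forall a, a != 0 -> exists u s,
    [/\ u \is a GRing.unit, forall p, p \in s -> prime_element p &
        a = u * \prod_(p <- s) p].

Lemma divides0 p : divides p 0.
Proof. by exists 0; rewrite mul0r. Qed.

Lemma dividesD p a b : divides p a -> divides p b -> divides p (a + b).
Proof. by move=> [c ->] [d ->]; exists (c + d); rewrite mulrDl. Qed.

Lemma dividesN p a : divides p a -> divides p (- a).
Proof. by move=> [c ->]; exists (- c); rewrite mulNr. Qed.

Lemma divides_mull p a b : divides p a -> divides p (b * a).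
Proof. by move=> [c ->]; exists (b * c); rewrite mulrA. Qed.

Lemma divides_mulr p a b : divides p a -> divides p (a * b).
Proof. by rewrite mulrC; exact: divides_mull. Qed.

Lemma divides_trans p q a : divides p q -> divides q a -> divides p a.
Proof. by move=> pq [c ->]; exact: divides_mull. Qed.

Lemma prime_divides_prod p s : prime_element p ->
  divides p (\prod_(q <- s) q) -> exists2 q, q \in s & divides p q.
Proof.
move=> [p0 pU pP]; elim: s => [|q s IHs].
  rewrite big_nil => -[c c1]; case/negP: pU.
  by apply/unitrPr; exists c; rewrite mulrC.
rewrite big_cons => /pP[pq|/IHs[r rs pr]].
  by exists q; rewrite ?mem_head.
by exists r; rewrite // inE rs orbT.
Qed.

Lemma prime_divides_prodI (I : finType) (P : pred I) (F : I -> R) p :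
  prime_element p -> divides p (\prod_(i | P i) F i) ->
  exists2 i, P i & divides p (F i).
Proof.
move=> pp; rewrite -big_filter -(big_map F xpredT id).
case/(prime_divides_prod pp) => q /mapP[j].
by rewrite mem_filter => /andP[Pj _] -> ?; exists j.
Qed.

End Divisibility.

Section Gauss.
Variable R : idomainType.
Implicit Types (f g h : {poly R}) (p c : R).

Lemma divides_coef p f : divides p%:P f -> forall i, divides p f`_i.
Proof. by move=> [g ->] i; exists g`_i; rewrite coefMC. Qed.

(** If [p] divides [f * g], it divides the product of the leading coefficients, hence one of them;
    removing that leading term keeps the divisibility and lowers the total size, which drives the
    induction. *)
Lemma prime_polyC p : prime_element p -> prime_element p%:P.
Proof.
move=> [p0 pU pP]; split; first by rewrite polyC_eq0.
  by rewrite poly_unitE coefC /= (negPf pU) andbF.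
suff key n f g : (size f + size g < n)%N -> divides p%:P (f * g) ->
    divides p%:P f \/ divides p%:P g.
  by move=> f g; exact: (key _.+1).
elim: n f g => // n IHn f g sfg pfg.
have [->|f0] := eqVneq f 0; first by left; exact: divides0.
have [->|g0] := eqVneq g 0; first by right; exact: divides0.
have /pP[pl|pl] : divides p (lead_coef f * lead_coef g).
    by rewrite -lead_coefM; exact: divides_coef.
- have pf : divides p%:P (lead_coef f *: 'X^((size f).-1)).
    by case: pl => c ->; exists (c *: 'X^((size f).-1));
      rewrite [RHS]mulrC mul_polyC scalerA [p * c]mulrC.
  have [||pf'|] := IHn (f - lead_coef f *: 'X^((size f).-1)) g.
  + apply: (leq_trans _ (sfg : (size f + size g <= n)%N)).
    rewrite ltn_add2r.
    rewrite -[X in (_ < X)%N]prednK ?size_poly_gt0 // ltnS.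
    apply/leq_sizeP => j; rewrite leq_eqVlt => /predU1P[<-|lj].
      by rewrite coefB coefZ coefXn eqxx mulr1 subrr.
    rewrite coefB coefZ coefXn gtn_eqF // mulr0 subr0 nth_default //.
    by move: lj; case: (size f).
  + rewrite mulrBl; apply: dividesD => //; apply: dividesN.
    exact: divides_mulr.
  + by left; rewrite -[f](subrK (lead_coef f *: 'X^((size f).-1)));
      exact: dividesD.
  + by right.
have pg : divides p%:P (lead_coef g *: 'X^((size g).-1)).
  by case: pl => c ->; exists (c *: 'X^((size g).-1));
    rewrite [RHS]mulrC mul_polyC scalerA [p * c]mulrC.
have [||?|pg'] := IHn f (g - lead_coef g *: 'X^((size g).-1)).
- apply: (leq_trans _ (sfg : (size f + size g <= n)%N)).
  rewrite ltn_add2l.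
  rewrite -[X in (_ < X)%N]prednK ?size_poly_gt0 // ltnS.
  apply/leq_sizeP => j; rewrite leq_eqVlt => /predU1P[<-|lj].
    by rewrite coefB coefZ coefXn eqxx mulr1 subrr.
  rewrite coefB coefZ coefXn gtn_eqF // mulr0 subr0 nth_default //.
  by move: lj; case: (size g).
- rewrite mulrBr; apply: dividesD => //; apply: dividesN.
  exact: divides_mull.
- by left.
- by right; rewrite -[g](subrK (lead_coef g *: 'X^((size g).-1)));
    exact: dividesD.
Qed.

Lemma prime_of_polyC p : prime_element p%:P -> prime_element p.
Proof.
move=> [p0 pU pP]; split; first by rewrite polyC_eq0 in p0.
  apply: contra pU => pU; rewrite poly_unitE coefC /= pU andbT.
  by rewrite size_polyC -polyC_eq0 p0.
move=> a b [c abE]; have /pP[] : divides p%:P (a%:P * b%:P).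
    by exists c%:P; rewrite -!polyCM abE.
- by move/divides_coef/(_ 0%N); rewrite coefC; left.
- by move/divides_coef/(_ 0%N); rewrite coefC; right.
Qed.

Definition primitive f := forall p, prime_element p -> ~ divides p%:P f.

Hypothesis Rfact : factorial_ring R.

(** Each prime constant pulled out of [f] also leaves the factor list of its leading coefficient, so
    the length of that list bounds the number of extractions; no gcd of the coefficients has to be
    formed. *)
Lemma content_decomp f : f != 0 ->
  exists c g, [/\ c != 0, primitive g & f = c *: g].
Proof.
move=> f0; have l0 : lead_coef f != 0 by rewrite lead_coef_eq0.
have [u [s [uU sP]]] := Rfact l0.
have [k] := ubnP (size s); elim: k s f f0 l0 sP => // k IHk s f f0 l0 sP sk lE.
have [[p' [p'p p'f]]|npf] :=
    pselect (exists p', prime_element p' /\ divides p'%:P f); last first.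
  by exists 1, f; split; rewrite ?oner_neq0 ?scale1r // => q qp qf;
    apply: npf; exists q.
have [p'0 p'U p'P] := p'p.
(* p' divides the leading coefficient, so it is associated with some q in s *)
have [q qs qf] : exists2 q, q \in s & divides q%:P f.
  have : divides p' (u * \prod_(q <- s) q).
    by rewrite -lE; exact: divides_coef.
  move=> /p'P[[c cE]|].
    by case/negP: p'U; move: uU; rewrite cE unitrM => /andP[].
  move=> /(prime_divides_prod p'p)[q qs [c qE]]; exists q => //.
  have [q0 qU qP] := sP q qs.
  have [[d dE]|[d dE]] : divides q c \/ divides q p'.
    by apply: qP; exists 1; rewrite mul1r.
    have pd : p' * d = 1.
      by apply: (mulfI q0); rewrite mulr1 {2}qE dE; ring.
    by case/negP: p'U; apply/unitrPr; exists d.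
  by apply: divides_trans p'f; exists d%:P; rewrite -polyCM dE.
have [q0 qU qP] := sP q qs; have [g fE] := qf.
have g0 : g != 0 by apply: contraNneq f0 => gz; rewrite fE gz mul0r.
have [||||c [h [c0 hp gE]]] := IHk (rem q s) g g0.
- by rewrite lead_coef_eq0.
- by move=> r /mem_rem; exact: sP.
- by rewrite size_rem //; case: (s) qs sk.
- apply: (mulIf q0); rewrite -[in LHS](lead_coefC q) -lead_coefM -fE lE.
  by rewrite (perm_big _ (perm_to_rem qs)) big_cons /=; ring.
exists (q * c), h; split=> //; first exact: mulf_neq0.
by rewrite fE gE [LHS]mulrC mul_polyC scalerA.
Qed.

(** Gauss's lemma: each prime factor of the scalar [c] divides [k * f] but not the primitive [f], so
    it divides [k] and can be cancelled. This turns divisibility over the field of fractions into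
    divisibility over [R]. *)
Lemma primitive_cancel f c g k : primitive f -> c != 0 -> c *: g = k * f ->
  divides f g.
Proof.
move=> fp c0; have [u [s [uU sP ->]]] := Rfact c0.
elim: s g k sP => [|p s IHs] g k sP.
  rewrite big_nil mulr1 => E; exists (u^-1 *: k).
  by rewrite -scalerAl -E scalerA mulVr // scale1r.
have pp : prime_element p by apply: sP; rewrite mem_head.
rewrite big_cons => E.
have : divides p%:P (k * f).
  rewrite -E; exists ((u * \prod_(j <- s) j) *: g).
  by rewrite [RHS]mulrC mul_polyC scalerA; congr (_ *: _); ring.
case: (prime_polyC pp) => _ _ pP /pP[[k' kE]|/(fp p pp)//].
apply: (IHs _ k') => [q qs|]; first by apply: sP; rewrite inE qs orbT.
have p0 : p%:P != 0 by rewrite polyC_eq0; case: pp.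
apply: (mulfI p0); rewrite [RHS]mulrA [_ * k']mulrC -kE -E.
by rewrite mul_polyC scalerA; congr (_ *: _); ring.
Qed.

Lemma primitive_size1 f : f != 0 -> primitive f -> (size f <= 1)%N ->
  f \is a GRing.unit.
Proof.
move=> f0 fp /size1_polyC fE; move: f0 fp; rewrite fE polyC_eq0.
set c := f`_0 => c0 fp; have [u [[|p s] [uU sP cE]]] := Rfact c0.
  by rewrite poly_unitE size_polyC c0 coefC /= cE big_nil mulr1.
case: (fp p); first by apply: sP; rewrite mem_head.
by exists (u * \prod_(q <- s) q)%:P; rewrite -polyCM cE big_cons; congr _%:P; ring.
Qed.

Lemma primitive_divides f g : primitive f -> divides g f -> primitive g.
Proof. by move=> fp gf p pp pg; apply: (fp p pp); exact: divides_trans gf. Qed.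

(** [irreducible_poly], [coprimep] and [%|] allow scalar factors, so they speak about the field of
    fractions; [primitive_cancel] removes these scalars. *)
Lemma primitive_irreducible f : primitive f -> irreducible_poly f ->
  prime_element f.
Proof.
move=> fp [sf irr]; have f0 : f != 0 by rewrite -size_poly_gt0 ltnW.
split=> //; first by rewrite poly_unitE; case: (size f) sf => [|[]].
move=> a b [c abE]; have [cp|ncp] := boolP (coprimep f a).
  right; have : f %| a * b by rewrite abE dvdp_mull.
  rewrite Gauss_dvdpr // => /Pdiv.Idomain.dvdpP[[d k] /= d0 E].
  exact: primitive_cancel E.
left; have : f %| a.
  have gf : gcdp f a %= f by apply: irr; rewrite ?dvdp_gcdl.
  by rewrite -(eqp_dvdl _ gf) dvdp_gcdr.
by move=> /Pdiv.Idomain.dvdpP[[d k] /= d0 E]; exact: primitive_cancel E.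
Qed.

Theorem factorial_poly : factorial_ring {poly R}.
Proof.
suff prim f : f != 0 -> primitive f -> exists (u : {poly R}) (s : seq {poly R}), [/\ u \is a GRing.unit,
    forall h, h \in s -> prime_element h & f = u * \prod_(h <- s) h].
  move=> f f0; have [c [g [c0 gp fE]]] := content_decomp f0.
  have g0 : g != 0 by apply: contraNneq f0 => gz; rewrite fE gz scaler0.
  have [u [s [uU sP gE]]] := prim g g0 gp.
  have [v [t [vU tP cE]]] := Rfact c0.
  exists (v%:P * u), ([seq p%:P | p <- t] ++ s); split.
  - rewrite unitrM uU andbT poly_unitE size_polyC coefC /= vU andbT.
    by rewrite (contraTneq _ vU) // => ->; rewrite unitr0.
  - move=> p; rewrite mem_cat => /orP[/mapP[q qt ->]|]; last exact: sP.
    by apply: prime_polyC; exact: tP.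
  - rewrite fE gE cE -mul_polyC polyCM rmorph_prod big_cat big_map /=; ring.
have [k] := ubnP (size f); elim: k f => // k IHk f sfk f0 fp.
have [sf|sf] := leqP (size f) 1.
  by exists f, [::]; split; rewrite ?big_nil ?mulr1 //; exact: primitive_size1.
have [irr|nirr] := pselect (irreducible_poly f).
  exists 1, [:: f]; split; rewrite ?unitr1 ?big_seq1 ?mul1r // => p.
  by rewrite inE => /eqP ->; exact: primitive_irreducible.
have [g [sg gf ngf]] : exists g, [/\ size g != 1, g %| f & ~~ (g %= f)].
  apply: contrapT => H; apply: nirr; split=> // g sg gf.
  by apply: contrapT => /negP ngf; apply: H; exists g.
have g0 : g != 0 by apply: contraTneq gf => ->; rewrite dvd0p.
have [c [h [c0 hp gE]]] := content_decomp g0.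
have /Pdiv.Idomain.dvdpP[[d q] /= d0 E] := gf.
(* The divisor [g] is known only up to scalars; its primitive part [h] divides [f] over [R] itself,
   and the cofactor is again primitive. *)
have [k' fE] : divides h f.
  apply: (primitive_cancel (k := c *: q) hp d0).
  by rewrite E gE -scalerAr -scalerAl.
have k'0 : k' != 0 by apply: contraNneq f0 => z; rewrite fE z mul0r.
have h0 : h != 0 by apply: contraNneq f0 => z; rewrite fE z mulr0.
have sh : (1 < size h)%N.
  by move: sg; rewrite gE size_scale // -size_poly_gt0 in h0 *;
    case: (size h) h0 => [|[]].
have sk' : (1 < size k')%N.
  rewrite ltnNge; apply: contra ngf => /size1_polyC k'E.
  apply/Pdiv.Idomain.eqpP; exists (c^-1 * 0 + k'`_0, c); rewrite /= ?mulr0 ?add0r.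
    by rewrite c0 andbT -polyC_eq0 -k'E.
  by rewrite fE gE [in RHS]k'E mul_polyC !scalerA mulrC.
have sfE : size f = (size k' + size h).-1 by rewrite fE size_mul.
have sh' : (size h < k)%N.
  by apply: (leq_trans _ (sfk : (size f <= k)%N)); rewrite sfE; lia.
have sk'' : (size k' < k)%N.
  by apply: (leq_trans _ (sfk : (size f <= k)%N)); rewrite sfE; lia.
have kp : primitive k'.
  by apply: primitive_divides fp _; exists h; rewrite mulrC -fE.
have [u [s [uU sP hE]]] := IHk h sh' h0 hp.
have [v [t [vU tP kE]]] := IHk k' sk'' k'0 kp.
exists (v * u), (t ++ s); split; first by rewrite unitrM vU.
- by move=> p; rewrite mem_cat => /orP[/tP|/sP].
- by rewrite fE hE kE big_cat /=; ring.
Qed.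

End Gauss.

Section Transfer.
Variables (R S : idomainType) (f : {rmorphism R -> S}) (g : {rmorphism S -> R}).
Hypotheses (fK : cancel f g) (gK : cancel g f).

Lemma divides_morph a b : divides a b -> divides (f a) (f b).
Proof. by move=> [c ->]; exists (f c); rewrite rmorphM. Qed.

Lemma divides_morphK a b : divides (f a) (f b) -> divides a b.
Proof. by move=> [c cE]; exists (g c); rewrite -[b]fK cE rmorphM fK. Qed.

Lemma prime_iso p : prime_element p -> prime_element (f p).
Proof.
move=> [p0 pU pP]; split.
- by rewrite -(rmorph0 f) (can_eq fK).
- by apply: contra pU => /(rmorph_unit g); rewrite fK.
move=> a b pab; case: (pP (g a) (g b)) => [||].
- by apply: divides_morphK; rewrite rmorphM !gK.
- by move/divides_morph; rewrite gK; left.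
- by move/divides_morph; rewrite gK; right.
Qed.

Lemma factorial_iso : factorial_ring R -> factorial_ring S.
Proof.
move=> Rf a a0; have ga0 : g a != 0 by rewrite -(rmorph0 g) (can_eq gK).
have [u [s [uU sP aE]]] := Rf _ ga0; exists (f u), (map f s); split.
- exact: rmorph_unit.
- by move=> _ /mapP[q qs ->]; apply: prime_iso; exact: sP.
- by rewrite -[a]gK aE rmorphM rmorph_prod big_map.
Qed.

End Transfer.

Lemma muni_sum n (R : nzRingType) I (s : seq I) (F : I -> mpoly n.+1 R) :
  muni (\sum_(i <- s) F i) = \sum_(i <- s) muni (F i).
Proof. exact: raddf_sum. Qed.

Lemma mwiden_sum n (R : nzRingType) I (s : seq I) (F : I -> mpoly n R) :
  mwiden (\sum_(i <- s) F i) = \sum_(i <- s) mwiden (F i).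
Proof. exact: raddf_sum. Qed.

Section MultivariateIso.
Variables (n : nat) (R : idomainType).

Let widen := widen_ord (leqnSn n).

(** Inverse of [muni]: widen the coefficients and substitute the last variable. The pair carries
    factoriality and primality through an induction on the number of variables. *)
Definition munform : {rmorphism {poly mpoly n R} -> mpoly n.+1 R} :=
  GRing.RMorphism.clone _ _
    (horner_eval (mpolyX R (mnm1 ord_max)) \o map_poly (@mwiden n R)) _.

Lemma muniX m : muni (mpolyX R m) =
  mpolyX R (Multinom [tuple m (widen i) | i < n]) *: 'X^(m ord_max).
Proof. by rewrite muniE msuppX big_seq1 mcoeffX eqxx scale1r. Qed.

Lemma mnmwiden_max (m : multinom n.+1) :
  mnm_add (mnmwiden (Multinom [tuple m (widen i) | i < n]))
    (mnm_muln (mnm1 ord_max) (m ord_max)) = m.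
Proof.
apply/mnmP => i; rewrite mnmDE mulmnE mnm1E.
have [j ->|->] := unliftP ord_max i.
  have -> : lift ord_max j = widen j by apply/val_inj; rewrite /= /bump leqNgt ltn_ord.
  by rewrite mnmwiden_widen mnmE [_ == _]gtn_eqF ?mul0n ?addn0 //= ltn_ord.
by rewrite mnmwiden_ordmax eqxx mul1n.
Qed.

Lemma munformE p : munform p =
  (map_poly (@mwiden n R) p).[mpolyX R (mnm1 ord_max)].
Proof. by []. Qed.

Lemma munform_sum I (s : seq I) (F : I -> {poly mpoly n R}) :
  munform (\sum_(i <- s) F i) = \sum_(i <- s) munform (F i).
Proof. exact: raddf_sum. Qed.

Lemma muniK : cancel (@muni n R) munform.
Proof.
move=> p; rewrite {1}(mpolyE p) muni_sum munform_sum.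
rewrite [RHS]mpolyE; apply: eq_bigr => m _; rewrite muniZ muniX munformE.
rewrite !map_polyZ map_polyXn !hornerZ hornerXn.
rewrite /= mwidenC mwidenX mul_mpolyC.
by rewrite mpolyXn -mpolyXD mnmwiden_max.
Qed.

Lemma munformK : cancel munform (@muni n R).
Proof.
move=> p; rewrite -{1}(coefK p) poly_def munform_sum muni_sum.
rewrite -[RHS]coefK poly_def; apply: eq_bigr => i _.
rewrite munformE map_polyZ map_polyXn hornerZ hornerXn muniM.
have -> a k : muni (a ^+ k) = muni a ^+ k by exact: rmorphXn.
rewrite -mul_polyC; congr (_ * _); last first.
  congr (_ ^+ _); rewrite muniX mnm1E eqxx expr1.
  have -> : Multinom [tuple mnm1 ord_max (widen j) | j < n] = mnm0.
    by apply/mnmP => j; rewrite mnmE mnm1E mnm0E [_ == _]gtn_eqF //= ltn_ord.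
  by rewrite mpolyX0 scale1r.
move: p`_i => c; change (muni (mwiden c) = c%:P).
rewrite {1}(mpolyE c) mwiden_sum muni_sum.
rewrite [in RHS](mpolyE c) (raddf_sum (@polyC _)); apply: eq_bigr => m _.
rewrite mwidenZ muniZ mwidenX muniX mnmwiden_ordmax expr0 -!mul_polyC mulr1.
rewrite -polyCM mul_mpolyC; congr (_ *: mpolyX _ _)%:P.
by apply/mnmP => j; rewrite mnmE mnmwiden_widen.
Qed.

Definition muni_morph : {rmorphism mpoly n.+1 R -> {poly mpoly n R}} :=
  GRing.RMorphism.clone _ _ (@muni n R) _.

Lemma prime_muni (p : mpoly n.+1 R) : prime_element p -> prime_element (muni p).
Proof. exact: (@prime_iso _ _ muni_morph munform muniK munformK). Qed.

Lemma divides_muni (p q : mpoly n.+1 R) : divides (muni p) (muni q) -> divides p q.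
Proof. exact: (@divides_morphK _ _ muni_morph munform muniK). Qed.

End MultivariateIso.

Lemma mevalS n (R : comNzRingType) (v : 'I_n -> R) I (s : seq I) (F : I -> mpoly n R) :
  meval v (\sum_(i <- s) F i) = \sum_(i <- s) meval v (F i).
Proof. exact: raddf_sum. Qed.

Lemma map_poly_sum (R S : nzRingType) (f : {rmorphism R -> S}) I (s : seq I)
    (F : I -> {poly R}) :
  map_poly f (\sum_(i <- s) F i) = \sum_(i <- s) map_poly f (F i).
Proof. exact: raddf_sum. Qed.

Lemma combination_root (R S : idomainType) (f : {rmorphism R -> S})
    (p q u w : {poly R}) (r : R) (a : S) : r%:P = u * p + w * q ->
  (map_poly f p).[a] = 0 -> (map_poly f q).[a] = 0 -> f r = 0.
Proof.
move=> rE pa qa; have := congr1 (fun q => (map_poly f q).[a]) rE.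
rewrite map_polyC hornerC => ->.
by rewrite rmorphD !rmorphM hornerD !hornerM pa qa !mulr0 addr0.
Qed.

Lemma meval_muni n (C : idomainType) (v : 'I_n.+1 -> C) p :
  meval v p =
  (map_poly (meval (fun i => v (widen_ord (leqnSn n) i))) (muni p)).[v ord_max].
Proof.
rewrite {1}(mpolyE p) [in RHS](mpolyE p) muni_sum.
rewrite mevalS map_poly_sum horner_sum.
apply: eq_bigr => m _; rewrite mevalZ muniZ map_polyZ hornerZ.
rewrite muniX map_polyZ map_polyXn hornerZ hornerXn /= mevalC.
congr (_ * _); rewrite !mevalX big_ord_recr /=.
by congr (_ * _); apply: eq_bigr => i _; rewrite mnmE.
Qed.

Definition extend_point n (T : Type) (v : 'I_n -> T) (a : T) (i : 'I_n.+1) : T :=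
  oapp v a (unlift ord_max i).

Lemma meval_extend n (C : idomainType) (v : 'I_n -> C) a p :
  meval (extend_point v a) p = (map_poly (meval v) (muni p)).[a].
Proof.
rewrite meval_muni {2}/extend_point unlift_none /=.
suff -> : (fun i => extend_point v a (widen_ord (leqnSn n) i)) = v by [].
apply/funext => i; rewrite /extend_point.
have -> : widen_ord (leqnSn n) i = lift ord_max i.
  by apply/val_inj; rewrite /= /bump leqNgt ltn_ord.
by rewrite liftK.
Qed.

Lemma mpoly0_const (C : nzRingType) (p : mpoly 0 C) : p = mpolyC 0 (mcoeff mnm0 p).
Proof.
apply/mpolyP => m; rewrite mcoeffC.
have -> : m = mnm0 by apply/mnmP => -[].
by rewrite eqxx mulr1.
Qed.

Lemma mpoly_unitE n (C : fieldType) (p : mpoly n C) :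
  (p \is a GRing.unit) = (p != 0) && (p == mpolyC n (mcoeff mnm0 p)).
Proof.
rewrite unfold_in /= /mpoly_unit unitfE andbC.
have [pE|//] := eqVneq p (mpolyC n (mcoeff mnm0 p)); last by rewrite !andbF.
by rewrite {2}pE mpolyC_eq0.
Qed.

Theorem factorial_mpoly n (C : fieldType) : factorial_ring (mpoly n C).
Proof.
elim: n => [|n IHn].
  move=> a a0; exists a, [::]; split; rewrite ?big_nil ?mulr1 //.
  by rewrite mpoly_unitE a0 -mpoly0_const eqxx.
exact: (@factorial_iso _ _ (@munform n C) (@muni_morph n C) (@munformK n C)
  (@muniK n C) (factorial_poly IHn)).
Qed.

(** A closed field is infinite: by induction avoid the zeros of the leading coefficient in the last
    variable, then the finitely many roots in that variable. *)
Lemma meval_neq0 n (C : closedFieldType) (p : mpoly n C) : p != 0 ->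
  exists v, meval v p != 0.
Proof.
elim: n p => [|n IHn] p p0.
  exists (fun=> 0); rewrite [p]mpoly0_const mevalC.
  by rewrite [p]mpoly0_const mpolyC_eq0 in p0.
have mp0 : muni p != 0 by rewrite -(rmorph0 (@muni n C)) (can_eq (@muniK n C)).
have [v vl] : exists v, meval v (lead_coef (muni p)) != 0.
  by apply: IHn; rewrite lead_coef_eq0.
have q0 : map_poly (meval v) (muni p) != 0.
  by rewrite -lead_coef_eq0 lead_coef_map_eq.
have [a av] := closed_nonrootP _ q0.
by exists (extend_point v a); rewrite meval_extend.
Qed.

(* Over the field of fractions of R the prime f and a polynomial g not
   divisible by f are coprime; the resultant clears the denominators. *)
Lemma prime_bezout (R : idomainType) (f g : {poly R}) :
  prime_element f -> (1 < size f)%N -> ~ divides f g ->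
  exists u v (r : R), r != 0 /\ r%:P = u * f + v * g.
Proof.
move=> [f0 fU fP] sf nfg.
have fc c : c != 0 -> ~ divides f c%:P.
  move=> c0 [k kE]; have k0 : k != 0.
    by apply: contraNneq c0 => z; rewrite -polyC_eq0 kE z mul0r.
  have := congr1 (fun q : {poly R} => size q) kE.
  rewrite size_polyC c0 size_mul // => sE.
  by move: sE sf; rewrite -size_poly_gt0 in k0; lia.
have scale_cancel c h : c != 0 -> divides f (c *: h) -> divides f h.
  by move=> c0; rewrite -mul_polyC => /fP[/(fc c c0)|].
have [sg|sg] := leqP (size g) 1.
  exists 0, 1, g`_0; rewrite mul0r add0r mul1r -size1_polyC //; split=> //.
  apply/eqP => g0; apply: nfg; rewrite (size1_polyC sg) g0.
  exact: divides0.
have [[u v] /= [_ _ E]] := resultant_in_ideal sf sg.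
exists u, v, (resultant f g); split=> //; rewrite resultant_eq0 -leqNgt.
(* If the gcd had positive degree, the prime [f] would divide it, since dividing the cofactor [k]
   contradicts the degrees; then [f] would divide [g]. *)
rewrite leqNgt; apply/negP => sd.
have d0 : gcdp f g != 0 by rewrite -size_poly_gt0 ltnW.
have /Pdiv.Idomain.dvdpP[[c k] /= c0 fE] := dvdp_gcdl f g.
have /Pdiv.Idomain.dvdpP[[e l] /= e0 gE] := dvdp_gcdr f g.
apply: nfg; apply: (scale_cancel e) => //; rewrite gE; apply: divides_mull.
have k0 : k != 0.
  by apply: contraNneq f0 => z; move: fE; rewrite z mul0r => /eqP;
    rewrite -mul_polyC mulf_eq0 polyC_eq0 (negPf c0).
have [||//] := fP k (gcdp f g).
  by rewrite -fE; exists c%:P; rewrite mul_polyC.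
move=> [q kE]; have q0 : q != 0.
  by apply: contraNneq k0 => z; rewrite kE z mul0r.
have := congr1 (fun q : {poly R} => size q) fE.
rewrite size_scale // kE size_mul ?mulf_neq0 // size_mul //.
by move: sd; rewrite -size_poly_gt0 in q0; lia.
Qed.

(** A Nullstellensatz for principal primes. If [p] does not involve the last variable, some
    coefficient of [h] is not divisible by it and induction applies. Otherwise a nonzero combination
    [r] of [p] and [h] lies in the smaller ring; over a point where [r] and the leading coefficient
    of [p] survive, no root of [p] is a root of [h]. *)
Lemma prime_zero n (C : closedFieldType) (p h : mpoly n C) :
  prime_element p -> ~ divides p h ->
  exists v, meval v p = 0 /\ meval v h != 0.
Proof.
elim: n p h => [|n IHn] p h pp nph.
  case: pp => p0 pU _; case/negP: pU.
  by rewrite mpoly_unitE p0 -mpoly0_const eqxx.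
have fp : prime_element (muni p).
  exact: prime_muni.
have nfh : ~ divides (muni p) (muni h).
  by move=> /divides_muni.
have muni_root (v : 'I_n -> C) a (q : mpoly n.+1 C) :
    (map_poly (meval v) (muni q)).[a] = meval (extend_point v a) q.
  by rewrite meval_extend.
have [sp|sp] := leqP (size (muni p)) 1.
  move: (size1_polyC sp); set c := _`_0 => pE.
  have cp : prime_element c by apply: prime_of_polyC; rewrite -pE.
  have [j ncj] : exists j, ~ divides c (muni h)`_j.
    apply: contrapT => H; apply: nfh.
    have H' j : exists d, (muni h)`_j = d * c.
      by apply: contrapT => K; apply: H; exists j.
    pose d j := projT1 (cid (H' j)).
    exists (\poly_(j < size (muni h)) d j); apply/polyP => j.
    rewrite pE coefMC coef_poly; case: ltnP => hj.
      exact: (projT2 (cid (H' j))).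
    by rewrite nth_default // mul0r.
  have [v [vc vh]] := IHn _ _ cp ncj.
  have q0 : map_poly (meval v) (muni h) != 0.
    apply: contraNneq vh => q0.
    by have := coef_map (meval v) (muni h) j; rewrite q0 coef0 => <-.
  have [a ah] := closed_nonrootP _ q0.
  exists (extend_point v a); rewrite -!muni_root; split=> //.
  by rewrite pE map_polyC hornerC.
have [u [w [r [r0 rE]]]] := prime_bezout fp sp nfh.
have rl0 : r * lead_coef (muni p) != 0.
  by rewrite mulf_neq0 // lead_coef_eq0; case: fp.
have [v] := meval_neq0 rl0; rewrite mevalM mulf_eq0 negb_or => /andP[vr vl].
have [|a ap] := closed_rootP (map_poly (meval v) (muni p)) _.
  by rewrite size_poly_eq // neq_ltn sp orbT.
exists (extend_point v a); rewrite -!muni_root; split; first exact/eqP.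
apply: contraNneq vr => ha.
by apply/eqP; exact: (combination_root rE (eqP ap) ha).
Qed.

(** * Orders along monic primes and Laurent products of polynomials *)

Section Order.
Variables (n : nat) (C : closedFieldType).
Implicit Types (p q a b h : mpoly n C) (s t : seq (mpoly n C)) (v : 'I_n -> C).

Definition leadc a : C := mcoeff (mlead a) a.

Lemma leadc_eq0 a : (leadc a == 0) = (a == 0).
Proof. exact: mleadc_eq0. Qed.

Lemma leadcM a b : leadc (a * b) = leadc a * leadc b.
Proof.
have [->|a0] := eqVneq a 0; first by rewrite mul0r /leadc mcoeff0 mul0r.
have [->|b0] := eqVneq b 0; first by rewrite mulr0 /leadc mcoeff0 mulr0.
by rewrite /leadc mleadM // mleadcM.
Qed.

Lemma leadcC c : leadc (mpolyC n c) = c.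
Proof. by rewrite /leadc mleadC mcoeffC eqxx mulr1. Qed.

Lemma leadcZ c a : leadc (c *: a) = c * leadc a.
Proof. by rewrite -mul_mpolyC leadcM leadcC. Qed.

(** Fixing the leading coefficient selects one prime in each class of associates, so primes can be
    compared by equality and [mord] can count occurrences in a list. *)
Definition monic_prime p := prime_element p /\ leadc p = 1.

Lemma monic_prime_neq0 p : monic_prime p -> p != 0.
Proof. by move=> [[]]. Qed.

Lemma leadc_prod s : (forall p, p \in s -> monic_prime p) ->
  leadc (\prod_(p <- s) p) = 1.
Proof.
elim: s => [|p s IHs] sP; first by rewrite big_nil /leadc mlead1 mcoeff1 eqxx.
rewrite big_cons leadcM IHs => [|q qs]; last by apply: sP; rewrite inE qs orbT.
by have [_ ->] := sP p (mem_head _ _); rewrite mulr1.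
Qed.

Lemma monic_prime_inj p q : monic_prime p -> monic_prime q -> divides p q -> p = q.
Proof.
move=> [[p0 pU pP] p1] [[q0 qU qP] q1] [c qE].
have [[d cE]|[d dE]] : divides q c \/ divides q p.
- by apply: qP; exists 1; rewrite mul1r.
- have : d * p = 1 by apply: (mulfI q0); rewrite mulr1 {2}qE cE; ring.
  by move=> dp; case/negP: pU; apply/unitrPr; exists d; rewrite mulrC.
have cd : c * d = 1 by apply: (mulIf q0); rewrite mul1r {2}qE dE; ring.
have /andP[_ /eqP cE] : (c != 0) && (c == mpolyC n (mcoeff mnm0 c)).
  by rewrite -mpoly_unitE; apply/unitrPr; exists d.
have : leadc q = leadc c * leadc p by rewrite qE leadcM.
by rewrite p1 q1 mulr1 cE leadcC => c1; rewrite qE cE -c1 mpolyC1 mul1r.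
Qed.

Lemma mpoly_factor a : a != 0 -> exists s,
  (forall p, p \in s -> monic_prime p) /\ a = leadc a *: \prod_(p <- s) p.
Proof.
have scale_prime c p : c != 0 -> prime_element p -> prime_element (c *: p).
  move=> c0 [p0 pU pP].
  have cU : mpolyC n c \is a GRing.unit.
    by rewrite mpoly_unitE mpolyC_eq0 c0 mcoeffC eqxx mulr1 /=.
  split; first by rewrite -mul_mpolyC mulf_neq0 // mpolyC_eq0.
    by rewrite -mul_mpolyC unitrM cU.
  have dvE x : divides (c *: p) x <-> divides p x.
    rewrite -mul_mpolyC; split=> [[d ->]|[d ->]].
      by exists (d * mpolyC n c); rewrite mulrA.
    by exists (d / mpolyC n c); rewrite mulrA divrK.
  by move=> x y; rewrite !dvE; exact: pP.
move=> a0; have [u [s [uU sP aE]]] := factorial_mpoly a0.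
suff [t [tP [c sE]]] : exists t, (forall p, p \in t -> monic_prime p) /\
    exists c, a = c *: \prod_(p <- t) p.
  exists t; split=> //.
  by rewrite {1}sE; congr (_ *: _); rewrite sE leadcZ leadc_prod // mulr1.
have {uU} [c uE] : exists c, u = mpolyC n c.
  by move: uU; rewrite mpoly_unitE => /andP[_ /eqP ->]; eexists.
elim: s a u c {a0} sP aE uE => [|p s IHs] a u c sP aE uE.
  exists [::]; split=> //; exists c.
  by rewrite aE !big_nil mulr1 uE -mul_mpolyC mulr1.
have pp : prime_element p by apply: sP; rewrite mem_head.
have l0 : leadc p != 0 by rewrite leadc_eq0; case: pp.
have [|||t [tP [d dE]]] := IHs (u * \prod_(q <- s) q) u c.
- by move=> q qs; apply: sP; rewrite inE qs orbT.
- by [].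
- by [].
exists ((leadc p)^-1 *: p :: t); split.
  move=> q; rewrite inE => /predU1P[->|]; last exact: tP.
  split; first by apply: scale_prime => //; rewrite invr_eq0.
  by rewrite leadcZ mulVf.
exists (d * leadc p); rewrite aE big_cons mulrCA dE big_cons.
by rewrite -!scalerAl -!scalerAr !scalerA mulfK.
Qed.

Lemma prod_monic_uniq s t c : (forall p, p \in s -> monic_prime p) ->
  (forall p, p \in t -> monic_prime p) ->
  \prod_(p <- s) p = c *: \prod_(p <- t) p -> perm_eq s t.
Proof.
move=> sP tP E; have c1 : c = 1.
  have := congr1 leadc E; rewrite leadcZ !leadc_prod // mulr1; exact: esym.
move: E; rewrite c1 scale1r => {c c1}.
elim: s t sP tP => [|p s IHs] t sP tP.
  rewrite big_nil; case: t tP => // q t tP E.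
  case: (tP q (mem_head _ _)) => -[_ qU _] _; case/negP: qU.
  apply/unitrPr; exists (\prod_(j <- t) j).
  by move: E; rewrite big_cons => <-.
have ps := sP p (mem_head _ _); rewrite big_cons => E.
have [q qt pq] : exists2 q, q \in t & divides p q.
  apply: prime_divides_prod; first by case: ps.
  by rewrite -E; exists (\prod_(j <- s) j); rewrite mulrC.
have pqE : p = q by apply: monic_prime_inj => //; exact: tP.
rewrite -pqE in qt => {q pq pqE}.
rewrite perm_sym (perm_trans (perm_to_rem qt)) // perm_cons perm_sym.
apply: IHs => [q qs|q /mem_rem|]; [|exact: tP|].
  by apply: sP; rewrite inE qs orbT.
apply: (mulfI (monic_prime_neq0 ps)); rewrite E.
by rewrite (perm_big _ (perm_to_rem qt)) big_cons.
Qed.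

(** The zero polynomial receives the empty list, so its orders are 0; [mfactorsE] still holds there
    because [leadc 0] is 0. *)
Definition mfactors a : seq (mpoly n C) :=
  if pselect (a != 0) is left a0 then projT1 (cid (mpoly_factor a0)) else [::].

Lemma mfactors_monic a p : p \in mfactors a -> monic_prime p.
Proof.
by rewrite /mfactors; case: pselect => // a0; case: cid => s /= [sP _] /sP.
Qed.

Lemma mfactorsE a : a = leadc a *: \prod_(p <- mfactors a) p.
Proof.
rewrite /mfactors; case: pselect => [a0|]; first by case: cid => s /= [].
by move/negP; rewrite negbK => /eqP ->; rewrite /leadc mcoeff0 scale0r.
Qed.

Definition mord p a : nat := count_mem p (mfactors a).

Lemma mfactorsM a b : a != 0 -> b != 0 ->
  perm_eq (mfactors (a * b)) (mfactors a ++ mfactors b).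
Proof.
move=> a0 b0; apply: (@prod_monic_uniq _ _ 1).
- by move=> p /mfactors_monic.
- by move=> p; rewrite mem_cat => /orP[] /mfactors_monic.
have l0 : leadc (a * b) != 0 by rewrite leadc_eq0 mulf_neq0.
apply: (scalerI l0); rewrite -mfactorsE scale1r big_cat /=.
by rewrite leadcM {1}(mfactorsE a) {1}(mfactorsE b) -scalerAl -scalerAr scalerA.
Qed.

Lemma mordM p a b : a != 0 -> b != 0 -> mord p (a * b) = (mord p a + mord p b)%N.
Proof.
by move=> a0 b0; rewrite /mord -count_cat; exact/seq.permP/mfactorsM.
Qed.

Lemma mordC p c : mord p (mpolyC n c) = 0%N.
Proof.
have [->|c0] := eqVneq c 0.
  by rewrite /mord /mfactors mpolyC0; case: pselect => [a0|//]; case/eqP: (a0).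
suff : perm_eq (mfactors (mpolyC n c)) [::].
  by rewrite /mord => /seq.permP ->.
apply: (@prod_monic_uniq _ _ 1) => //; first by move=> q /mfactors_monic.
rewrite big_nil scale1r; have := mfactorsE (mpolyC n c).
rewrite leadcC -{1}[mpolyC n c]mulr1 mul_mpolyC => /(scalerI c0); exact: esym.
Qed.

Lemma mord_prod p I (r : seq I) (F : I -> mpoly n C) : (forall i, F i != 0) ->
  mord p (\prod_(i <- r) F i) = (\sum_(i <- r) mord p (F i))%N.
Proof.
move=> F0; elim: r => [|i r IHr]; first by rewrite !big_nil -mpolyC1 mordC.
rewrite !big_cons mordM ?IHr //.
by elim/big_rec: _ => [|j x _ x0]; rewrite ?oner_eq0 // mulf_neq0.
Qed.

Lemma mordX p a k : a != 0 -> mord p (a ^+ k) = (k * mord p a)%N.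
Proof.
move=> a0; elim: k => [|k IHk]; first by rewrite expr0 -mpolyC1 mordC.
by rewrite exprS mordM ?expf_neq0 // IHk.
Qed.

Lemma mord_monic p q : monic_prime p -> mord q p = (p == q).
Proof.
move=> pp; suff : perm_eq (mfactors p) [:: p].
  by rewrite /mord => /seq.permP -> /=; rewrite addn0.
apply: (@prod_monic_uniq _ _ 1).
- by move=> r /mfactors_monic.
- by move=> r; rewrite inE => /eqP ->.
by rewrite big_seq1 scale1r [RHS]mfactorsE; case: pp => _ ->; rewrite scale1r.
Qed.

Lemma mord_gt0 p a : (0 < mord p a)%N = (p \in mfactors a).
Proof. by rewrite /mord -has_count has_pred1. Qed.

Lemma mord_divides p a : monic_prime p -> a != 0 ->
  divides p a <-> (0 < mord p a)%N.
Proof.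
move=> pp a0; split=> [[c aE]|].
  have c0 : c != 0 by apply: contraNneq a0 => z; rewrite aE z mul0r.
  by rewrite aE mordM ?(monic_prime_neq0 pp) // (mord_monic p pp) eqxx addn1.
rewrite mord_gt0 => pa; rewrite [a]mfactorsE -mul_mpolyC.
apply: divides_mull; rewrite (perm_big _ (perm_to_rem pa)) big_cons.
by apply: divides_mulr; exists 1; rewrite mul1r.
Qed.

Lemma mord_eq a b : a != 0 -> b != 0 -> (forall p, mord p a = mord p b) ->
  exists2 c, c != 0 & a = c *: b.
Proof.
move=> a0 b0 ab; exists (leadc a / leadc b).
  by rewrite mulf_neq0 ?invr_eq0 ?leadc_eq0.
have pE : perm_eq (mfactors a) (mfactors b).
  by apply/allP => p _; apply/eqP; exact: ab.
rewrite {1}[a]mfactorsE {2}[b]mfactorsE scalerA divfK ?leadc_eq0 //.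
by rewrite (perm_big _ pE).
Qed.

Lemma meval_eq0_factor v a : a != 0 ->
  meval v a = 0 -> exists p, [/\ monic_prime p, meval v p = 0 & (0 < mord p a)%N].
Proof.
move=> a0; rewrite {1}[a]mfactorsE mevalZ => /eqP.
rewrite mulf_eq0 leadc_eq0 (negPf a0) /= (rmorph_prod (meval v)).
rewrite prodf_seq_eq0 => /hasP[p pa /eqP vp]; exists p; split=> //.
  exact: mfactors_monic pa.
by rewrite mord_gt0.
Qed.

Lemma meval_ord0 v p a : meval v p = 0 -> meval v a != 0 -> mord p a = 0%N.
Proof.
move=> vp va; have a0 : a != 0 by apply: contraNneq va => ->; rewrite meval0.
apply/eqP; rewrite -leqn0 leqNgt mord_gt0; apply: contra va => pa.
have pp := mfactors_monic pa.
have /(mord_divides pp a0)[c ->] : (0 < mord p a)%N by rewrite mord_gt0.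
by rewrite mevalM vp mulr0.
Qed.

Lemma dense_eq h a b : h != 0 ->
  (forall v, meval v h != 0 -> meval v a = meval v b) -> a = b.
Proof.
move=> h0 ab; apply/eqP; rewrite -subr_eq0; apply: contraT => d0.
have [v] := meval_neq0 (mulf_neq0 h0 d0).
by rewrite mevalM mulf_eq0 negb_or => /andP[/ab vab]; rewrite mevalB vab subrr eqxx.
Qed.

Lemma mevalX_exp v a k : meval v (a ^+ k) = meval v a ^+ k.
Proof. exact: rmorphXn. Qed.

(** Formal products of integer powers, split by [lpos] and [lneg] into numerator and denominator:
    rational functions and their orders without a field of fractions. *)
Definition laurent := seq (mpoly n C * int).
Implicit Types l : laurent.

Definition lneq0 l := all (fun x => x.1 != 0) l.
Definition leval v l : C := \prod_(x <- l) meval v x.1 ^ x.2.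
Definition lord p l : int := \sum_(x <- l) x.2 * (mord p x.1)%:Z.
Definition lpos l := \prod_(x <- l) x.1 ^+ (if 0 <= x.2 then `|x.2|%N else 0%N).
Definition lneg l := \prod_(x <- l) x.1 ^+ (if 0 <= x.2 then 0%N else `|x.2|%N).

Lemma levalE v l : leval v l = meval v (lpos l) / meval v (lneg l).
Proof.
rewrite /leval /lpos /lneg; elim: l => [|[a [k|k]] l IHl].
- by rewrite !big_nil meval1 divr1.
- by rewrite !big_cons /= IHl !mevalM !mevalX_exp expr0 mul1r mulrA.
- rewrite !big_cons /= IHl !mevalM !mevalX_exp expr0 mul1r NegzE /=.
  by rewrite -exprnN invfM; ring.
Qed.

Lemma lpos_neq0 l : lneq0 l -> lpos l != 0.
Proof.
elim: l => [|x l IHl]; first by rewrite /lpos big_nil oner_eq0.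
by rewrite /lpos big_cons => /andP[x0 /IHl]; apply: mulf_neq0; rewrite expf_neq0.
Qed.

Lemma lneg_neq0 l : lneq0 l -> lneg l != 0.
Proof.
elim: l => [|x l IHl]; first by rewrite /lneg big_nil oner_eq0.
by rewrite /lneg big_cons => /andP[x0 /IHl]; apply: mulf_neq0; rewrite expf_neq0.
Qed.

Lemma lordE p l : lneq0 l -> lord p l = (mord p (lpos l))%:Z - (mord p (lneg l))%:Z.
Proof.
elim: l => [_|[a k] l IHl /andP[/= a0 l0]].
  by rewrite /lord /lpos /lneg !big_nil -mpolyC1 mordC.
have := IHl l0; rewrite /lord /lpos /lneg !big_cons /= => ->.
rewrite !mordM ?expf_neq0 //; [|exact: lneg_neq0|exact: lpos_neq0].
rewrite !mordX //; case: k => k /=; first by rewrite mul0n; lia.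
by rewrite mul0n NegzE; lia.
Qed.

Lemma lneg_meval v l : (forall x, x \in l -> x.2 < 0 -> meval v x.1 != 0) ->
  meval v (lneg l) != 0.
Proof.
elim: l => [|x l IHl] xP; first by rewrite /lneg big_nil meval1 oner_eq0.
rewrite /lneg big_cons mevalM mulf_neq0 //; last first.
  by apply: IHl => y yl; apply: xP; rewrite inE yl orbT.
rewrite mevalX_exp; case: ifPn => [_|]; first by rewrite expr0 oner_eq0.
by rewrite -ltNge => /(xP _ (mem_head _ _)) x0; rewrite expf_neq0.
Qed.

Section LaurentIdentity.
Variables (h : mpoly n C) (l l' : laurent).
Hypotheses (h0 : h != 0) (l0 : lneq0 l) (l'0 : lneq0 l').
Hypothesis (ll' : forall v, meval v h != 0 -> leval v l = leval v l').

(** Cross-multiplied, the equality of values becomes a polynomial identity on a dense open set. From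
    it follow equal orders, and equal values wherever the denominators survive, even outside that
    set. *)
Lemma laurent_eq : lpos l * lneg l' = lpos l' * lneg l.
Proof.
apply: (@dense_eq (h * (lneg l * lneg l'))).
  by rewrite !mulf_neq0 ?lneg_neq0.
move=> v; rewrite !mevalM !mulf_eq0 !negb_or => /andP[/ll' + /andP[v0 v'0]].
by rewrite !levalE => /eqP; rewrite eqr_div // => /eqP.
Qed.

Lemma laurent_ord p : lord p l = lord p l'.
Proof.
have := congr1 (mord p) laurent_eq.
by rewrite !mordM ?lpos_neq0 ?lneg_neq0 // !lordE //; lia.
Qed.

Lemma laurent_eval v : meval v (lneg l) != 0 -> meval v (lneg l') != 0 ->
  leval v l = leval v l'.
Proof.
move=> v0 v'0; have := congr1 (meval v) laurent_eq.
by rewrite !mevalM !levalE => E; apply/eqP; rewrite eqr_div // E.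
Qed.

End LaurentIdentity.

(** By unique factorization, a quotient of order 0 along every prime is a nonzero constant. *)
Lemma laurent_const l l' : lneq0 l -> lneq0 l' ->
  (forall p, lord p l = lord p l') ->
  exists2 c, c != 0 & forall v, meval v (lneg l) != 0 ->
    meval v (lneg l') != 0 -> leval v l = c * leval v l'.
Proof.
move=> l0 l'0 ll'; have [||p|c c0 E] := @mord_eq (lpos l * lneg l') (lpos l' * lneg l).
- by rewrite mulf_neq0 ?lpos_neq0 ?lneg_neq0.
- by rewrite mulf_neq0 ?lpos_neq0 ?lneg_neq0.
- have := ll' p.
  by rewrite !mordM ?lpos_neq0 ?lneg_neq0 // !lordE //; lia.
exists c => // v v0 v'0; have := congr1 (meval v) E.
rewrite mevalZ !mevalM !levalE => {}E; apply/eqP.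
by rewrite mulrA eqr_div // E mulrA.
Qed.

End Order.

(** * Rational cones and fans *)

Section Pairing.
Variables (A : comNzRingType) (n : nat).
Implicit Types (m u v : 'rV[A]_n) (a : A).

Lemma pairing_addl m m' v : pairing (m + m') v = pairing m v + pairing m' v.
Proof. by rewrite /pairing -big_split; apply: eq_bigr => i _; rewrite mxE mulrDl. Qed.

Lemma pairingC m v : pairing m v = pairing v m.
Proof. by rewrite /pairing; apply: eq_bigr => i _; rewrite mulrC. Qed.

Lemma pairing_addr m v v' : pairing m (v + v') = pairing m v + pairing m v'.
Proof. by rewrite pairingC pairing_addl !(pairingC m). Qed.

Lemma pairingZl a m v : pairing (a *: m) v = a * pairing m v.
Proof. by rewrite /pairing mulr_sumr; apply: eq_bigr => i _; rewrite mxE mulrA. Qed.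

Lemma pairingZr a m v : pairing m (a *: v) = a * pairing m v.
Proof. by rewrite pairingC pairingZl pairingC. Qed.

Lemma pairingNl m v : pairing (- m) v = - pairing m v.
Proof. by rewrite -scaleN1r pairingZl mulN1r. Qed.

Lemma pairingNr m v : pairing m (- v) = - pairing m v.
Proof. by rewrite pairingC pairingNl pairingC. Qed.

Lemma pairing0l v : pairing 0 v = 0.
Proof. by rewrite -(scale0r 0) pairingZl mul0r. Qed.

Lemma pairing0r m : pairing m 0 = 0.
Proof. by rewrite pairingC pairing0l. Qed.

Lemma pairing_sumr m I (r : seq I) (P : pred I) (F : I -> 'rV[A]_n) :
  pairing m (\sum_(i <- r | P i) F i) = \sum_(i <- r | P i) pairing m (F i).
Proof.
by apply: (big_morph (pairing m)) => [x y|]; rewrite ?pairing_addr ?pairing0r.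
Qed.

Lemma pairing_suml v I (r : seq I) (P : pred I) (F : I -> 'rV[A]_n) :
  pairing (\sum_(i <- r | P i) F i) v = \sum_(i <- r | P i) pairing (F i) v.
Proof. by rewrite pairingC pairing_sumr; apply: eq_bigr => i _; rewrite pairingC. Qed.

Lemma pairing_delta v k : pairing (delta_mx 0 k) v = v 0 k.
Proof.
rewrite /pairing (bigD1 k) //= mxE !eqxx mul1r big1 ?addr0 // => i ik.
by rewrite mxE (negPf ik) andbF mul0r.
Qed.

End Pairing.

Lemma pairing_map (A B : comNzRingType) n (f : {rmorphism A -> B}) (m v : 'rV[A]_n) :
  pairing (map_mx f m) (map_mx f v) = f (pairing m v).
Proof.
by rewrite /pairing rmorph_sum; apply: eq_bigr => i _; rewrite !mxE rmorphM.
Qed.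

Lemma pairing_intr (B : comNzRingType) n (m v : 'rV[int]_n) :
  pairing (map_mx intr m) (map_mx intr v) = (pairing m v)%:~R :> B.
Proof. exact: (@pairing_map int B n intr). Qed.

(** * Farkas' lemma and its integral form *)

Section Farkas.
Variables (F : realFieldType) (n : nat).
Implicit Types (m u v w : 'rV[F]_n) (s : seq 'rV[F]_n).

Fixpoint conic s v : Prop :=
  if s is u :: s' then exists2 a : F, 0 <= a & conic s' (v - a *: u) else v = 0.

Lemma conic_shear u (k : 'rV[F]_n -> F) s w : (forall x, x \in s -> 0 <= k x) ->
  conic [seq x + k x *: u | x <- s] w ->
  exists2 e, 0 <= e & conic s (w - e *: u).
Proof.
elim: s w => [|x s IHs] w k0 /=; first by exists 0; rewrite ?scale0r ?subr0.
move=> [a a0 /IHs[y ys|e e0 es]]; first by apply: k0; rewrite inE ys orbT.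
have kx := k0 x (mem_head _ _).
exists (e + a * k x); first by rewrite addr_ge0 ?mulr_ge0.
exists a => //; move: es; congr (conic _ _).
by apply/rowP => j; rewrite !mxE; ring.
Qed.

(* Projecting along a generator reduces to fewer generators. *)
Theorem farkas s v : conic s v \/
  exists2 m, (forall u, u \in s -> 0 <= pairing m u) & pairing m v < 0.
Proof.
have [k] := ubnP (size s); elim: k s v => // k IHk [|u s] v /= sk.
  have [->|v0] := eqVneq v 0; [by left | right; exists (- v) => //].
  rewrite pairingNl oppr_lt0 /pairing lt_def sumr_ge0 ?andbT; last first.
    by move=> i _; rewrite -expr2 sqr_ge0.
  apply: contraNneq v0 => /eqP.
  rewrite psumr_eq0 => [/allP H|i _]; last by rewrite -expr2 sqr_ge0.
  apply/eqP/rowP => i; rewrite mxE; apply/eqP.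
  by have := H i (mem_index_enum _); rewrite mulf_eq0 orbb.
have [sv|[m ms mv]] := IHk s v sk.
  by left; exists 0; rewrite ?scale0r ?subr0.
have [mu|mu] := leP 0 (pairing m u).
  by right; exists m => // x; rewrite inE => /predU1P[->|/ms].
(* This shear makes [m] vanish on every [x + c x *: u]; [c] is non-negative on [s], because [m] is
   non-negative there and negative at [u]. *)
pose c x := - (pairing m x / pairing m u).
have [|sv|[m' m's m'v]] := IHk [seq x + c x *: u | x <- s] (v + c v *: u).
- by rewrite size_map.
- left; have [x xs|e e0 es] := conic_shear _ sv.
    by rewrite /c -mulrN mulr_ge0 ?ms // oppr_ge0 invr_le0 ltW.
  exists (e - c v); last by move: es; congr (conic _ _);
    apply/rowP => j; rewrite !mxE; ring.
  rewrite addr_ge0 // /c opprK mulr_le0 ?invr_le0 ?ltW //.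
have cE x : pairing m' (x + c x *: u) =
    pairing (m' - (pairing m' u / pairing m u) *: m) x.
  rewrite pairing_addr pairingZr pairing_addl pairingNl pairingZl /c; ring.
right; exists (m' - (pairing m' u / pairing m u) *: m); last by rewrite -cE.
move=> x; rewrite inE => /predU1P[->|xs].
  rewrite pairing_addl pairingNl pairingZl divfK ?subrr //.
  by rewrite lt_eqF.
by rewrite -cE; apply: m's; apply: map_f.
Qed.

Lemma conic_sum (I : eqType) (f : I -> 'rV[F]_n) (l : seq I) v : uniq l ->
  conic (map f l) v ->
  exists2 c : I -> F, forall i, 0 <= c i & v = \sum_(i <- l) c i *: f i.
Proof.
elim: l v => [|i l IHl] v /=; first by exists (fun=> 0); rewrite ?big_nil.
move=> /andP[il ul] [a a0 /(IHl _ ul)[c c0 E]].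
exists (fun j => if j == i then a else c j) => [j|]; first by case: ifP.
rewrite big_cons eqxx -[v in LHS](subrK (a *: f i)) E addrC; congr (_ + _).
by apply: eq_big_seq => j jl; case: eqP => // ji; rewrite -ji jl in il.
Qed.

End Farkas.

Lemma clear_denominators n (m : 'rV[rat]_n) :
  exists2 d : rat, 0 < d & exists m' : 'rV[int]_n, map_mx intr m' = d *: m.
Proof.
exists (\prod_i (denq (m 0 i))%:~R).
  by apply: prodr_gt0 => i _; rewrite ltr0z denq_gt0.
exists (\row_i (numq (m 0 i) * \prod_(j | j != i) denq (m 0 j))).
apply/rowP => i; rewrite !mxE [in RHS](bigD1 i) //= intrM numqE rmorph_prod /=.
ring.
Qed.

Section IntegerCone.
Variables (n r : nat) (u : 'I_r -> 'rV[int]_n).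
Implicit Types (S : {set 'I_r}) (m v : 'rV[int]_n).

Definition qcone S (v : 'rV[rat]_n) : Prop :=
  exists2 c : 'I_r -> rat, forall i, 0 <= c i &
    v = \sum_(i in S) c i *: map_mx intr (u i).

(** The denominators of a rational functional are cleared. The generator [w] is kept apart from the
    rays because [separating_functional] needs one that is not a ray. *)
Lemma integer_farkas S (w : 'rV[int]_n) v :
  (exists2 a : rat, 0 <= a & qcone S (map_mx intr v - a *: map_mx intr w)) \/
  exists m, [/\ forall i, i \in S -> 0 <= pairing m (u i), 0 <= pairing m w &
                pairing m v < 0].
Proof.
have [|[m ms mv]] := @farkas rat n
    (map_mx intr w :: [seq map_mx intr (u i) | i <- enum S]) (map_mx intr v).
  move=> /= [a a0 H]; left; exists a => //.
  have [c c0 E] := conic_sum (enum_uniq _) H.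
  by exists c => //; rewrite E big_enum.
right; have [d d0 [m' m'E]] := clear_denominators m.
have E x : (pairing m' x)%:~R = d * pairing m (map_mx intr x) :> rat.
  by rewrite -pairing_intr m'E pairingZl.
exists m'; split.
- move=> i iS; rewrite -(ler_int rat) E mulr_ge0 ?(ltW d0) //.
  apply: ms; rewrite inE; apply/orP; right.
  by apply/mapP; exists i; rewrite ?mem_enum.
- by rewrite -(ler_int rat) E mulr_ge0 ?(ltW d0) // ms ?mem_head.
- by rewrite -(ltr_int rat) E pmulr_rlt0.
Qed.

Lemma integer_farkas0 S v : qcone S (map_mx intr v) \/
  exists2 m, (forall i, i \in S -> 0 <= pairing m (u i)) & pairing m v < 0.
Proof.
have [[a _]|[m [mS _ mv]]] := integer_farkas S 0 v; last by right; exists m.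
rewrite (_ : map_mx intr 0 = 0) ?scaler0 ?subr0; first by left.
by apply/rowP => i; rewrite !mxE.
Qed.

End IntegerCone.

Lemma int_poly_nonroot (q : {poly int}) : q != 0 -> exists a : int, q.[a] != 0.
Proof.
move=> q0; apply: contrapT => H.
have := @max_poly_roots _ q [seq k%:Z | k <- iota 0 (size q)] q0.
rewrite size_map size_iota ltnn => K; suff : false by []; apply: K.
  apply/allP => a _; rewrite rootE; apply: contrapT => /negP qa.
  by apply: H; exists a.
by rewrite map_inj_uniq ?iota_uniq // => i j [].
Qed.

(** The vector is a point (1, a, a^2, ...) of the moment curve: pairing with [m] evaluates a nonzero
    polynomial at [a], and some integer [a] avoids the roots of the product of these polynomials. *)
Lemma generic_vector n (s : seq 'rV[int]_n) : (forall m, m \in s -> m != 0) ->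
  exists w, forall m, m \in s -> pairing m w != 0.
Proof.
move=> s0; pose p (m : 'rV[int]_n) : {poly int} := \sum_(i < n) m 0 i *: 'X^i.
have p0 m : m \in s -> p m != 0.
  move=> ms; apply: contraNneq (s0 m ms) => pm0; apply/eqP/rowP => i.
  have := congr1 (fun q : {poly int} => q`_i) pm0.
  rewrite coef_sum coef0 (bigD1 i) //= coefZ coefXn eqxx mulr1 big1 => [|j ji].
    by rewrite addr0 mxE.
  rewrite coefZ coefXn [_ == _]negbTE ?mulr0 //.
  by apply: contra ji => /eqP ji; apply/eqP/val_inj.
have /int_poly_nonroot[a] : \prod_(m <- s) p m != 0.
  by rewrite prodf_seq_neq0; apply/allP => m /p0.
rewrite horner_prod prodf_seq_neq0 => /allP H; exists (\row_i a ^+ i) => m ms.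
have := H m ms; rewrite horner_sum /=; congr (_ != _); apply: eq_bigr => i _.
by rewrite hornerZ hornerXn mxE.
Qed.

(** Write the ratio of one coordinate as p/q in lowest terms. Then q x = p y, so p divides [x] and q
    divides [y], and primitivity makes both of them units; [0 <= c] settles the sign. *)
Lemma primitive_ray_inj (R : realFieldType) n (x y : 'rV[int]_n) (c : R) :
  (forall (d : int) w, x = d *: w -> `|d| = 1) ->
  (forall (d : int) w, y = d *: w -> `|d| = 1) ->
  0 <= c -> map_mx intr x = c *: map_mx intr y -> x = y.
Proof.
move=> xP yP c0 xy.
have n0 (z : 'rV[int]_n) : (forall (d : int) w, z = d *: w -> `|d| = 1) -> z != 0.
  by move=> zP; apply/eqP => z0; have := zP 0 0; rewrite z0 scaler0 normr0 => /(_ erefl).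
have [k yk] : exists k, y 0 k != 0.
  apply: contrapT => H; have /eqP := n0 y yP; apply; apply/rowP => k.
  rewrite [RHS]mxE; apply: contrapT => /eqP yk; apply: H; by exists k.
have ykR : (y 0 k)%:~R != 0 :> R by rewrite intr_eq0.
have cE l : (x 0 l)%:~R = c * (y 0 l)%:~R.
  by have /rowP/(_ l) := xy; rewrite !mxE.
have cross l : x 0 l * y 0 k = x 0 k * y 0 l.
  by apply: (@intr_inj R); rewrite !intrM !cE; ring.
pose a := (x 0 k)%:~R / (y 0 k)%:~R : rat; pose p := numq a; pose q := denq a.
have ykQ : (y 0 k)%:~R != 0 :> rat by rewrite intr_eq0.
have qQ : q%:~R != 0 :> rat by rewrite intr_eq0 denq_neq0.
have pq : coprimez p q by rewrite coprimezE coprime_num_den.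
have aE : a * q%:~R = p%:~R by rewrite /p /q -numqE.
have E l : q * x 0 l = p * y 0 l.
  apply: (@intr_inj rat); rewrite !intrM -aE; apply: (mulIf ykQ).
  have axk : a * (y 0 k)%:~R = (x 0 k)%:~R by rewrite /a divfK.
  by rewrite -mulrA -intrM cross intrM -axk; ring.
have p1 : `|p| = 1.
  apply: (xP p (\row_l divz (x 0 l) p)); apply/rowP => l; rewrite !mxE mulrC divzK //.
  have : (p %| (q * x 0 l)%R)%Z by rewrite E dvdz_mulr.
  by rewrite Gauss_dvdzr.
have q1 : q = 1.
  rewrite -[LHS]gtr0_norm ?denq_gt0 //.
  apply: (yP q (\row_l divz (y 0 l) q)); apply/rowP => l; rewrite !mxE mulrC divzK //.
  have : (q %| (p * y 0 l)%R)%Z by rewrite -E dvdz_mulr.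
  by rewrite Gauss_dvdzr // coprimez_sym.
have [pE|pE] : p = 1 \/ p = -1.
- by case: (ler0P p) p1 => _ <-; [right; rewrite opprK|left].
- by apply/rowP => l; have := E l; rewrite q1 pE !mul1r.
have := E k; rewrite q1 pE mul1r mulN1r => xk.
have := cE k; rewrite xk intrN => /eqP.
rewrite -subr_eq0 -opprD oppr_eq0 -[X in X + _]mul1r -mulrDl mulf_eq0 (negPf ykR).
by rewrite orbF gt_eqF // ltr_wpDr.
Qed.

Section FanLemmas.
Variables (R : realType) (n : nat) (D : fan R n).
Implicit Types (S T : {set 'I_(nrays D)}).

Definition toR (v : 'rV[int]_n) : 'rV[R]_n := map_mx intr v.

Lemma toRD v w : toR (v + w) = toR v + toR w.
Proof. by apply/rowP => i; rewrite !mxE intrD. Qed.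

Lemma toRZ a v : toR (a *: v) = a%:~R *: toR v.
Proof. by apply/rowP => i; rewrite !mxE intrM. Qed.

Lemma toR_sum I (s : seq I) (P : pred I) (F : I -> 'rV[int]_n) :
  toR (\sum_(i <- s | P i) F i) = \sum_(i <- s | P i) toR (F i).
Proof.
apply: (big_morph toR) => [v w|]; first exact: toRD.
by apply/rowP => i; rewrite !mxE.
Qed.

Lemma ray_neq0 i : ray D i != 0.
Proof.
apply/eqP => z; have := @ray_primitive _ _ D i 0 0.
by rewrite z scaler0 normr0 => /(_ erefl).
Qed.

Lemma toR_ray_neq0 i : toR (ray D i) != 0.
Proof.
apply: contraNneq (ray_neq0 i) => /rowP z; apply/eqP/rowP => k.
by have := z k; rewrite !mxE => /eqP; rewrite intr_eq0 => /eqP.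
Qed.

Lemma ray_proportional i j (c : R) : 0 <= c ->
  toR (ray D i) = c *: toR (ray D j) -> i = j.
Proof.
move=> c0 E; apply: (@ray_inj _ _ D).
by apply: (@primitive_ray_inj R _ _ _ c) => //; exact: ray_primitive.
Qed.

Lemma cone_span_ray S i : i \in S -> cone_span R (ray D) S (toR (ray D i)).
Proof.
move=> iS; exists (fun j => (j == i)%:R); split; first by move=> j; rewrite ler0n.
rewrite (bigD1 i) //= eqxx scale1r big1 ?addr0 // => j /andP[_ /negPf ->].
by rewrite scale0r.
Qed.

Lemma cone_spanD S v w : cone_span R (ray D) S v -> cone_span R (ray D) S w ->
  cone_span R (ray D) S (v + w).
Proof.
move=> [c [c0 ->]] [d [d0 ->]]; exists (fun i => c i + d i); split.
  by move=> i; rewrite addr_ge0.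
by rewrite -big_split /=; apply: eq_bigr => i _; rewrite scalerDl.
Qed.

Lemma cone_span0 S : cone_span R (ray D) S 0.
Proof.
by exists (fun=> 0); split=> //; rewrite big1 // => i _; rewrite scale0r.
Qed.

Lemma cone_span_sum S (I : Type) (s : seq I) (P : pred I) F :
  (forall i, P i -> cone_span R (ray D) S (F i)) ->
  cone_span R (ray D) S (\sum_(i <- s | P i) F i).
Proof.
move=> FP; elim/big_ind: _ => //; [exact: cone_span0|exact: cone_spanD].
Qed.

Lemma cone_spanZ S a v : 0 <= a -> cone_span R (ray D) S v ->
  cone_span R (ray D) S (a *: v).
Proof.
move=> a0 [c [c0 ->]]; exists (fun i => a * c i); split.
  by move=> i; rewrite mulr_ge0.
by rewrite scaler_sumr; apply: eq_bigr => i _; rewrite scalerA.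
Qed.

Lemma cone_spanS S T v : S \subset T -> cone_span R (ray D) S v ->
  cone_span R (ray D) T v.
Proof.
move=> /fintype.subsetP ST [c [c0 ->]]; apply: cone_span_sum => i iS.
by apply: cone_spanZ => //; apply: cone_span_ray; exact: ST.
Qed.

Lemma qcone_span S (v : 'rV[int]_n) : qcone (ray D) S (map_mx intr v) ->
  cone_span R (ray D) S (toR v).
Proof.
move=> [c c0 E]; exists (fun i => ratr (c i)); split; first by move=> i; rewrite ler0q.
apply/rowP => k; have /rowP/(_ k) := E; rewrite !mxE !summxE => Ek.
rewrite -(ratr_int R) Ek rmorph_sum; apply: eq_bigr => i _.
by rewrite !mxE rmorphM /= ratr_int.
Qed.

(** The single ray [j] is a cone of the fan, so its intersection with [S] is a face of [S], cut out
    by some functional. This functional is non-negative on every term and 0 on the sum, so a ray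
    with positive coefficient lies in that face and is [j]. *)
Lemma cone_span_extremal S j (c : 'I_(nrays D) -> R) : S \in cones D ->
  (forall i, 0 <= c i) -> toR (ray D j) = \sum_(i in S) c i *: toR (ray D i) ->
  forall i, i \in S -> 0 < c i -> i = j.
Proof.
move=> SD c0 E i iS ci.
have [m [mS FE]] := cones_inter SD (cones_ray j).
have mj : pairing m (toR (ray D j)) = 0.
  have : (cone_span R (ray D) S `&` cone_span R (ray D) (finset.set1 j))%classic
      (toR (ray D j)).
    split; first by exists c.
    by apply: cone_span_ray; rewrite finset.in_set1.
  by rewrite FE => -[].
have mi : pairing m (toR (ray D i)) = 0.
  move: mj; rewrite E pairing_sumr => /eqP; rewrite psumr_eq0; last first.
    by move=> k kS; rewrite pairingZr mulr_ge0 // mS //; exact: cone_span_ray.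
  move=> /allP/(_ i (mem_index_enum _))/implyP/(_ iS).
  by rewrite pairingZr mulf_eq0 gt_eqF //= => /eqP.
have : (cone_span R (ray D) S `&` [set v | pairing m v = 0])%classic
    (toR (ray D i)) by split=> //; exact: cone_span_ray.
rewrite -FE => -[_ [d [d0]]]; rewrite big_set1; exact: ray_proportional.
Qed.

Lemma cone_span_mem S j : S \in cones D -> cone_span R (ray D) S (toR (ray D j)) ->
  j \in S.
Proof.
move=> SD [c [c0 E]]; have [k /andP[kS ck]] : exists k, (k \in S) && (0 < c k).
  apply: contrapT => H; have /eqP := toR_ray_neq0 j; apply; rewrite E big1 // => i iS.
  have [ci|] := ltP 0 (c i); first by case: H; exists i; rewrite iS.
  by move=> ci; rewrite (@le_anti _ _ (c i) 0) ?ci ?c0 // scale0r.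
by rewrite -(cone_span_extremal SD c0 E kS ck).
Qed.

(** By strong convexity [- ray D i] is outside the cone, and Farkas gives a functional non-negative
    on [S] and positive at [i]; these are summed over [i]. *)
Lemma positive_functional S : S \in cones D ->
  exists m, forall i, i \in S -> 0 < pairing m (ray D i).
Proof.
move=> SD; have H i : exists m, i \in S ->
    (forall k, k \in S -> 0 <= pairing m (ray D k)) /\ 0 < pairing m (ray D i).
  have [iS|] := boolP (i \in S); last by exists 0.
  have [Hc|[m mS mi]] := integer_farkas0 (ray D) S (- ray D i); last first.
    by exists m => _; split=> //; rewrite -oppr_lt0 -pairingNr.
  have /eqP := toR_ray_neq0 i; case.
  apply: (cones_strongly_convex SD); first exact: cone_span_ray.
  have := qcone_span Hc; congr (cone_span _ _ _ _).
  by apply/rowP => k; rewrite !mxE intrN.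
have [m mP] := choice H; exists (\sum_(i in S) m i) => i iS.
rewrite pairing_suml (bigD1 i) //= ltr_pwDl //; first by case: (mP i iS).
by apply: sumr_ge0 => k /andP[kS _]; case: (mP k kS) => + _; apply.
Qed.

(** A positive functional cuts out the origin as a face of any cone. The fan axiom gives a member
    with that span, and such a member can have no rays. *)
Lemma set0_cones : finset.set0 \in cones D.
Proof.
have [S SD] : exists S, S \in cones D.
  by have /set0Pn := cones_neq0 D.
have [m mS] := positive_functional SD.
have mR i : i \in S -> 0 < pairing (toR m) (toR (ray D i)).
  by move=> iS; rewrite pairing_intr ltr0z mS.
have [|S' S'D E] := @cones_face _ _ D S [set 0]%classic SD.
  exists (toR m); split.
    move=> v [c [c0 ->]]; rewrite pairing_sumr sumr_ge0 // => i iS.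
    by rewrite pairingZr mulr_ge0 // ltW // mR.
  apply/seteqP; split=> [v ->|v [[c [c0 ->]]]] /=.
    by split; [exact: cone_span0|rewrite pairing0r].
  rewrite pairing_sumr => /eqP; rewrite psumr_eq0; last first.
    by move=> i iS; rewrite pairingZr mulr_ge0 // ltW // mR.
  move=> /allP H; rewrite big1 // => i iS.
  have := H i (mem_index_enum _); rewrite iS pairingZr mulf_eq0.
  by rewrite [pairing _ _ == _]gt_eqF ?mR // orbF => /eqP ->; rewrite scale0r.
suff -> : finset.set0 = S' by [].
apply/esym/eqP; rewrite -finset.subset0; apply/fintype.subsetP => i iS'.
have : cone_span R (ray D) S' (toR (ray D i)) by exact: cone_span_ray.
by rewrite -E => /= /eqP; rewrite (negPf (toR_ray_neq0 i)).
Qed.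

(** Let [b] be the sum of the rays of [T]. A functional non-negative on [S] and on [- b] vanishes on
    [T]. Farkas makes it positive at a given [i], unless a multiple of [b] minus the ray [i] lies in
    the cone of [S]; then the functional that cuts out the intersection of [S] and [T] vanishes at
    the ray [i] and puts it in [T]. The functionals found are summed. *)
Lemma separating_functional S T : S \in cones D -> T \in cones D -> T \subset S ->
  exists m, [/\ forall i, i \in S -> 0 <= pairing m (ray D i),
    forall i, i \in T -> pairing m (ray D i) = 0 &
    forall i, i \in S -> i \notin T -> 0 < pairing m (ray D i)].
Proof.
move=> SD TD TS; pose b := \sum_(i in T) ray D i.
have Tvanish m : (forall i, i \in S -> 0 <= pairing m (ray D i)) ->
    0 <= pairing m (- b) -> forall i, i \in T -> pairing m (ray D i) = 0.
  move=> mS; rewrite pairingNr oppr_ge0 /b pairing_sumr => mb i iT.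
  have /eqP : \sum_(i in T) pairing m (ray D i) = 0.
    apply: le_anti; rewrite mb sumr_ge0 // => k kT.
    exact/mS/(fintype.subsetP TS).
  rewrite psumr_eq0 => [/allP/(_ i (mem_index_enum _))/implyP/(_ iT)/eqP//|k kT].
  exact/mS/(fintype.subsetP TS).
have H i : exists m, i \in S -> i \notin T ->
    [/\ forall k, k \in S -> 0 <= pairing m (ray D k),
      forall k, k \in T -> pairing m (ray D k) = 0 & 0 < pairing m (ray D i)].
  have [/andP[iS iT]|/nandP nST] := boolP ((i \in S) && (i \notin T)); last first.
    by exists 0 => iS iT; case: nST => /negP; case.
  have [[a a0 Hc]|[m [mS mb mi]]] := integer_farkas (ray D) S (- b) (- ray D i);
    last first.
    exists m => _ _; split=> //; first exact: Tvanish.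
    by rewrite -oppr_lt0 -pairingNr.
  case/negP: iT; have [c c0 E] := Hc.
  have [m [mS FE]] := cones_inter SD TD.
  have bS : cone_span R (ray D) S (toR b).
    rewrite /b toR_sum; apply: cone_span_sum => k kT.
    exact/cone_span_ray/(fintype.subsetP TS).
  have mb : pairing m (toR b) = 0.
    have : (cone_span R (ray D) S `&` cone_span R (ray D) T)%classic (toR b).
      split=> //; rewrite /b toR_sum; apply: cone_span_sum => k kT.
      exact: cone_span_ray.
    by rewrite FE => -[].
  have ER : \sum_(k in S) (ratr (c k) : R) *: toR (ray D k) =
      ratr a *: toR b - toR (ray D i).
    apply/rowP => k; have /rowP/(_ k) := E; rewrite !mxE !summxE => Ek.
    have := congr1 (ratr : rat -> R) Ek.
    rewrite rmorph_sum rmorphB rmorphM /= !intrN !rmorphN /= !ratr_int.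
    rewrite mulrN opprK [- _ + _]addrC => ->.
    by apply: eq_bigr => j _; rewrite !mxE rmorphM /= ratr_int.
  have mi : pairing m (toR (ray D i)) = 0.
    have s0 : 0 <= pairing m (\sum_(k in S) (ratr (c k) : R) *: toR (ray D k)).
      by apply: mS; exists (fun k => ratr (c k)); split=> // k; rewrite ler0q.
    apply: le_anti; rewrite (mS _ (cone_span_ray iS)) andbT.
    by move: s0; rewrite ER pairing_addr pairingZr pairingNr mb mulr0 add0r oppr_ge0.
  have : (cone_span R (ray D) S `&` [set v | pairing m v = 0])%classic
    (toR (ray D i)) by split=> //; exact: cone_span_ray.
  by rewrite -FE => -[_]; exact: cone_span_mem.
have [m mP] := choice H; exists (\sum_(i in S :\: T) m i); split=> [i iS|i iT|i iS iT].
- rewrite pairing_suml sumr_ge0 // => k; rewrite finset.in_setD => /andP[kT kS].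
  by case: (mP k kS kT) => + _ _; apply.
- rewrite pairing_suml big1 // => k; rewrite finset.in_setD => /andP[kT kS].
  by case: (mP k kS kT) => _ + _; apply.
- rewrite pairing_suml (bigD1 i) ?finset.in_setD ?iT //= ltr_pwDl //.
    by case: (mP i iS iT).
  apply: sumr_ge0 => k; rewrite finset.in_setD => /andP[/andP[kT kS] _].
  by case: (mP k kS kT) => + _ _; apply.
Qed.

End FanLemmas.

Local Open Scope classical_set_scope.

(** * Spaces with functions *)

Section FunctionSheaf.
Variables (C : fieldType) (X : fspace C).
Implicit Types (U V W : set X) (f g : X -> C).

Let sh := regular_sheaf X.

Lemma regular_cst U c : open U -> regular U (fun=> c).
Proof. exact: sheaf_cst. Qed.

Lemma regular_add U f g : open U -> regular U f -> regular U g ->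
  regular U (fun x => f x + g x).
Proof. exact: (sheaf_add sh). Qed.

Lemma regular_mul U f g : open U -> regular U f -> regular U g ->
  regular U (fun x => f x * g x).
Proof. exact: (sheaf_mul sh). Qed.

Lemma regular_res U V f : open U -> open V -> V `<=` U -> regular U f -> regular V f.
Proof. exact: (sheaf_res sh). Qed.

Lemma regular_ext U f g : open U -> (forall x, U x -> f x = g x) ->
  regular U f -> regular U g.
Proof.
move=> oU fg rf; apply: (sheaf_glue sh) => // x Ux; exists U, f.
by split=> // y /fg.
Qed.

Lemma regular_local U f : open U ->
  (forall x, U x -> exists V, [/\ open V, V x, V `<=` U & regular V f]) ->
  regular U f.
Proof.
move=> oU H; apply: (sheaf_glue sh) => // x /H[V [oV Vx VU rf]].
by exists V, f.
Qed.

Lemma open_nonvanishing U f : open U -> regular U f ->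
  open (U `&` [set x | f x != 0]).
Proof. by move=> oU /(sheaf_inv sh oU)[]. Qed.

Lemma regular_inv U f : open U -> (forall x, U x -> f x != 0) -> regular U f ->
  regular U (fun x => (f x)^-1).
Proof.
move=> oU f0 /(sheaf_inv sh oU)[_].
suff -> : U `&` [set x | f x != 0] = U by [].
by apply/seteqP; split=> [x []|x Ux] //; split=> //; exact: f0.
Qed.

Lemma regular_sum U (I : Type) (s : seq I) (P : pred I) (F : I -> X -> C) :
  open U -> (forall i, P i -> regular U (F i)) ->
  regular U (fun x => \sum_(i <- s | P i) F i x).
Proof.
move=> oU FP; elim: s => [|i s IHs].
  by apply: (regular_ext oU (f := fun=> 0)) => [x _|]; [rewrite big_nil|exact: regular_cst].
have [Pi|nPi] := boolP (P i).
  apply: (regular_ext oU (f := fun x => F i x + \sum_(j <- s | P j) F j x)).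
    by move=> x _; rewrite big_cons Pi.
  by apply: regular_add => //; exact: FP.
by apply: regular_ext IHs => // x _; rewrite big_cons (negPf nPi).
Qed.

Lemma regular_prod U (I : Type) (s : seq I) (P : pred I) (F : I -> X -> C) :
  open U -> (forall i, P i -> regular U (F i)) ->
  regular U (fun x => \prod_(i <- s | P i) F i x).
Proof.
move=> oU FP; elim: s => [|i s IHs].
  by apply: (regular_ext oU (f := fun=> 1)) => [x _|]; [rewrite big_nil|exact: regular_cst].
have [Pi|nPi] := boolP (P i).
  apply: (regular_ext oU (f := fun x => F i x * \prod_(j <- s | P j) F j x)).
    by move=> x _; rewrite big_cons Pi.
  by apply: regular_mul => //; exact: FP.
by apply: regular_ext IHs => // x _; rewrite big_cons (negPf nPi).
Qed.

Lemma regular_exp U f k : open U -> regular U f -> regular U (fun x => f x ^+ k).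
Proof.
move=> oU rf; elim: k => [|k IHk].
  by apply: (regular_ext oU (f := fun=> 1)) => //; exact: regular_cst.
apply: (regular_ext oU (f := fun x => f x * f x ^+ k)).
  by move=> x _; rewrite exprS.
exact: regular_mul.
Qed.

Lemma regular_expz U f (z : int) : open U ->
  (0 <= z \/ forall x, U x -> f x != 0) -> regular U f ->
  regular U (fun x => f x ^ z).
Proof.
move=> oU H rf; case: z H => [k _|k [//|f0]]; first exact: regular_exp.
apply: (regular_ext oU (f := fun x => (f x ^+ k.+1)^-1)).
  by move=> x _; rewrite NegzE -exprnN.
apply: regular_inv => // [x Ux|]; last exact: regular_exp.
by rewrite expf_neq0 // f0.
Qed.

Lemma regular_meval U k (F : 'I_k -> X -> C) p : open U ->
  (forall i, regular U (F i)) ->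
  regular U (fun x => meval (fun i => F i x) p).
Proof.
move=> oU FP; apply: (regular_ext oU (f := fun x =>
  \sum_(m <- msupp p) mcoeff m p * \prod_i F i x ^+ m i)).
  by move=> x _; rewrite mevalE.
apply: regular_sum => // m _; apply: regular_mul => //; first exact: regular_cst.
by apply: regular_prod => // i _; exact: regular_exp.
Qed.

Lemma open_local U :
  (forall x, U x -> exists V, [/\ open V, V x & V `<=` U]) -> open U.
Proof.
move=> H; rewrite openE => x /H[V [oV Vx VU]].
by apply: (filterS VU); exact: open_nbhs_nbhs.
Qed.

End FunctionSheaf.

Lemma regular_map_on_comp (C : fieldType) (X Y Z : fspace C) (D : set X)
    (f : X -> Y) (g : Y -> Z) :
  regular_map_on D f -> regular_map g -> regular_map_on D (g \o f).
Proof.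
move=> rf rg V oV; have [oW rW] := rg V oV.
have [oD rD] := rf _ oW; rewrite setTI in oD rD rW.
by split=> // h /rW /rD.
Qed.

Lemma regular_map_on_open (C : fieldType) (X Y : fspace C) (D : set X) (f : X -> Y) :
  regular_map_on D f -> open D.
Proof.
by move=> /(_ setT openT)[+ _]; rewrite preimage_setT setIT.
Qed.

Lemma regular_map_on_res (C : fieldType) (X Y : fspace C) (D D' : set X)
    (f : X -> Y) : regular_map_on D f -> open D' -> D' `<=` D ->
  regular_map_on D' f.
Proof.
move=> rf oD' DD' V oV; have [oW rW] := rf V oV.
have E : D' `&` f @^-1` V = D' `&` (D `&` f @^-1` V).
  by apply/seteqP; split=> [x [D'x Vx]|x [D'x [_ Vx]]]; split=> //; split=> //; exact: DD'.
split; first by rewrite E; exact: openI.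
move=> h /rW rh; apply: (regular_res oW) => //; first by rewrite E; exact: openI.
by rewrite E => x [].
Qed.

Lemma irreducible_finite_meet (T : topologicalType) (I : eqType) (s : seq I)
    (O : I -> set T) : irreducible_set [set: T] ->
  (forall i, i \in s -> open (O i) /\ O i !=set0) ->
  open [set x | forall i, i \in s -> O i x] /\
  [set x | forall i, i \in s -> O i x] !=set0.
Proof.
move=> [[x0 _] irr]; elim: s => [|i s IHs] sP.
  split; last by exists x0.
  by have := @openT T; congr open; apply/seteqP; split.
have [os ns] := IHs (fun j js => sP j (mem_behead (s := i :: s) js)).
have [oi ni] := sP i (mem_head _ _).
have -> : [set x | forall j, j \in i :: s -> O j x] =
    O i `&` [set x | forall j, j \in s -> O j x].
  apply/seteqP; split=> x /= H.
    by split=> [|j js]; apply: H; rewrite inE ?eqxx // js orbT.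
  by move=> j; rewrite inE => /predU1P[->|]; case: H => // _; apply.
split; first exact: openI.
have [||y [_ yP]] := irr _ _ oi os; last by exists y.
- by case: ni => y Oy; exists y.
- by case: ns => y Oy; exists y.
Qed.

Section IntoGlued.
Variables (C : fieldType) (X : fspace C) (A : atlas C) (W : set X).
Variable f : X -> glued_space A.
Hypotheses (oW : open W)
  (fopen : forall i, open (W `&` f @^-1` (@chart C A i)))
  (freg : forall i c, @coordf C A i c ->
     regular (W `&` f @^-1` (@chart C A i)) (c \o f))
  (fcover : forall x, W x -> exists i, @chart C A i (f x)).

(** Regular functions on the target are locally quotients of coordinate functions, so it is enough
    to pull back the latter, chart by chart. *)
Lemma regular_into_glued : regular_map_on W f.
Proof.
move=> V oV; have oWV : open (W `&` f @^-1` V).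
  apply: open_local => x [Wx Vx]; have [i ix] := fcover Wx.
  have [c [cA cx cV]] := (glued_openE V).1 oV i (f x) Vx ix.
  exists ((W `&` f @^-1` (@chart C A i)) `&` [set y | c (f y) != 0]); split=> //.
    by apply: (@open_nonvanishing _ _ _ (c \o f)) => //; exact: freg.
  by move=> y [[Wy iy] cy]; split=> //; exact: cV.
split=> // h rh; apply: regular_local => // x [Wx Vx].
have [i ix] := fcover Wx; have [a [b [aA bA bx hE]]] := rh i (f x) Vx ix.
pose N := (W `&` f @^-1` (@chart C A i)) `&` [set y | b (f y) != 0].
have oN : open N by apply: (@open_nonvanishing _ _ _ (b \o f)) => //; exact: freg.
have oN' : open ((W `&` f @^-1` V) `&` N) by exact: openI.
have rN c : @coordf C A i c -> regular ((W `&` f @^-1` V) `&` N) (c \o f).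
  move=> cA; apply: (regular_res (fopen i)) => //; last exact: freg.
  by move=> y [_ []].
exists ((W `&` f @^-1` V) `&` N); split=> //.
apply: (regular_ext oN' (f := fun y => (a \o f) y * ((b \o f) y)^-1)).
  by move=> y [[Wy Vy] [[_ iy] by0]]; rewrite /= hE.
apply: regular_mul => //; first exact: rN.
by apply: regular_inv => // [y [_ []]|] //; exact: rN.
Qed.

End IntoGlued.

Section SubAffineSpaces.
Variables (C : fieldType) (n : nat) (S : set 'rV[C]_n).

Definition coordinate (x : sub_affine S) (i : 'I_n) : C := sval x 0 i.

Lemma sub_affine_inj (x y : sub_affine S) :
  (forall i, coordinate x i = coordinate y i) -> x = y.
Proof.
case: x y => [x xP] [y yP] xy; apply/eq_exist; apply/rowP => i.
by have := xy i.
Qed.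

Lemma regular_polynomial (U : set (sub_affine S)) p :
  regular U (fun x : sub_affine S => meval (coordinate x) p).
Proof.
move=> [] x Ux _; exists (fun x => peval p (sval x)), (fun=> 1); split.
- by exists p.
- exact: polynomial_cst.
- exact: oner_neq0.
- by move=> y _ _ _; rewrite divr1.
Qed.

Lemma regular_coordinate (U : set (sub_affine S)) i :
  regular U (fun x : sub_affine S => coordinate x i).
Proof.
have := @regular_polynomial U (mpolyX C (mnm1 i)); congr (regular _ _).
by apply/funext => x; rewrite mevalXU.
Qed.

Lemma open_principal p : open [set x : sub_affine S | meval (coordinate x) p != 0].
Proof.
have := @open_nonvanishing _ (sub_affine S) setT
  (fun x : sub_affine S => meval (coordinate x) p) openT (@regular_polynomial setT p).
by rewrite setTI.
Qed.

Lemma sub_affine_openP (U : set (sub_affine S)) x : open U -> U x ->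
  exists p, meval (coordinate x) p != 0 /\
    forall y, meval (coordinate y) p != 0 -> U y.
Proof.
move=> oU Ux; have [f [[p fE] fx fU]] := (glued_openE U).1 oU tt x Ux I.
exists p; split; first by move: fx; rewrite fE.
by move=> y py; apply: fU => //; rewrite fE.
Qed.

Lemma sub_affine_regularP (U : set (sub_affine S)) f x : open U -> regular U f ->
  U x -> exists a b, meval (coordinate x) b != 0 /\
    forall y, meval (coordinate y) b != 0 ->
      U y /\ f y = meval (coordinate y) a / meval (coordinate y) b.
Proof.
move=> oU rf Ux; have [p [px pU]] := sub_affine_openP oU Ux.
have [f1 [f2 [[a aE] [b bE] bx fE]]] := rf tt x Ux I.
exists (a * p), (b * p); split.
  by rewrite mevalM mulf_neq0 //; move: bx; rewrite bE.
move=> y; rewrite !mevalM mulf_eq0 negb_or => /andP[by0 py].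
have Uy := pU y py; split=> //.
by rewrite fE ?aE ?bE // -mulf_div divff // mulr1.
Qed.

Lemma regular_into_sub_affine (X : fspace C) (W : set X) (f : X -> sub_affine S) :
  open W -> (forall i, regular W (fun x => coordinate (f x) i)) ->
  regular_map_on W f.
Proof.
move=> oW rf; apply: regular_into_glued => //.
- by move=> j; rewrite preimage_setT setIT.
- move=> j c [p cE]; rewrite preimage_setT setIT.
  apply: (regular_ext oW (f := fun x => meval (fun i => coordinate (f x) i) p)).
    by move=> x _; rewrite /= cE.
  exact: regular_meval.
- by move=> x _; exists tt.
Qed.

End SubAffineSpaces.

Section AffineSpace.
Variables (C : closedFieldType) (n : nat).

Definition affine_space : fspace C := sub_affine (zero_locus (@set0 (mpoly n C))).

Definition aff_point (v : 'I_n -> C) : affine_space.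
Proof. by exists (\row_i v i). Defined.

Lemma aff_pointE v i : coordinate (aff_point v) i = v i.
Proof. by rewrite /coordinate mxE. Qed.

Lemma meval_aff_point v p : meval (coordinate (aff_point v)) p = meval v p.
Proof. by congr meval; apply/funext => i; rewrite aff_pointE. Qed.

Lemma variety_affine_space : variety affine_space.
Proof.
split.
- split=> [|U V oU oV [x [_ Ux]] [y [_ Vy]]]; first by exists (aff_point (fun=> 0)).
  have [p [px pU]] := sub_affine_openP oU Ux.
  have [q [qx qV]] := sub_affine_openP oV Vy.
  have [|v] := @meval_neq0 _ _ (p * q).
    by rewrite mulf_neq0 //; [move: px|move: qx]; apply: contraNneq => ->; rewrite meval0.
  rewrite mevalM mulf_eq0 negb_or => /andP[pv qv].
  exists (aff_point v); split=> //.
  by split; [apply: pU|apply: qV]; rewrite meval_aff_point.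
- exists 1%N, (fun=> setT); split=> [_|x]; last by exists ord0.
  by exists n, set0, id, id; split=> // V oV; split=> //; rewrite ?setTI.
- move=> x y /= xy; have [i xyi] : exists i, coordinate x i != coordinate y i.
    apply: contrapT => H; apply: xy; apply: sub_affine_inj => i.
    by apply: contrapT => /eqP xyi; apply: H; exists i.
  exists setT, setT, (fun x y => coordinate x i - coordinate y i).
  split=> //; [by split; [exact: openT|]|by split; [exact: openT|] | | by rewrite subr_eq0 |].
    exists 2%N, (fun k x => if k == ord0 then coordinate x i else -1).
    exists (fun k y => if k == ord0 then 1 else coordinate y i); split.
    + move=> k; case: (k == ord0); first exact: regular_coordinate.
      by apply: regular_cst; exact: openT.
    + move=> k; case: (k == ord0); last exact: regular_coordinate.
      by apply: regular_cst; exact: openT.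
    + by move=> x' y'; rewrite big_ord_recl big_ord1 /= mulr1 mulN1r.
  by move=> x' y' _ _; rewrite subr_eq0 /= => + e; rewrite e eqxx.
Qed.

End AffineSpace.

(** * Complete and non-singular toric varieties *)

Section ToricCharts.
Variables (C : closedFieldType) (R : realType) (n : nat) (D : fan R n).
Implicit Types (S T : {set 'I_(nrays D)}) (m : 'rV[int]_n).

Local Notation X := (toric_variety C D).

Lemma in_dualP S m :
  reflect (forall i, i \in S -> 0 <= pairing m (ray D i)) (in_dual S m).
Proof. exact: forall_inP. Qed.

Lemma in_perpP S m :
  reflect (forall i, i \in S -> pairing m (ray D i) = 0) (in_perp S m).
Proof. by apply: (iffP forall_inP) => H i iS; apply/eqP; exact: H. Qed.

Lemma in_perp_set0 m : in_perp (finset.set0 : {set 'I_(nrays D)}) m.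
Proof. by apply/in_perpP => i; rewrite finset.in_set0. Qed.

Lemma in_perp_dual S m : in_perp S m -> in_dual S m.
Proof. by move=> /in_perpP mS; apply/in_dualP => i /mS ->. Qed.

Lemma toric_point_eq (x y : toric_point C D) :
  tcone x = tcone y -> tval x =1 tval y -> x = y.
Proof.
case: x y => [S f Sc f0 fM] [T g Tc g0 gM] /= ST /funext fg.
by rewrite -ST -fg in Tc g0 gM *; congr ToricPoint; exact: Prop_irrelevance.
Qed.

Definition mkpoint S (SD : S \in cones D) (f : 'rV[int]_n -> C)
    (f0 : forall m, in_perp S m -> f m != 0)
    (fM : forall m m', in_perp S m -> in_perp S m' -> f (m + m') = f m * f m') :
  toric_point C D.
Proof.
refine (@ToricPoint C R n D S (fun m => if in_perp S m then f m else 0) SD _ _).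
  by move=> m; case: ifP => [/f0 //|_]; rewrite eqxx.
move=> m m' mS m'S; rewrite mS m'S fM // (_ : in_perp S (m + m')) //.
apply/in_perpP => i iS; rewrite pairing_addl.
by rewrite (in_perpP _ _ mS) // (in_perpP _ _ m'S) // addr0.
Defined.

Lemma toric_chart_self (x : X) (xD := tcone_in x) :
  toric_chart (exist _ (tcone x) xD) x.
Proof. exact: fintype.subxx. Qed.

(** [m] supports the face [tcone x] of [s']: in the chart of [s'], its character is nonzero only on
    orbits whose cone lies in [tcone x]. *)
Lemma toric_separation (s s' : toric_index D) (x : X) :
  toric_chart s x -> toric_chart s' x ->
  exists m, [/\ in_dual (sval s') m, tval x m != 0,
    forall y : X, toric_chart s' y -> tval y m != 0 -> tcone y \subset tcone x &
    forall i, i \in sval s' -> i \notin tcone x -> 0 < pairing m (ray D i)].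
Proof.
move=> sx s'x.
have [m [mS mT mST]] := separating_functional (proj2_sig s') (tcone_in x) s'x.
exists m; split=> //; first exact/in_dualP.
  by rewrite tval_neq0; apply/in_perpP.
move=> y s'y; rewrite tval_neq0 => /in_perpP my; apply/fintype.subsetP => i iy.
apply: contraT => ix; have := mST i (fintype.subsetP s'y i iy) ix.
by rewrite my // ltxx.
Qed.

Lemma toric_chart_open (s : toric_index D) : open (toric_chart s : set X).
Proof.
apply/glued_openE => s' x sx s'x.
have [m [md mx my _]] := toric_separation sx s'x.
exists (fun y => tval y m); split=> //.
  by exists [:: (1, m)]; split; [rewrite /= md|move=> y _; rewrite big_seq1 mul1r].
move=> y s'y ym; apply: fintype.subset_trans (my y s'y ym) sx.
Qed.

Lemma tval_muln (x : X) m k : in_perp (tcone x) m -> tval x (m *+ k) = tval x m ^+ k.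
Proof.
move=> mx; elim: k => [|k IHk]; first exact: tval0.
rewrite mulrS exprS tval_mul ?IHk //.
apply/in_perpP => i iS; rewrite -scaler_nat pairingZl (in_perpP _ _ mx) //.
by rewrite mulr0.
Qed.

(** On the overlap with another chart [s'], a power of the character from [toric_separation] serves
    as denominator: enough copies of [m0] make [m] non-negative on the rays of [s'] outside
    [tcone x], and on [tcone x] it already is. *)
Lemma regular_tval (s : toric_index D) m : in_dual (sval s) m ->
  regular (toric_chart s : set X) (fun x => tval x m).
Proof.
move=> md s' x sx s'x.
have [m0 [m0d m0x m0y m0i]] := toric_separation sx s'x.
have [k kP] : exists k : nat, forall i, i \in sval s' -> i \notin tcone x ->
    0 <= pairing (m + m0 *+ k) (ray D i).
  exists (\sum_i `|pairing m (ray D i)|)%N => i is' ix.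
  rewrite pairing_addl -scaler_nat pairingZl.
  have : (`|pairing m (ray D i)| <= \sum_i `|pairing m (ray D i)|)%N.
    by rewrite (bigD1 i) //= leq_addr.
  have := m0i i is' ix.
  move: (pairing m0 _) (pairing m _) (\sum_i _)%N => a b c a0 bc.
  by rewrite natz; nia.
have m0k : in_perp (tcone x) (m0 *+ k).
  apply/in_perpP => i ix; rewrite -scaler_nat pairingZl.
  by move: m0x; rewrite tval_neq0 => /in_perpP ->; rewrite ?mulr0.
have mkd : in_dual (sval s') (m + m0 *+ k).
  apply/in_dualP => i is'; have [ix|] := boolP (i \in tcone x); last exact: kP.
  rewrite pairing_addl (in_perpP _ _ m0k) // addr0.
  by apply: (in_dualP _ _ md); exact: (fintype.subsetP sx).
have m0kd : in_dual (sval s') (m0 *+ k).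
  apply/in_dualP => i is'; rewrite -scaler_nat pairingZl natz mulr_ge0 //.
  exact: (in_dualP _ _ m0d).
have coordE a : in_dual (sval s') a -> toric_coord s' (fun y => tval y a).
  by move=> ad; exists [:: (1, a)]; split; [rewrite /= ad|move=> y _; rewrite big_seq1 mul1r].
exists (fun y => tval y (m + m0 *+ k)), (fun y => tval y (m0 *+ k)); split.
- exact: coordE.
- exact: coordE.
- by rewrite tval_neq0.
move=> y sy s'y yk; have ky : in_perp (tcone y) (m0 *+ k) by rewrite -(tval_neq0 y).
rewrite (@tvalD _ _ _ _ (exist _ (tcone y) (tcone_in y))) ?mulfK //.
- exact: toric_chart_self.
- by apply/in_dualP => i /(fintype.subsetP sy); exact: (in_dualP _ _ md).
- exact: in_perp_dual.
Qed.

Definition torus_point (y : 'I_n -> C) (y0 : forall k, y k != 0) : toric_point C D.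
Proof.
refine (@mkpoint finset.set0 (set0_cones D)
  (fun m => \prod_k y k ^ m 0 k) _ _).
  by move=> m _; apply/prodf_neq0 => k _; rewrite expfz_neq0.
move=> m m' _ _; rewrite -big_split; apply: eq_bigr => k _ /=.
by rewrite mxE expfzDr.
Defined.

Lemma torus_pointE y y0 m : tval (@torus_point y y0) m = \prod_k y k ^ m 0 k.
Proof. by rewrite /= in_perp_set0. Qed.

Lemma one_parameter_subgroup (v : 'rV[int]_n) (t : C) : t != 0 ->
  exists x : toric_point C D, tcone x = finset.set0 /\ forall m, tval x m = t ^ pairing m v.
Proof.
move=> t0; have y0 (k : 'I_n) : t ^ v 0 k != 0 by rewrite expfz_neq0.
exists (torus_point y0); split=> // m; rewrite torus_pointE /pairing.
rewrite (big_morph (fun z => t ^ z) (op1 := *%R) (id1 := 1)) //.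
  by apply: eq_bigr => k _; rewrite exprz_exp mulrC.
by move=> a b; rewrite expfzDr.
Qed.

Definition line_function (t : affine_space C 1) : C := coordinate t ord0.

(* The graph W of the one-parameter subgroup of v lies over A^1 - 0, which is
   not closed.  If no cone contains v, then W is closed: a point of W over 0
   would lie in a chart with a dual vector m negative on v, where
   chi^m t^(-<m, v>) = 1. *)
Lemma complete_support : complete X ->
  forall v, exists2 S, S \in cones D & qcone (ray D) S (map_mx intr v).
Proof.
move=> Xc v; apply: contrapT => nv.
have vS S : S \in cones D -> exists2 m, in_dual S m & pairing m v < 0.
  move=> SD; have [Hq|[m mS mv]] := integer_farkas0 (ray D) S v.
    by case: nv; exists S.
  by exists m => //; exact/in_dualP.
pose W : set (X * affine_space C 1) := [set xt | [/\ line_function xt.2 != 0,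
  tcone xt.1 = finset.set0 & forall m, tval xt.1 m = line_function xt.2 ^ pairing m v]].
have reg_line (V : set (affine_space C 1)) : regular V line_function.
  exact: regular_coordinate.
have Wc : prod_closed W.
  move=> x t nW; pose s : toric_index D := exist _ (tcone x) (tcone_in x).
  have [t0|t0] := eqVneq (line_function t) 0.
    have [m md mv] := vS (tcone x) (tcone_in x).
    exists (toric_chart s), setT,
      (fun x' t' => tval x' m * line_function t' ^+ `|pairing m v|%N - 1); split.
    + by split; [exact: toric_chart_open|exact: toric_chart_self].
    + by split; [exact: openT|].
    + exists 2%N, (fun k x' => if k == ord0 then tval x' m else -1).
      exists (fun k t' => if k == ord0 then line_function t' ^+ `|pairing m v|%N else 1).
      split.
      * move=> k; case: (k == ord0); first exact: regular_tval.
        by apply: regular_cst; exact: toric_chart_open.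
      * move=> k; case: (k == ord0); last by apply: regular_cst; exact: openT.
        by apply: regular_exp; [exact: openT|exact: reg_line].
      * by move=> x' t'; rewrite big_ord_recl big_ord1 /= mulr1.
    + rewrite t0 expr0n absz_eq0 lt_eqF // mulr0 sub0r.
      by rewrite oppr_eq0 oner_eq0.
    + move=> x' t' _ _ h0 [/= t'0 _ x't']; case/eqP: h0.
      rewrite x't' exprnP (_ : `|pairing m v|%N%:Z = - pairing m v); last by lia.
      by rewrite -expfzDr // subrr expr0z subrr.
  (* A character detecting that the point is off the graph. In the torus, some character violates
     the graph equation; outside it, a functional positive on [tcone x] has character value 0, which
     is no power of a nonzero t. *)
  have [m [md mx]] : exists m, in_dual (tcone x) m /\
      tval x m != line_function t ^ pairing m v.
    have [/eqP x0|/set0Pn[i ix]] := boolP (tcone x == finset.set0).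
      apply: contrapT => H; apply: nW; split=> // m.
      apply: contrapT => /eqP K; apply: H; exists m; split=> //.
      by rewrite x0; apply: in_perp_dual; exact: in_perp_set0.
    have [m mP] := positive_functional (tcone_in x).
    exists m; split; first by apply/in_dualP => k /mP /ltW.
    suff -> : tval x m = 0 by rewrite eq_sym expfz_neq0.
    apply/eqP; rewrite -[_ == _]negbK tval_neq0; apply/negP => /in_perpP/(_ i ix).
    by move=> E; have := mP i ix; rewrite E ltxx.
  have oV : open [set t' : affine_space C 1 | line_function t' != 0].
    have := @open_nonvanishing _ _ setT line_function openT (reg_line _).
    by rewrite setTI.
  exists (toric_chart s), [set t' | line_function t' != 0],
    (fun x' t' => tval x' m - line_function t' ^ pairing m v); split.
  + by split; [exact: toric_chart_open|exact: toric_chart_self].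
  + by [].
  + exists 2%N, (fun k x' => if k == ord0 then tval x' m else -1).
    exists (fun k t' => if k == ord0 then 1 else line_function t' ^ pairing m v).
    split.
    * move=> k; case: (k == ord0); first exact: regular_tval.
      by apply: regular_cst; exact: toric_chart_open.
    * move=> k; case: (k == ord0); first exact: regular_cst.
      by apply: regular_expz => //; right.
    * by move=> x' t'; rewrite big_ord_recl big_ord1 /= mulr1 mulN1r.
  + by rewrite subr_eq0.
  + by move=> x' t' _ _ + [/= _ _ x't']; rewrite x't' subrr eqxx.
(* The complement of the projection of [W] is open and contains 0, hence also some t different from
   0, although the graph has a point over every such t. *)
have [a a0] : exists a : affine_space C 1, line_function a = 0.
  by exists (aff_point (fun=> 0)); exact: aff_pointE.
have oI := Xc _ (variety_affine_space C 1) W Wc.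
have Ia : (~` (snd @` W)) a by move=> [[x t] [/= t0 _ _] ta]; rewrite ta a0 eqxx in t0.
have [p [pa pI]] := sub_affine_openP (closed_openC oI) Ia.
have p0 : p != 0 by apply: contraNneq pa => ->; rewrite meval0.
have [|w] := @meval_neq0 _ _ (p * mpolyX C (mnm1 ord0)).
  rewrite mulf_neq0 //; apply/eqP => /(congr1 (mcoeff (mnm1 ord0))) /eqP.
  by rewrite mcoeffX eqxx mcoeff0 oner_eq0.
rewrite mevalM mulf_eq0 negb_or mevalXU => /andP[wp w0].
have := pI (aff_point w); rewrite meval_aff_point => /(_ wp); apply.
have [x [x0 xv]] := one_parameter_subgroup v w0.
exists (x, aff_point w) => //; split=> //=; first by rewrite /line_function aff_pointE.
by move=> m; rewrite xv /line_function aff_pointE.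
Qed.

End ToricCharts.

Section QCone.
Variables (n r : nat) (u : 'I_r -> 'rV[int]_n).
Implicit Types (S : {set 'I_r}) (m v : 'rV[int]_n).

Lemma qcone_pairing_ge0 S m v : (forall i, i \in S -> 0 <= pairing m (u i)) ->
  qcone u S (map_mx intr v) -> 0 <= pairing m v.
Proof.
move=> mS [c c0 E]; rewrite -(ler_int rat) -pairing_intr E pairing_sumr.
by apply: sumr_ge0 => i iS; rewrite pairingZr mulr_ge0 // pairing_intr ler0z mS.
Qed.

Lemma qcone_pairing_eq0 S m v : (forall i, i \in S -> pairing m (u i) = 0) ->
  qcone u S (map_mx intr v) -> pairing m v = 0.
Proof.
move=> mS vS; apply: le_anti; rewrite (qcone_pairing_ge0 _ vS) => [|i iS].
  rewrite andbT -oppr_ge0 -pairingNl (qcone_pairing_ge0 _ vS) // => i iS.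
  by rewrite pairingNl mS ?oppr0.
by rewrite mS.
Qed.

End QCone.

Lemma infinitely_often (I : finType) (f : nat -> I) :
  exists i, forall K, exists k, (K <= k)%N /\ f k = i.
Proof.
apply: contrapT => H.
have H' i : exists K, forall k, (K <= k)%N -> f k != i.
  apply: contrapT => Hi; apply: H; exists i => K; apply: contrapT => HK.
  by apply: Hi; exists K => k Kk; apply/eqP => fk; apply: HK; exists k.
have [K KP] := choice H'; pose M := (\sum_i K i)%N.
suff : f M != f M by rewrite eqxx.
have leK i : (K i <= M)%N by rewrite /M (bigD1 i) //= leq_addr.
exact: KP.
Qed.

Section FullCones.
Variables (R : realType) (n : nat) (D : fan R n).
Implicit Types (S T : {set 'I_(nrays D)}) (m v : 'rV[int]_n).

Definition full_cone S := forall m, in_perp S m -> m = 0.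

Hypothesis support : forall v,
  exists2 S, S \in cones D & qcone (ray D) S (map_mx intr v).

(* A cone containing k v + w for infinitely many k contains v; it is
   full-dimensional when w avoids the hyperplanes attached to the others. *)
Lemma full_support v :
  exists S, [/\ S \in cones D, full_cone S & qcone (ray D) S (map_mx intr v)].
Proof.
have H S : exists m, ~ full_cone S -> in_perp S m /\ m != 0.
  have [fS|] := pselect (full_cone S); first by exists 0 => /(_ fS).
  move=> nf; apply: contrapT => K; apply: nf => m mS; apply: contrapT => /eqP m0.
  by apply: K; exists m => _.
have [f fP] := choice H.
have [w wP] := @generic_vector n [seq m <- [seq f T | T in cones D] | m != 0]
  (fun m => (fun mf => (andP (eq_ind _ is_true mf _ (mem_filter _ _ _))).1)).
have /choice[s sP] : forall k : nat, exists S, S \in cones D /\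
    qcone (ray D) S (map_mx intr (v *+ k + w)).
  by move=> k; have [S SD Sk] := support (v *+ k + w); exists S.
have [S SP] := infinitely_often s.
have pk m k : pairing m (v *+ k + w) = k%:Z * pairing m v + pairing m w.
  by rewrite pairing_addr -scaler_nat pairingZr natz.
have SD : S \in cones D by have [k [_ <-]] := SP 0%N; case: (sP k).
exists S; split=> //.
  apply: contrapT => nf; have [/in_perpP fS f0] := fP S nf.
  (* Two different [k] with [s k = S] kill the slope [pairing (f S) v], and then [pairing (f S) w],
     against the choice of [w]. *)
  have fk k : s k = S -> k%:Z * pairing (f S) v + pairing (f S) w = 0.
    move=> kS; rewrite -pk; apply: (qcone_pairing_eq0 fS).
    by rewrite -kS; case: (sP k).
  have /eqP : pairing (f S) w != 0.
    by apply: wP; rewrite mem_filter f0 /=; apply/mapP; exists S; rewrite ?mem_enum.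
  apply; have [k [_ /fk k0]] := SP 0%N.
  have [k' [kk' /fk k'0]] := SP k.+1.
  have : (k'%:Z - k%:Z) * pairing (f S) v = 0 by lia.
  move=> /eqP; rewrite mulf_eq0 subr_eq0 eqz_nat gtn_eqF //= => /eqP v0.
  by move: k0; rewrite v0 mulr0 add0r.
have [//|[m mS mv]] := integer_farkas0 (ray D) S v.
(* Since [pairing m v] is at most -1, [m] would be negative at [v *+ k + w] for [k] beyond the
   absolute value of [pairing m w]. *)
have [k [kK ks]] := SP (`|pairing m w|.+1)%N.
have := qcone_pairing_ge0 mS; move=> /(_ (v *+ k + w)); rewrite -{1}ks.
move=> /(_ (sP k).2); rewrite pk => H0; exfalso.
move: mv kK H0; move: (pairing m v) (pairing m w) => a b; nia.
Qed.

End FullCones.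

Section Coefficients.
Variables (C : closedFieldType) (R : realType) (n : nat) (D : fan R n).
Implicit Types (l : seq (C * 'rV[int]_n)) (m : 'rV[int]_n).

Definition lfun l (x : toric_point C D) : C := \sum_(a <- l) a.1 * tval x a.2.

Definition lcoef l m : C := \sum_(a <- l | a.2 == m) a.1.

Definition lmul l l' := [seq (a.1 * b.1, a.2 + b.2) | a <- l, b <- l'].

Lemma lcoef_notin l m : m \notin [seq a.2 | a <- l] -> lcoef l m = 0.
Proof.
move=> ml; rewrite /lcoef big_seq_cond big1 // => a /andP[al /eqP am].
by case/negP: ml; rewrite -am; apply/mapP; exists a.
Qed.

(** Independence of characters: a one-parameter subgroup that separates [m] from the other exponents
    turns the sum into a Laurent polynomial in t. The shift by [N] makes it an ordinary polynomial,
    zero at every t other than 0. *)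
Lemma lfun_eq0_lcoef l : (forall x, tcone x = finset.set0 -> lfun l x = 0) ->
  forall m, lcoef l m = 0.
Proof.
move=> l0 m; have [ml|/lcoef_notin//] := boolP (m \in [seq a.2 | a <- l]).
have [w wP] := @generic_vector n
  [seq d <- [seq a.2 - m | a <- l] | d != 0]
  (fun m => (fun mf => (andP (eq_ind _ is_true mf _ (mem_filter _ _ _))).1)).
pose N : nat := (\sum_(a <- l) `|pairing a.2 w|)%N.
have N0 a : a \in l -> 0 <= pairing a.2 w + N%:Z.
  move=> al; have : (`|pairing a.2 w| <= N)%N.
    by rewrite /N (perm_big _ (perm_to_rem al)) big_cons leq_addr.
  lia.
pose q : {poly C} := \sum_(a <- l) a.1 *: 'X^(`|pairing a.2 w + N%:Z|).
have q0 : q = 0.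
  have : q * 'X = 0.
    apply: contrapT => /eqP qX0; have [t] := closed_nonrootP _ qX0.
    rewrite rootE hornerM hornerX mulf_eq0 negb_or => /andP[qt t0].
    case/eqP: qt; have [x [x0 xw]] := one_parameter_subgroup D w t0.
    transitivity (lfun l x * t ^ N%:Z); last by rewrite l0 // mul0r.
    rewrite horner_sum /lfun mulr_suml.
    apply: eq_big_seq => a al; rewrite hornerZ hornerXn xw -mulrA -expfzDr //.
    by rewrite exprnP gez0_abs ?N0.
  by move/eqP; rewrite mulf_eq0 polyX_eq0 orbF => /eqP.
have := congr1 (fun p : {poly C} => p`_(`|pairing m w + N%:Z|)) q0.
rewrite coef0 coef_sum => <-; rewrite /lcoef big_mkcond; apply: eq_big_seq => a al.
rewrite coefZ coefXn; have [->|am] := eqVneq a.2 m; first by rewrite eqxx mulr1.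
suff : pairing (a.2 - m) w != 0.
  have /mapP[b bl mE] := ml; have := N0 a al; have := N0 b bl; rewrite -mE.
  rewrite pairing_addl pairingNl; move: (pairing m w) (pairing a.2 w) => y z.
  move=> Nb Na /eqP yz; case: eqP => [E|_]; last by rewrite mulr0.
  by exfalso; lia.
apply: wP; rewrite mem_filter subr_eq0 am /=.
by apply/mapP; exists a.
Qed.

Lemma lfunM s l l' (x : toric_point C D) : toric_chart s x ->
  all (fun a => in_dual (sval s) a.2) l -> all (fun a => in_dual (sval s) a.2) l' ->
  lfun (lmul l l') x = lfun l x * lfun l' x.
Proof.
move=> sx /allP ls /allP l's; rewrite /lfun big_allpairs_dep /= mulr_suml.
apply: eq_big_seq => a al; rewrite mulr_sumr; apply: eq_big_seq => b bl.
by rewrite (tvalD sx (ls a al) (l's b bl)) mulrACA.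
Qed.

Lemma lfun_cat l l' (x : toric_point C D) : lfun (l ++ l') x = lfun l x + lfun l' x.
Proof. by rewrite /lfun big_cat. Qed.

Lemma lcoef_cat l l' m : lcoef (l ++ l') m = lcoef l m + lcoef l' m.
Proof. by rewrite /lcoef big_cat. Qed.

Lemma all_lmul S l l' : all (fun a => in_dual S a.2) l ->
  all (fun a => in_dual S a.2) l' ->
  all (fun a : C * _ => @in_dual R n D S a.2) (lmul l l').
Proof.
move=> /allP ls /allP l's; apply/allP => _ /allpairsP[[a b] [/= al bl ->]] /=.
apply/in_dualP => i iS; rewrite pairing_addl addr_ge0 //.
  exact: (in_dualP _ _ (ls a al)).
exact: (in_dualP _ _ (l's b bl)).
Qed.

(** For a full-dimensional cone these are the Hilbert basis of the monoid of lattice points in the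
    dual cone. *)
Definition irreducible_in S m := [/\ @in_dual R n D S m, m != 0 &
  forall a b, in_dual S a -> in_dual S b -> m = a + b -> a = 0 \/ b = 0].

(* The coefficient at an irreducible exponent is a point derivation. *)
Lemma lcoef_lmul S l l' m : irreducible_in S m ->
  all (fun a => in_dual S a.2) l -> all (fun a => in_dual S a.2) l' ->
  lcoef (lmul l l') m = lcoef l 0 * lcoef l' m + lcoef l m * lcoef l' 0.
Proof.
move=> [_ m0 mirr] /allP ls /allP l's.
rewrite /lcoef big_mkcond big_allpairs_dep /=.
rewrite !(big_mkcond (fun a : C * 'rV[int]_n => a.2 == _)) /=.
rewrite !mulr_suml -big_split /=; apply: eq_big_seq => a al.
rewrite !mulr_sumr -big_split /=; apply: eq_big_seq => b bl.
have [E|ne] := eqVneq (a.2 + b.2) m; last first.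
  have [a0|a0] := eqVneq a.2 0.
    move: ne; rewrite a0 add0r => /negPf ->.
    by rewrite mulr0 add0r (negPf (_ : 0 != m)) ?mul0r // eq_sym.
  have [b0|b0] := eqVneq b.2 0; last by rewrite mul0r mulr0 addr0.
  by move: ne; rewrite b0 addr0 => /negPf ->; rewrite !mul0r addr0.
have [a0|b0] := mirr _ _ (ls a al) (l's b bl) (esym E).
  move: E; rewrite a0 add0r => ->; rewrite !eqxx eq_sym (negPf m0).
  by rewrite mul0r addr0.
move: E; rewrite b0 addr0 => ->; rewrite !eqxx (negPf m0) eq_sym (negPf m0).
by rewrite mul0r add0r.
Qed.

End Coefficients.

Lemma left_kernel (F : fieldType) p q (M : 'M[F]_(p, q)) : (q < p)%N ->
  exists c : 'rV_p, c != 0 /\ c *m M = 0.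
Proof.
move=> qp; have : kermx M != 0.
  rewrite kermx_eq0 /row_free ltn_eqF //.
  exact: leq_ltn_trans (rank_leq_col M) qp.
move=> /rowV0Pn[c /sub_kermxP cM c0]; by exists c.
Qed.

(** * Bounds on the dimension of cotangent spaces *)

Section Cotangent.
Variables (C : fieldType) (X : fspace C) (x : X).
Implicit Types f g : X -> C.

Local Notation m2 := (@max_ideal_sq C X x).

Lemma max_ideal_sq_ext f g : (\forall y \near x, f y = g y) -> m2 f -> m2 g.
Proof.
move=> fg [k [a [b [am bm fE]]]]; exists k, a, b; split=> //.
by move: fg fE; apply: filterS2 => y -> ->.
Qed.

Lemma max_ideal_sq_ext1 f g : f =1 g -> m2 f -> m2 g.
Proof. by move=> fg; apply: max_ideal_sq_ext; apply: nearW. Qed.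

Lemma max_ideal_sq_add f g : m2 f -> m2 g -> m2 (fun y => f y + g y).
Proof.
move=> [k [a [b [am bm fE]]]] [k' [a' [b' [am' bm' gE]]]].
exists (k + k')%N, (fun i => match split i with inl j => a j | inr j => a' j end),
  (fun i => match split i with inl j => b j | inr j => b' j end).
split=> [i|i|]; [by case: (split i)|by case: (split i)|].
move: fE gE; apply: filterS2 => y -> ->; rewrite big_split_ord; congr (_ + _).
  by apply: eq_bigr => i _; rewrite (unsplitK (inl i)).
by apply: eq_bigr => i _; rewrite (unsplitK (inr i)).
Qed.

Lemma max_ideal_scale c f : max_ideal x f -> max_ideal x (fun y => c * f y).
Proof.
move=> [[U [oU Ux rf]] fx]; split; last by rewrite fx mulr0.
by exists U; split=> //; apply: regular_mul => //; exact: regular_cst.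
Qed.

Lemma max_ideal_sq_scale c f : m2 f -> m2 (fun y => c * f y).
Proof.
move=> [k [a [b [am bm fE]]]]; exists k, (fun i y => c * a i y), b; split=> //.
  by move=> i; exact: max_ideal_scale.
move: fE; apply: filterS => y ->; rewrite mulr_sumr.
by apply: eq_bigr => i _; rewrite mulrA.
Qed.

Lemma max_ideal_sq_mul f g : max_ideal x f -> max_ideal x g -> m2 (fun y => f y * g y).
Proof.
move=> fm gm; exists 1%N, (fun=> f), (fun=> g); split=> //.
by apply: nearW => y; rewrite big_ord1.
Qed.

Lemma max_ideal_sq0 : m2 (fun=> 0).
Proof.
by exists 0%N, (fun=> (fun=> 0)), (fun=> (fun=> 0)); split=> [[]//|[]//|];
  apply: nearW => y; rewrite big_ord0.
Qed.

Lemma max_ideal_sq_sum (I : Type) (s : seq I) (F : I -> X -> C) :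
  (forall i, m2 (F i)) -> m2 (fun y => \sum_(i <- s) F i y).
Proof.
move=> FQ; elim: s => [|i s IHs].
  by apply: max_ideal_sq_ext1 max_ideal_sq0 => y; rewrite big_nil.
apply: max_ideal_sq_ext1 (max_ideal_sq_add (FQ i) IHs) => y.
by rewrite big_cons.
Qed.

(** Exchange modulo the square of the maximal ideal: with more [gs] than [fs], a vector in the left
    kernel of the coefficient matrix is a nontrivial relation among the [gs]. *)
Lemma independent_le_spanning p q (gs : 'I_p -> X -> C) (fs : 'I_q -> X -> C) :
  (forall i, exists c : 'rV_q, m2 (fun y => gs i y - \sum_j c 0 j * fs j y)) ->
  (forall c : 'rV_p, m2 (fun y => \sum_i c 0 i * gs i y) -> c = 0) ->
  (p <= q)%N.
Proof.
move=> /choice[M MP] gi; rewrite leqNgt; apply/negP => qp.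
have [c [c0 cM]] := left_kernel (\matrix_(i, j) M i 0 j) qp.
case/eqP: c0; apply: gi.
apply: max_ideal_sq_ext1 (max_ideal_sq_sum (index_enum _)
  (fun i => max_ideal_sq_scale (c 0 i) (MP i))) => y /=.
under eq_bigr do rewrite mulrBr; rewrite sumrB -[RHS]subr0; congr (_ - _).
under eq_bigr do rewrite mulr_sumr; rewrite exchange_big /=.
rewrite big1 // => j _; have /matrixP/(_ 0 j) := cM; rewrite !mxE => cMj.
under eq_bigr do rewrite mulrA; rewrite -mulr_suml.
rewrite (eq_bigr (fun i => c 0 i * (\matrix_(i, j) M i 0 j) i j)).
  by rewrite cMj mul0r.
by move=> i _; rewrite mxE.
Qed.

Lemma cotangent_dim_le d q (fs : 'I_q -> X -> C) : cotangent_dim x d ->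
  (forall f, max_ideal x f ->
     exists c : 'rV_q, m2 (fun y => f y - \sum_j c 0 j * fs j y)) ->
  (d <= q)%N.
Proof.
move=> [b [bm bP]] fsP; apply: (@independent_le_spanning _ _ b fs).
  by move=> i; exact: fsP.
(* Independence of [b] is read off from the uniqueness clause at the zero germ, for which both 0 and
   [- c] qualify. *)
move=> c cQ; have [|c' [_ c'U]] := bP (fun=> 0).
  split=> //; exists setT; split=> //; first exact: openT.
  by apply: regular_cst; exact: openT.
have c'0 : c' = 0.
  apply: c'U; apply: max_ideal_sq_ext1 (max_ideal_sq0) => y.
  by rewrite big1 ?subr0 // => i _; rewrite mxE mul0r.
have c'c : c' = - c.
  apply: c'U; apply: max_ideal_sq_ext1 cQ => y; rewrite sub0r -sumrN.
  by apply: eq_bigr => i _; rewrite mxE mulNr opprK.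
by rewrite -[c]opprK -c'c c'0 oppr0.
Qed.

Lemma cotangent_dim_ge d p (gs : 'I_p -> X -> C) : cotangent_dim x d ->
  (forall i, max_ideal x (gs i)) ->
  (forall c : 'rV_p, m2 (fun y => \sum_i c 0 i * gs i y) -> c = 0) ->
  (p <= d)%N.
Proof.
move=> [b [bm bP]] gm gi; apply: (@independent_le_spanning _ _ gs b) => // i.
by have [c [cQ _]] := bP (gs i) (gm i); exists c.
Qed.

End Cotangent.

Section ToricCotangent.
Variables (C : closedFieldType) (R : realType) (n : nat) (D : fan R n).
Implicit Types (S : {set 'I_(nrays D)}) (m : 'rV[int]_n).
Implicit Types (l : seq (C * 'rV[int]_n)).

Local Notation X := (toric_variety C D).

Lemma regular_lfun (s : toric_index D) l : all (fun a => in_dual (sval s) a.2) l ->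
  regular (toric_chart s : set X) (lfun l).
Proof.
have oc := @toric_chart_open C _ _ _ s.
elim: l => [_|a l IHl /= /andP[as_ ls]].
  apply: (regular_ext oc (f := fun=> 0)); last exact: regular_cst.
  by move=> y _; rewrite /lfun big_nil.
apply: (regular_ext oc (f := fun y : X => a.1 * tval y a.2 + lfun l y)).
  by move=> y _; rewrite /lfun big_cons.
apply: regular_add => //; last exact: IHl.
by apply: regular_mul => //; [exact: regular_cst|exact: regular_tval].
Qed.

Lemma toric_regularP (s : toric_index D) (U : set X) f x : open U -> regular U f ->
  U x -> toric_chart s x -> exists a b,
    [/\ all (fun a => in_dual (sval s) a.2) a, all (fun a => in_dual (sval s) a.2) b,
      lfun b x != 0, f x = lfun a x / lfun b x &
      \forall y \near (x : X), [/\ toric_chart s y, lfun b y != 0 &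
        f y = lfun a y / lfun b y]].
Proof.
move=> oU rf Ux sx; have [a [b [[la [las aE]] [lb [lbs bE]] bx fE]]] := rf s x Ux sx.
have lbx : lfun lb x != 0 by rewrite -[lfun _ _]bE.
exists la, lb; split=> //.
  by rewrite (fE x) // aE // bE.
have oN : open (U `&` (toric_chart s `&` [set y : X | lfun lb y != 0])).
  apply: openI => //; apply: open_nonvanishing; first exact: toric_chart_open.
  exact: regular_lfun.
have : nbhs (x : X) (U `&` (toric_chart s `&` [set y : X | lfun lb y != 0])).
  by apply: open_nbhs_nbhs; split.
apply: filterS => y [Uy [sy lby]]; split=> //.
by rewrite (fE y) ?aE ?bE // -[lfun _ _]bE.
Qed.

Let s0 : toric_index D := exist _ finset.set0 (set0_cones D).
Let x1 : X := torus_point D (fun k : 'I_n => oner_neq0 C).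

Lemma x1E m : tval x1 m = 1.
Proof. by rewrite torus_pointE big1 // => k _; rewrite exp1rz. Qed.

Lemma in_dual_set0 m : in_dual (finset.set0 : {set 'I_(nrays D)}) m.
Proof. exact/in_perp_dual/in_perp_set0. Qed.

Lemma toric_chart_x1 : toric_chart s0 x1. Proof. exact: fintype.subxx. Qed.

Let E m (y : X) : C := tval y m - 1.

Let Em m : max_ideal x1 (E m).
Proof.
split; last by rewrite /E x1E subrr.
exists (toric_chart s0); split; first exact: toric_chart_open.
  exact: toric_chart_x1.
have oc := @toric_chart_open C _ _ _ s0.
apply: regular_add => //; first exact/regular_tval/in_dual_set0.
exact: regular_cst.
Qed.

Let L m (y : X) : C := \sum_(k < n) (m 0 k)%:~R * E (delta_mx 0 k) y.

Lemma near_chart0 (P : X -> Prop) : (forall y, toric_chart s0 y -> P y) ->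
  \forall y \near x1, P y.
Proof.
move=> H; have : nbhs x1 (toric_chart s0 : set X).
  by apply: open_nbhs_nbhs; split; [exact: toric_chart_open|exact: toric_chart_x1].
exact: filterS.
Qed.

(** The error is additive in the exponent: uv - 1 = (u - 1) + (v - 1) + (u - 1)(v - 1), and the last
    term is in the square of the maximal ideal. *)
Lemma character_linear m : max_ideal_sq x1 (fun y => E m y - L m y).
Proof.
have LD m' m'' y : L (m' + m'') y = L m' y + L m'' y.
  by rewrite /L -big_split; apply: eq_bigr => k _; rewrite mxE intrD mulrDl.
have LN m' y : L (- m') y = - L m' y.
  by rewrite /L -sumrN; apply: eq_bigr => k _; rewrite mxE intrN mulNr.
have P0 : max_ideal_sq x1 (fun y => E 0 y - L 0 y).
  apply: max_ideal_sq_ext1 (max_ideal_sq0 x1) => y.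
  rewrite /E tval0 subrr /L big1 ?subr0 // => k _; by rewrite mxE mul0r.
have tD m' m'' (y : X) : toric_chart s0 y -> tval y (m' + m'') = tval y m' * tval y m''.
  by move=> s0y; rewrite (tvalD s0y) // in_dual_set0.
have PD m' m'' : max_ideal_sq x1 (fun y => E m' y - L m' y) ->
    max_ideal_sq x1 (fun y => E m'' y - L m'' y) ->
    max_ideal_sq x1 (fun y => E (m' + m'') y - L (m' + m'') y).
  move=> Pm' Pm''; have := max_ideal_sq_add (max_ideal_sq_add Pm' Pm'')
    (max_ideal_sq_mul (Em m') (Em m'')).
  apply: max_ideal_sq_ext; apply: near_chart0 => y s0y.
  by rewrite LD /E tD //; ring.
have PN m' : max_ideal_sq x1 (fun y => E m' y - L m' y) ->
    max_ideal_sq x1 (fun y => E (- m') y - L (- m') y).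
  move=> Pm'; have := max_ideal_sq_scale (-1) (max_ideal_sq_add Pm'
    (max_ideal_sq_mul (Em m') (Em (- m')))).
  apply: max_ideal_sq_ext; apply: near_chart0 => y s0y.
  have := tD m' (- m') y s0y; rewrite subrr tval0 => t1.
  rewrite LN /E mulrDl !mulrDr -t1; ring.
have Pe k : max_ideal_sq x1 (fun y => E (delta_mx 0 k) y - L (delta_mx 0 k) y).
  apply: max_ideal_sq_ext1 (max_ideal_sq0 x1) => y.
  rewrite /L (bigD1 k) //= mxE !eqxx mul1r big1 ?addr0 ?subrr // => j jk.
  by rewrite mxE (negPf jk) andbF mul0r.
have Pn k j : max_ideal_sq x1 (fun y => E (delta_mx 0 k *+ j) y - L (delta_mx 0 k *+ j) y).
  by elim: j => [|j IHj]; [rewrite mulr0n|rewrite mulrS; exact: PD].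
have Pz k (z : int) : max_ideal_sq x1 (fun y =>
    E (z *: delta_mx 0 k) y - L (z *: delta_mx 0 k) y).
  case: z => j; first by rewrite -natz scaler_nat.
  by rewrite NegzE scaleNr -natz scaler_nat; exact: PN.
rewrite (row_sum_delta m); elim/big_rec: _ => // k m' _; exact: PD.
Qed.

(** Write f = a / b with [a] zero at the identity of the torus. Modulo the square of the maximal
    ideal, 1 / b may be replaced by its value and [a] by its linear part, so the n coordinate
    characters span. *)
Lemma torus_cotangent_dim d : cotangent_dim x1 d -> (d <= n)%N.
Proof.
move=> xd; apply: (cotangent_dim_le (fs := fun k => E (delta_mx 0 k)) xd).
move=> f fm; have [[U [oU Ux rf]] fx] := fm.
have [a [b [as0 bs0 bx fE fnear]]] := toric_regularP oU rf Ux toric_chart_x1.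
have ax : lfun a x1 = 0.
  by apply/eqP; move/eqP: fE; rewrite fx eq_sym mulf_eq0 invr_eq0 (negPf bx) orbF.
have lm l : all (fun a => in_dual (sval s0) a.2) l -> lfun l x1 = 0 ->
    max_ideal x1 (lfun l).
  move=> ls lx; split=> //; exists (toric_chart s0); split.
  - exact: toric_chart_open.
  - exact: toric_chart_x1.
  - exact: regular_lfun.
have am := lm a as0 ax.
pose b1 := lfun b x1.
have bm : max_ideal x1 (fun y => (lfun b y)^-1 - b1^-1).
  split; last by rewrite subrr.
  have oN : open ((toric_chart s0 : set X) `&` [set y : X | lfun b y != 0]).
    by apply: open_nonvanishing; [exact: toric_chart_open|exact: regular_lfun].
  exists ((toric_chart s0 : set X) `&` [set y : X | lfun b y != 0]); split=> //.
    by split; [exact: toric_chart_x1|].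
  apply: regular_add => //; last exact: regular_cst.
  apply: regular_inv => // [y []//|].
  apply: (@regular_res _ X (toric_chart s0)) => //; first exact: toric_chart_open.
  exact: regular_lfun.
exists (\row_k (b1^-1 * \sum_(p <- a) p.1 * (p.2 0 k)%:~R)).
have H1 := max_ideal_sq_scale b1^-1 (max_ideal_sq_sum a
  (fun p => max_ideal_sq_scale p.1 (character_linear p.2))).
apply: max_ideal_sq_ext (max_ideal_sq_add H1 (max_ideal_sq_mul am bm)).
apply: filterS fnear => y [s0y by0 ->] /=.
have aE : \sum_(p <- a) p.1 * E p.2 y = lfun a y.
  transitivity (lfun a y - lfun a x1); last by rewrite ax subr0.
  rewrite /lfun -sumrB; apply: eq_bigr => p _.
  by rewrite /E x1E mulrBr.
have bE : \sum_(p <- a) p.1 * (E p.2 y - L p.2 y) =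
    lfun a y - \sum_(p <- a) p.1 * L p.2 y.
  by rewrite -aE -sumrB; apply: eq_bigr => p _; rewrite mulrBr.
have cE : \sum_k (\row_k (b1^-1 * \sum_(p <- a) p.1 * (p.2 0 k)%:~R)) 0 k *
    E (delta_mx 0 k) y = b1^-1 * \sum_(p <- a) p.1 * L p.2 y.
  under [in RHS]eq_bigr do rewrite /L mulr_sumr; rewrite exchange_big mulr_sumr.
  apply: eq_bigr => k _; rewrite mxE -mulrA mulr_suml; congr (_ * _).
  by apply: eq_bigr => p _; rewrite mulrA.
by rewrite bE cE; ring.
Qed.

(** Multiply the difference by a function [e] that is nonzero at [x] and whose non-vanishing implies
    that the equality holds. The product is 0 on the torus, so all its coefficients vanish; at [m],
    the derivation rule leaves the constant coefficient of [e] times the difference. *)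
Lemma near_lfun_eq S (SD : S \in cones D) (x : X) l l' m : tcone x = S ->
  irreducible_in S m ->
  all (fun a => in_dual S a.2) l -> all (fun a => in_dual S a.2) l' ->
  lcoef l 0 = 0 -> lcoef l' 0 = 0 ->
  (forall e : seq (C * 'rV[int]_n), all (fun a => in_dual S a.2) e ->
     lfun e x = lcoef e 0) ->
  (\forall y \near x, lfun l y = lfun l' y) -> lcoef l m = lcoef l' m.
Proof.
move=> xS mirr ls l's l0 l'0 xE.
move=> near_eq; have : nbhs x [set y | lfun l y = lfun l' y] by exact: near_eq.
rewrite nbhsE => -[B [oB Bx] BE].
pose s : toric_index D := exist _ S SD.
have sx : toric_chart s x by rewrite /toric_chart /= xS.
have [f [[e [es eE]] fx fB]] := (glued_openE B).1 oB s x Bx sx.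
have elx : lcoef e 0 != 0 by rewrite -xE // -[lfun _ _]eE.
pose neg (k : seq (C * 'rV[int]_n)) := [seq (- p.1, p.2) | p <- k].
have negs k : all (fun a => in_dual S a.2) (neg k) = all (fun a => in_dual S a.2) k.
  by rewrite /neg all_map.
have negf k y : lfun (neg k) y = - lfun k y.
  by rewrite /lfun /neg big_map -sumrN; apply: eq_bigr => p _; rewrite mulNr.
have negc k a : lcoef (neg k) a = - lcoef k a.
  by rewrite /lcoef /neg big_map -sumrN.
have ds : all (fun a => in_dual S a.2) (l ++ neg l').
  by rewrite all_cat ls negs l's.
have := @lfun_eq0_lcoef C R n D (lmul e (l ++ neg l')) _ m.
rewrite (lcoef_lmul mirr) // lcoef_cat negc lcoef_cat negc l0 l'0 subrr mulr0 addr0.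
move=> H; suff /eqP : lcoef e 0 * (lcoef l m - lcoef l' m) = 0.
  by rewrite mulf_eq0 (negPf elx) subr_eq0 => /eqP.
apply: H => y y0.
have sy : toric_chart s y by rewrite /toric_chart /= y0 finset.sub0set.
rewrite (lfunM sy) // lfun_cat negf.
have [->|ey] := eqVneq (lfun e y) 0; first by rewrite mul0r.
rewrite BE ?subrr ?mulr0 //; apply: fB => //.
by rewrite eE.
Qed.

(** At the torus-fixed point of [S], the coefficient at an irreducible exponent kills the square of
    the maximal ideal, so the characters of [hs] are independent in the cotangent space. Its
    dimension [d] is the same at the identity of the torus, where it is at most n. *)
Lemma irreducibles_bound S (hs : seq 'rV[int]_n) d :
  S \in cones D -> full_cone S -> uniq hs -> (forall h, h \in hs -> irreducible_in S h) ->
  (forall x : X, cotangent_dim x d) -> (size hs <= n)%N.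
Proof.
move=> SD Sf uh hP xd; apply: leq_trans (torus_cotangent_dim (xd x1)).
have f0 : forall m, in_perp S m -> (1 : C) != 0 by move=> m _; exact: oner_neq0.
have fM : forall m m', in_perp S m -> in_perp S m' -> (1 : C) = 1 * 1.
  by move=> m m' _ _; rewrite mulr1.
pose x : X := mkpoint (f := fun=> 1) SD f0 fM.
pose s : toric_index D := exist _ S SD.
have sx : toric_chart s x by exact: fintype.subxx.
(* As [S] is full-dimensional, only the exponent 0 is orthogonal to it, so every other character
   vanishes at [x]. *)
have tx m : tval x m = (m == 0)%:R.
  rewrite /=; case: ifP => [/Sf ->|mS]; first by rewrite eqxx.
  by case: eqP mS => // ->; rewrite in_perp0.
have xE e : lfun e x = lcoef e 0.
  rewrite /lfun /lcoef [RHS]big_mkcond; apply: eq_bigr => p _.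
  by rewrite tx; case: eqP; rewrite ?mulr1 ?mulr0.
pose gs (i : 'I_(size hs)) (y : X) : C := tval y (nth 0 hs i).
have hsP (i : 'I_(size hs)) : irreducible_in S (nth 0 hs i) by exact/hP/mem_nth.
apply: (cotangent_dim_ge (gs := gs) (xd x)) => [i|c].
  have [hd h0 _] := hsP i; split; last by rewrite /gs tx (negPf h0).
  exists (toric_chart s); split=> //; first exact: toric_chart_open.
  exact: regular_tval.
move=> [k [a [b [am bm cE]]]]; apply/rowP => j; rewrite mxE.
have rep f : max_ideal x f -> exists e e',
    [/\ all (fun p => in_dual S p.2) e, all (fun p => in_dual S p.2) e',
        lcoef e 0 = 0, lcoef e' 0 != 0 &
        \forall y \near x, [/\ toric_chart s y, lfun e' y != 0 &
          f y = lfun e y / lfun e' y]].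
  move=> [[U [oU Ux rf]] fx].
  have [e [e' [es e's e'x fE fnear]]] := toric_regularP oU rf Ux sx.
  exists e, e'; split=> //; rewrite -xE //.
  by apply/eqP; move/eqP: fE; rewrite fx eq_sym mulf_eq0 invr_eq0 (negPf e'x) orbF.
have [h0d h0 _] := hsP j.
(* A finite sum of products of elements of the maximal ideal is a quotient of
   combinations of characters whose numerator has no coefficient at h_j. *)
have [e [e' [es e's e0 [e'0 ej] enear]]] : exists e e',
    [/\ all (fun p => in_dual S p.2) e, all (fun p => in_dual S p.2) e',
        lcoef e 0 = 0, lcoef e' 0 != 0 /\ lcoef e (nth 0 hs j) = 0 &
        \forall y \near x, [/\ toric_chart s y, lfun e' y != 0 &
          \sum_i a i y * b i y = lfun e y / lfun e' y]].
  elim: k a b am bm {cE} => [|k IHk] a b am bm.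
    exists [::], [:: (1, 0)]; split=> //.
    - by rewrite /= in_perp_dual // in_perp0.
    - by rewrite /lcoef big_nil.
    - by rewrite /lcoef big_nil big_cons big_nil eqxx addr0 oner_neq0.
    - have : nbhs x (toric_chart s : set X).
        by apply: open_nbhs_nbhs; split=> //; exact: toric_chart_open.
      apply: filterS => y sy; rewrite big_ord0 /lfun big_nil mul0r big_seq1 tval0.
      by rewrite mulr1 oner_neq0.
  have [e [e' [es e's e0 [e'0 ej] enear]]] := IHk (fun i => a (lift ord0 i))
    (fun i => b (lift ord0 i)) (fun i => am _) (fun i => bm _).
  have [p [p' [ps p's p0 p'0 pnear]]] := rep _ (am ord0).
  have [q [q' [qs q's q0 q'0 qnear]]] := rep _ (bm ord0).
  have pq's := all_lmul p's q's; have pqs := all_lmul ps qs.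
  exists (lmul (lmul p q) e' ++ lmul e (lmul p' q')), (lmul e' (lmul p' q')).
  have c0M l l' : all (fun a => in_dual S a.2) l -> all (fun a => in_dual S a.2) l' ->
      lcoef (lmul l l') 0 = lcoef l 0 * lcoef l' 0.
    by move=> ls l's; rewrite -!xE (lfunM sx).
  split; rewrite ?all_cat ?all_lmul //.
  - by rewrite lcoef_cat !c0M ?all_lmul // p0 e0 !mul0r addr0.
  - rewrite !c0M ?all_lmul // !mulf_neq0 //; split=> //.
    rewrite lcoef_cat !(lcoef_lmul (hsP j)) ?all_lmul // c0M // p0 q0 e0 ej.
    by rewrite !(mul0r, mulr0, addr0).
  - apply: filterS3 enear pnear qnear => y [sy e'y eE] [_ p'y pE] [_ q'y qE].
    rewrite lfun_cat !(lfunM sy) ?all_lmul // !mulf_neq0 //; split=> //.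
    by rewrite big_ord_recl eE pE qE mulf_div addf_div ?mulf_neq0 //;
      congr (_ / _); ring.
pose l := [seq (c 0 i, nth 0 hs i) | i <- index_enum 'I_(size hs)].
have ls : all (fun p => in_dual S p.2) l.
  by apply/allP => _ /mapP[i _ ->] /=; case: (hsP i).
have l0 : lcoef l 0 = 0.
  rewrite /lcoef /l big_map big1 // => i /= /eqP hi0.
  by have [_ /eqP] := hsP i; rewrite hi0.
have lj : lcoef l (nth 0 hs j) = c 0 j.
  rewrite /lcoef /l big_map (bigD1 j) //= big1 ?addr0 // => i /andP[/eqP hij ij].
  case/negP: ij; apply/eqP/val_inj/eqP.
  by rewrite -(nth_uniq 0 (ltn_ord i) (ltn_ord j) uh) hij.
have := @near_lfun_eq S SD x (lmul e' l) e (nth 0 hs j) erefl (hsP j) _ es _ e0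
  (fun e _ => xE e).
rewrite ej (lcoef_lmul (hsP j)) // l0 mulr0 addr0 lj => H.
suff /eqP : lcoef e' 0 * c 0 j = 0 by rewrite mulf_eq0 (negPf e'0) => /eqP.
apply: H.
- exact: all_lmul.
- by rewrite -xE (lfunM sx) // !xE l0 mulr0.
apply: filterS2 enear cE => y [sy e'y eE] cE.
rewrite (lfunM sy) // (_ : lfun l y = \sum_i c 0 i * gs i y).
  by rewrite cE eE mulrC divfK.
by rewrite /lfun /l big_map.
Qed.

End ToricCotangent.

(** * Smoothness of full-dimensional cones *)

Section SmoothCones.
Variables (R : realType) (n : nat) (D : fan R n).
Implicit Types (S T : {set 'I_(nrays D)}) (m v : 'rV[int]_n).

(* The rays of S form a basis of the lattice, mu being the dual basis. *)
Definition dual_basis S (mu : 'I_(nrays D) -> 'rV[int]_n) :=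
  (forall i k, i \in S -> k \in S -> pairing (mu i) (ray D k) = (i == k)%:R) /\
  (forall v, v = \sum_(i in S) pairing (mu i) v *: ray D i).

(** Induction on the sum of the pairings with the rays of [S], which is additive and, [S] being
    full-dimensional, positive at the nonzero points of the dual cone. *)
Lemma irreducible_decomposition S m : S \in cones D -> full_cone S ->
  in_dual S m -> exists s : seq 'rV[int]_n,
    (forall h, h \in s -> irreducible_in S h) /\ m = \sum_(h <- s) h.
Proof.
move=> SD Sf; pose len m := \sum_(i in S) pairing m (ray D i).
have len0 a : in_dual S a -> 0 <= len a.
  by move=> /in_dualP aS; apply: sumr_ge0.
have len_eq0 a : in_dual S a -> len a = 0 -> a = 0.
  move=> /in_dualP aS /eqP; rewrite psumr_eq0 // => /allP H; apply: Sf.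
  apply/in_perpP => i iS.
  by have := H i (mem_index_enum _); rewrite iS => /eqP.
have lenD a b : len (a + b) = len a + len b.
  by rewrite /len -big_split; apply: eq_bigr => i _; rewrite pairing_addl.
have [k] := ubnP `|len m|%N; elim: k m => // k IHk m mk md.
have [->|m0] := eqVneq m 0; first by exists [::]; rewrite big_nil; split.
have [irr|nirr] := pselect (irreducible_in S m).
  by exists [:: m]; rewrite big_seq1; split=> // h; rewrite inE => /eqP ->.
have [a [b [ad bd mE a0 b0]]] : exists a b, [/\ in_dual S a, in_dual S b, m = a + b,
    a != 0 & b != 0].
  apply: contrapT => H; apply: nirr; split=> // a b ad bd mE.
  apply: contrapT => /not_orP[/eqP a0 /eqP b0]; apply: H.
  by exists a, b.
have la : 0 < len a by rewrite lt_def len0 // andbT; apply: contraNneq a0 => /len_eq0 ->.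
have lb : 0 < len b by rewrite lt_def len0 // andbT; apply: contraNneq b0 => /len_eq0 ->.
have := lenD a b; rewrite -mE => lmE.
have [|s [sP aE]] := IHk a _ ad; first by lia.
have [|t [tP bE]] := IHk b _ bd; first by lia.
exists (s ++ t); split; last by rewrite big_cat /= -aE -bE.
by move=> h; rewrite mem_cat => /orP[/sP|/tP].
Qed.

(** Without a complete list, duplicate-free lists of every length could be built, against the
    bound. *)
Lemma all_irreducibles S :
  (forall hs, uniq hs -> (forall h, h \in hs -> irreducible_in S h) -> (size hs <= n)%N) ->
  exists hs, [/\ uniq hs, forall h, h \in hs -> irreducible_in S h &
    forall h, irreducible_in S h -> h \in hs].
Proof.
move=> bound; apply: contrapT => H.
suff : forall k, exists hs : seq 'rV[int]_n, [/\ uniq hs, size hs = k &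
    forall h, h \in hs -> irreducible_in S h].
  by move=> /(_ n.+1)[hs [uh sh hP]]; have := bound hs uh hP; rewrite sh ltnn.
elim=> [|k [hs [uh sh hP]]]; first by exists [::].
have [h hirr hn] : exists2 h, irreducible_in S h & h \notin hs.
  apply: contrapT => K; apply: H; exists hs; split=> // h hirr.
  by apply: contrapT => /negP hn; apply: K; exists h.
exists (h :: hs); split; rewrite /= ?uh ?hn ?sh // => g.
by rewrite inE => /predU1P[->|/hP].
Qed.

Lemma nat_combination (hs s : seq 'rV[int]_n) : uniq hs ->
  (forall h, h \in s -> h \in hs) ->
  \sum_(h <- s) h = \sum_(i < size hs) (count_mem (nth 0 hs i) s)%:Z *: nth 0 hs i.
Proof.
move=> uh; elim: s => [|h s IHs] sP.
  by rewrite big_nil big1 // => i _; rewrite scale0r.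
rewrite big_cons IHs; last by move=> g gs; apply: sP; rewrite inE gs orbT.
have hh := sP h (mem_head _ _); have hi : (index h hs < size hs)%N by rewrite index_mem.
rewrite (bigD1 (Ordinal hi)) //= [RHS](bigD1 (Ordinal hi)) //= nth_index // eqxx.
rewrite addrA; congr (_ + _); first by rewrite add1n intS scalerDl scale1r.
apply: eq_bigr => i ih; rewrite (negPf (_ : h != nth 0 hs i)) //.
apply: contra ih => /eqP hE; apply/eqP/val_inj => /=.
by rewrite hE index_uniq.
Qed.

(* The irreducibles hs generate the lattice M, so by the bound there are exactly
   n of them and they form a basis; the vectors of the dual basis are the rays. *)
Lemma smooth_full_cone S : S \in cones D -> full_cone S ->
  (forall hs, uniq hs -> (forall h, h \in hs -> irreducible_in S h) -> (size hs <= n)%N) ->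
  exists mu, dual_basis S mu.
Proof.
move=> SD Sf bound; have [hs [uh hP hall]] := all_irreducibles bound.
have gen m : in_dual S m -> exists2 a : 'I_(size hs) -> int, forall j, 0 <= a j &
    m = \sum_j a j *: nth 0 hs j.
  move=> /(irreducible_decomposition SD Sf)[s [sP ->]].
  exists (fun j => (count_mem (nth 0 hs j) s)%:Z) => //.
  by apply: nat_combination => // h /sP /hall.
have [m0 m0P] := positive_functional SD.
have m0d : in_dual S m0 by apply/in_dualP => i iS; rewrite ltW // m0P.
(* Adding a multiple of [m0], positive on all rays of [S], moves any lattice point into the dual
   cone; differences then show that [hs] generates the whole lattice. *)
have genZ m : exists a : 'I_(size hs) -> int, m = \sum_j a j *: nth 0 hs j.
  pose K : nat := (\sum_i `|pairing m (ray D i)|)%N.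
  have mKd : in_dual S (m + m0 *+ K).
    apply/in_dualP => i iS; rewrite pairing_addl -scaler_nat pairingZl natz.
    have : (`|pairing m (ray D i)| <= K)%N by rewrite /K (bigD1 i) //= leq_addr.
    have := m0P i iS; move: (pairing m0 _) (pairing m _) K => a b c; nia.
  have [a _ aE] := gen _ mKd; have [b _ bE] := gen _ m0d.
  exists (fun j => a j - b j *+ K).
  rewrite -[LHS](addrK (m0 *+ K)) aE bE -sumrMnl -sumrB.
  by apply: eq_bigr => j _; rewrite scalerBl -scalerMnl.
have shn : (size hs <= n)%N by exact: bound.
pose H := \matrix_(j < size hs, k < n) (nth 0 hs j) 0 k.
have [b bE] := choice (fun k => genZ (delta_mx 0 k)).
pose B := \matrix_(k < n, j < size hs) b k j.
have BH : B *m H = 1%:M.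
  apply/matrixP => k l; rewrite !mxE.
  have /rowP/(_ l) := bE k; rewrite mxE eqxx summxE eq_sym => ->.
  by apply: eq_bigr => j _; rewrite !mxE.
(* Over the rationals, [B *m H = 1] forces [H] to have at least n rows; the bound gives the other
   inequality. *)
have shE : size hs = n.
  apply/eqP; rewrite eqn_leq shn /=.
  have := congr1 (map_mx (intr : int -> rat)) BH.
  rewrite map_mxM map_mx1 => BHq.
  rewrite -{1}(mxrank1 rat n) -BHq; apply: leq_trans (mxrankM_maxr _ _) _.
  exact: rank_leq_row.
have HB : H *m B = 1%:M.
  move: H B BH; rewrite shE => H B; exact: mulmx1C.
pose w j := \row_k B k j.
have hw (l j : 'I_(size hs)) : pairing (nth 0 hs l) (w j) = (l == j)%:R.
  have /matrixP/(_ l j) := HB; rewrite !mxE => <-.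
  by apply: eq_bigr => k _; rewrite !mxE.
have vE v : v = \sum_(j < size hs) pairing (nth 0 hs j) v *: w j.
  apply/rowP => k; rewrite summxE.
  have := congr1 (fun A => (A *m v^T) k 0) BH; rewrite mul1mx -mulmxA !mxE => <-.
  apply: eq_bigr => j _; rewrite !mxE mulrC; congr (_ * _).
  by apply: eq_bigr => i _; rewrite !mxE.
(* A vector outside the cone is negative on some point of the dual cone; that point is a
   non-negative combination of [hs], on which [w j] cannot be negative. *)
have wcone j : qcone (ray D) S (map_mx intr (w j)).
  have [//|[m /in_dualP mS mv]] := integer_farkas0 (ray D) S (w j).
  have [a a0 aE] := gen m mS; move: mv; rewrite aE pairing_suml (bigD1 j) //=.
  rewrite pairingZl hw eqxx mulr1 big1 ?addr0 ?ltNge ?a0 // => l lj.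
  by rewrite pairingZl hw (negPf lj) mulr0.
have hray (j : 'I_(size hs)) i : i \in S -> 0 <= pairing (nth 0 hs j) (ray D i).
  by have [/in_dualP + _ _] := hP _ (mem_nth 0 (ltn_ord j)); apply.
(* A ray occurring in [w j] with positive coefficient is killed by the other elements of [hs], so it
   is a multiple of [w j], and primitivity makes it equal to [w j]. *)
have wray j : exists2 i, i \in S & ray D i = w j.
  have [c c0 E] := wcone j.
  have [i /andP[iS ci]] : exists i, (i \in S) && (0 < c i).
    apply: contrapT => K; have := hw j j; rewrite eqxx.
    suff -> : w j = 0 by rewrite pairing0r.
    apply/rowP => k; have /rowP/(_ k) := E; rewrite big1 => [|i iS].
      by rewrite !mxE => /eqP; rewrite intr_eq0 => /eqP.
    have [ci|] := ltP 0 (c i); first by case: K; exists i; rewrite iS.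
    by move=> ci; rewrite (@le_anti _ _ (c i) 0) ?ci ?c0 // scale0r.
  exists i => //.
  have hl l : l != j -> pairing (nth 0 hs l) (ray D i) = 0.
    move=> lj; have := hw l j; rewrite (negPf lj) => hwl.
    have : pairing (map_mx intr (nth 0 hs l)) (map_mx intr (w j)) = 0 :> rat.
      by rewrite pairing_intr hwl.
    rewrite E pairing_sumr => /eqP; rewrite psumr_eq0 => [|k kS]; last first.
      by rewrite pairingZr mulr_ge0 // pairing_intr ler0z hray.
    move=> /allP/(_ i (mem_index_enum _)); rewrite iS pairingZr pairing_intr.
    by rewrite mulf_eq0 gt_eqF //= intr_eq0 => /eqP.
  have rE : ray D i = pairing (nth 0 hs j) (ray D i) *: w j.
    rewrite {1}(vE (ray D i)) (bigD1 j) //= big1 ?addr0 // => l lj.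
    by rewrite hl // scale0r.
  by have := ray_primitive rE; rewrite ger0_norm ?hray // => h1; rewrite rE h1 scale1r.
have [f fP] := choice (fun j => let: ex_intro2 i iS iE := wray j in
  ex_intro (fun i => i \in S /\ ray D i = w j) i (conj iS iE)).
have fS j : f j \in S by case: (fP j).
have fw j : ray D (f j) = w j by case: (fP j).
(* Conversely, a ray of [S] is a non-negative combination of the [w j], which are rays of [S];
   extremality identifies it with one of them. *)
have fonto i : i \in S -> exists j, f j = i.
  move=> iS; pose c k : R := (\sum_(j < size hs | f j == k) pairing (nth 0 hs j) (ray D i))%:~R.
  have c0 k : 0 <= c k by rewrite ler0z sumr_ge0 // => j _; exact: hray.
  have E : toR R (ray D i) = \sum_(k in S) c k *: toR R (ray D k).
    rewrite {1}(vE (ray D i)) (partition_big f (mem S)) //= toR_sum.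
    apply: eq_bigr => k kS; rewrite -toRZ scaler_suml; congr (toR _ _).
    by apply: eq_bigr => j /eqP <-; rewrite fw.
  have [j hj] : exists j : 'I_(size hs), 0 < pairing (nth 0 hs j) (ray D i).
    apply: contrapT => K; have /eqP := ray_neq0 i; apply; rewrite (vE (ray D i)).
    rewrite big1 // => j _; suff -> : pairing (nth 0 hs j) (ray D i) = 0 by rewrite scale0r.
    by apply: le_anti; rewrite hray // andbT leNgt; apply/negP => hj; apply: K; exists j.
  exists j; apply: (cone_span_extremal SD c0 E (fS j)).
  rewrite ltr0z (bigD1 j) //= ltr_pwDl // sumr_ge0 // => l _; exact: hray.
exists (fun i => \sum_(j < size hs | f j == i) nth 0 hs j); split=> [i k iS kS|v].
  have [l <-] := fonto k kS; rewrite fw pairing_suml.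
  have [fl|fl] := eqVneq i (f l).
    rewrite (bigD1 l) ?fl //= hw eqxx big1 ?addr0 // => j /andP[_ jl].
    by rewrite hw (negPf jl).
  rewrite big1 // => j /eqP fj; rewrite hw; case: eqP => // jl.
  by case/eqP: fl; rewrite -jl.
rewrite {1}(vE v) (partition_big f (mem S)) //=; apply: eq_bigr => k kS.
rewrite pairing_suml scaler_suml; apply: eq_bigr => j /eqP <-.
by rewrite fw.
Qed.

End SmoothCones.

Section SmoothFans.
Variables (R : realType) (n : nat) (D : fan R n).
Implicit Types (S T : {set 'I_(nrays D)}) (m v : 'rV[int]_n).

Definition smooth_cone S := S \in cones D /\ exists mu, dual_basis S mu.

Definition smooth_complete := forall v : 'rV[int]_n,
  exists2 S, smooth_cone S & qcone (ray D) S (map_mx intr v).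

Lemma smooth_complete_fan (C : closedFieldType) :
  complete (toric_variety C D) -> nonsingular (toric_variety C D) ->
  smooth_complete.
Proof.
move=> Xc [d [_ Xd]] v.
have [S [SD Sf Sv]] := full_support (complete_support Xc) v.
exists S => //; split=> //; apply: smooth_full_cone => // hs uh hP.
exact: (irreducibles_bound SD Sf uh hP Xd).
Qed.

(** The sum of the dual basis vectors outside [T] is 0 on [T] and positive on the other rays, so it
    cuts out the span of [T] as a face. The fan axiom gives a member with that span, and its rays
    must be those of [T]. *)
Lemma subset_smooth_cone S T mu : S \in cones D -> dual_basis S mu ->
  T \subset S -> T \in cones D.
Proof.
move=> SD [muE _] TS; pose m := \sum_(i in S :\: T) mu i.
have mE k : k \in S -> pairing m (ray D k) = (k \notin T)%:R.
  move=> kS; rewrite /m pairing_suml; have [kT|kT] := boolP (k \in T).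
    rewrite big1 // => i; rewrite finset.in_setD => /andP[iT iS].
    by rewrite muE //; case: eqP => // ik; rewrite ik kT in iT.
  rewrite (bigD1 k) ?finset.in_setD ?kT //= muE // eqxx big1 ?addr0 //.
  move=> i /andP[]; rewrite finset.in_setD => /andP[_ iS] ik.
  by rewrite muE // (negPf ik).
have mER k : k \in S -> pairing (toR R m) (toR R (ray D k)) = (k \notin T)%:R.
  by move=> kS; rewrite pairing_intr mE //; case: (k \in T).
have [|S' S'D E] := @cones_face _ _ D S (cone_span R (ray D) T) SD.
  exists (toR R m); split.
    move=> v [c [c0 ->]]; rewrite pairing_sumr sumr_ge0 // => k kS.
    by rewrite pairingZr mER // mulr_ge0 // ler0n.
  apply/seteqP; split=> [v vT|v [[c [c0 ->]]]] /=.
    split; first exact: cone_spanS vT.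
    have [c [c0 ->]] := vT; rewrite pairing_sumr big1 // => k kT.
    by rewrite pairingZr mER ?kT ?mulr0 //; exact: (fintype.subsetP TS).
  rewrite pairing_sumr => /eqP; rewrite psumr_eq0; last first.
    by move=> k kS; rewrite pairingZr mER // mulr_ge0 // ler0n.
  move=> /allP H; apply: cone_span_sum => k kS.
  have := H k (mem_index_enum _); rewrite kS pairingZr mER //.
  have [kT _|kT] := boolP (k \in T); first exact/cone_spanZ/cone_span_ray.
  by rewrite mulr1 => /= /eqP ->; rewrite scale0r; exact: cone_span0.
suff -> : T = S' by [].
apply/setP => i; apply/idP/idP => [iT|iS'].
  by apply: cone_span_mem => //; rewrite -E; exact: cone_span_ray.
have iT : cone_span R (ray D) T (toR R (ray D i)) by rewrite E; exact: cone_span_ray.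
have iS : i \in S by apply: cone_span_mem => //; exact: cone_spanS iT.
have : pairing (toR R m) (toR R (ray D i)) = 0.
  have [c [c0 ->]] := iT; rewrite pairing_sumr big1 // => k kT.
  by rewrite pairingZr mER ?kT ?mulr0 //; exact: (fintype.subsetP TS).
by rewrite mER //; case: (i \in T) => // /eqP; rewrite oner_eq0.
Qed.

Hypothesis smooth : smooth_complete.

(* The face S0 :&: S of S0 contains an interior point of S0. *)
Lemma cone_in_smooth S0 : S0 \in cones D ->
  exists2 S, smooth_cone S & S0 \subset S.
Proof.
move=> S0D; pose v := \sum_(i in S0) ray D i.
have [S Ss vS] := smooth v; exists S => //; have [SD _] := Ss.
have [m [mS0 FE]] := cones_inter S0D SD.
have mi i : i \in S0 -> 0 <= pairing m (toR R (ray D i)).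
  by move=> iS0; apply: mS0; exact: cone_span_ray.
have : pairing m (toR R v) = 0.
  have : (cone_span R (ray D) S0 `&` cone_span R (ray D) S) (toR R v).
    split; last exact: qcone_span.
    by rewrite /v toR_sum; apply: cone_span_sum => i iS0; exact: cone_span_ray.
  by rewrite FE => -[].
rewrite /v toR_sum pairing_sumr => /eqP; rewrite psumr_eq0 // => /allP H.
apply/fintype.subsetP => j jS0; apply: cone_span_mem => //.
have : (cone_span R (ray D) S0 `&` [set x | pairing m x = 0]) (toR R (ray D j)).
  split; first exact: cone_span_ray.
  by have := H j (mem_index_enum _); rewrite jS0 => /eqP.
by rewrite -FE => -[].
Qed.

Definition supported (a : 'I_(nrays D) -> nat) :=
  exists2 S, S \in cones D & forall i, i \notin S -> a i = 0%N.

Definition ray_sum (a : 'I_(nrays D) -> nat) := \sum_i (a i)%:Z *: ray D i.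

Lemma ray_sum_smooth S a : (forall i, i \notin S -> a i = 0%N) ->
  ray_sum a = \sum_(i in S) (a i)%:Z *: ray D i.
Proof.
move=> aS; rewrite /ray_sum (bigID (mem S)) /= [X in _ + X]big1 ?addr0 // => i iS.
by rewrite aS // scale0r.
Qed.

Lemma ray_sum_exists v : exists2 a, supported a & v = ray_sum a.
Proof.
have [S [SD [mu [muE vE]]] vS] := smooth v.
have mu0 i : i \in S -> 0 <= pairing (mu i) v.
  move=> iS; apply: (qcone_pairing_ge0 _ vS) => k kS.
  by rewrite muE //; case: eqP.
exists (fun i => if i \in S then `|pairing (mu i) v|%N else 0%N).
  by exists S => // i /negPf ->.
rewrite (@ray_sum_smooth S) => [|i /negPf -> //].
rewrite {1}(vE v); apply: eq_bigr => i iS.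
by rewrite iS gez0_abs // mu0.
Qed.

(** Enlarge [T] to a smooth cone [T']. The functional cutting out the intersection of [S] and [T']
    as a face of [S] vanishes on the common vector, so every ray with nonzero coefficient in [a]
    lies in [T']; there the dual basis reads off both families of coefficients. *)
Lemma ray_sum_inj a b : supported a -> supported b -> ray_sum a = ray_sum b -> a =1 b.
Proof.
move=> [S SD aS] [T TD bT] ab.
have [T' [T'D [mu [muE _]]] /fintype.subsetP TT'] := cone_in_smooth TD.
have bT' i : i \notin T' -> b i = 0%N by move=> iT; apply: bT; apply: contra iT => /TT'.
have aT' i : i \notin T' -> a i = 0%N.
  move=> iT'; apply: contrapT => /eqP ai.
  have iS : i \in S by apply: contraT => /aS ai0; rewrite ai0 eqxx in ai.
  case/negP: iT'; have [m [mS FE]] := cones_inter SD T'D.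
  have cone_sum (U : {set 'I_(nrays D)}) (c : 'I_(nrays D) -> nat) : (forall i, i \notin U -> c i = 0%N) ->
      cone_span R (ray D) U (toR R (ray_sum c)).
    move=> cU; rewrite (ray_sum_smooth cU) toR_sum; apply: cone_span_sum => k kU.
    by rewrite toRZ; apply: cone_spanZ; [rewrite ler0z|exact: cone_span_ray].
  have : pairing m (toR R (ray_sum a)) = 0.
    have : (cone_span R (ray D) S `&` cone_span R (ray D) T') (toR R (ray_sum a)).
      by split; [exact: cone_sum|rewrite ab; exact: cone_sum].
    by rewrite FE => -[].
  rewrite (ray_sum_smooth aS) toR_sum pairing_sumr => /eqP.
  rewrite psumr_eq0 => [/allP/(_ i (mem_index_enum _))|k kS]; last first.
    by rewrite toRZ pairingZr mulr_ge0 ?ler0z // mS //; exact: cone_span_ray.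
  rewrite iS toRZ pairingZr mulf_eq0 intr_eq0 (negPf (_ : (a i)%:Z != 0)) //= => /eqP mi.
  have : (cone_span R (ray D) S `&` [set x | pairing m x = 0]) (toR R (ray D i)).
    by split=> //; exact: cone_span_ray.
  by rewrite -FE => -[_]; exact: cone_span_mem.
have muE' (c : 'I_(nrays D) -> nat) : (forall i, i \notin T' -> c i = 0%N) -> forall k, k \in T' ->
    pairing (mu k) (ray_sum c) = (c k)%:Z.
  move=> cT k kT; rewrite (ray_sum_smooth cT) pairing_sumr (bigD1 k) //=.
  rewrite pairingZr muE // eqxx mulr1 big1 ?addr0 // => j /andP[jT jk].
  by rewrite pairingZr muE // eq_sym (negPf jk) mulr0.
move=> i; have [iT|iT] := boolP (i \in T'); last by rewrite aT' ?bT'.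
by have := muE' a aT' i iT; rewrite ab muE' // => -[].
Qed.

End SmoothFans.

(** * Cox coordinates *)

Section CoxQuotient.
Variables (C : closedFieldType) (R : realType) (n : nat) (D : fan R n).
Implicit Types (S T : {set 'I_(nrays D)}) (m v : 'rV[int]_n).
Hypothesis smooth : smooth_complete D.

Local Notation X := (toric_variety C D).
Implicit Types (z : 'I_(nrays D) -> C) (x y : X).

Lemma in_perpZ S (a : int) m : in_perp S m -> @in_perp R n D S (a *: m).
Proof. by move=> /in_perpP mS; apply/in_perpP => i /mS; rewrite pairingZl => ->; rewrite mulr0. Qed.

Lemma in_perp_add S m m' : in_perp S m -> in_perp S m' -> @in_perp R n D S (m + m').
Proof.
move=> /in_perpP mS /in_perpP m'S; apply/in_perpP => i iS.
by rewrite pairing_addl mS ?m'S ?addr0.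
Qed.

Lemma tvalZ x (a : int) m : in_perp (tcone x) m -> tval x (a *: m) = tval x m ^ a.
Proof.
move=> mx; case: a => k; first by rewrite -natz scaler_nat tval_muln // natz.
have kx : in_perp (tcone x) (m *+ k.+1) by rewrite -scaler_nat; exact: in_perpZ.
have nkx : in_perp (tcone x) (- (m *+ k.+1)) by rewrite -scaleN1r; exact: in_perpZ.
have -> : Negz k *: m = - (m *+ k.+1) by rewrite NegzE scaleNr -natz scaler_nat.
rewrite NegzE -exprnN -tval_muln //.
apply: (mulIf (_ : tval x (m *+ k.+1) != 0)); first by rewrite tval_neq0.
by rewrite -tval_mul // addNr tval0 mulVf // tval_neq0.
Qed.

Lemma tval_sum x (I : Type) (s : seq I) (P : pred I) (F : I -> 'rV[int]_n) :
  (forall i, P i -> in_perp (tcone x) (F i)) ->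
  tval x (\sum_(i <- s | P i) F i) = \prod_(i <- s | P i) tval x (F i) /\
  in_perp (tcone x) (\sum_(i <- s | P i) F i).
Proof.
move=> FP; elim: s => [|i s [IHs sx]].
  by rewrite !big_nil tval0; split=> //; exact: in_perp0.
rewrite !big_cons; case: ifP => [Pi|_]; last by [].
by rewrite tval_mul ?IHs ?in_perp_add ?FP.
Qed.

Lemma smooth_pairing_sum S mu m : dual_basis S mu ->
  m = \sum_(i in S) pairing m (ray D i) *: mu i.
Proof.
move=> [_ muE]; apply/rowP => k.
have -> : m 0 k = pairing m (delta_mx 0 k) by rewrite pairingC; exact: esym (pairing_delta _ _).
rewrite {1}(muE (delta_mx 0 k)) pairing_sumr summxE; apply: eq_bigr => i _.
by rewrite pairingZr mxE [pairing (mu i) _]pairingC pairing_delta mulrC.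
Qed.

(** Everything is determined by the characters of the dual basis: the vanishing of the one at [mu i]
    decides whether [i] is in the cone of the point, and exponents orthogonal to that cone are
    integer combinations of the remaining [mu i]. *)
Lemma toric_point_ext S mu x y : S \in cones D -> dual_basis S mu ->
  tcone x \subset S -> tcone y \subset S ->
  (forall m, in_dual S m -> tval x m = tval y m) -> x = y.
Proof.
move=> SD Smu xS yS xy; have [muE vE] := Smu.
have mud i : i \in S -> in_dual S (mu i).
  by move=> iS; apply/in_dualP => k kS; rewrite muE //; case: eqP.
have tconeE (t : X) i : tcone t \subset S -> i \in S ->
    (i \in tcone t) = (tval t (mu i) == 0).
  move=> /fintype.subsetP tS iS; apply/idP/idP => [it|].
    rewrite -[_ == _]negbK tval_neq0; apply/negP => /in_perpP/(_ i it).
    by rewrite muE // eqxx => /eqP; rewrite oner_eq0.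
  apply: contraTT => it; rewrite tval_neq0; apply/in_perpP => k kt.
  rewrite muE //; last exact: tS.
  by case: eqP => // ik; rewrite ik kt in it.
have xyE : tcone x = tcone y.
  apply/setP => i; have [iS|iS] := boolP (i \in S).
    by rewrite !tconeE // xy // mud.
  by rewrite (negPf (contra (fintype.subsetP xS i) iS))
    (negPf (contra (fintype.subsetP yS i) iS)).
apply: toric_point_eq => // m.
have [mx|mx] := boolP (in_perp (tcone x) m); last first.
  have my := mx; rewrite xyE -(tval_neq0 y) negbK in my.
  by rewrite -(tval_neq0 x) negbK in mx; rewrite (eqP mx) (eqP my).
have Fx i : i \in S -> in_perp (tcone x) (pairing m (ray D i) *: mu i).
  move=> iS; have [ix|ix] := boolP (i \in tcone x).
    by rewrite (in_perpP _ _ mx) // scale0r; exact: in_perp0.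
  apply: in_perpZ; rewrite -tval_neq0.
  by move: ix; rewrite tconeE.
rewrite (smooth_pairing_sum m Smu) !(tval_sum _ _).1 -?xyE //.
apply: eq_bigr => i iS; have [ix|ix] := boolP (i \in tcone x).
  by rewrite (in_perpP _ _ mx) // scale0r !tval0.
have mux : in_perp (tcone x) (mu i) by rewrite -tval_neq0; move: ix; rewrite tconeE.
by rewrite !tvalZ -?xyE // xy // mud.
Qed.

Definition monomial z m := \prod_i z i ^ pairing m (ray D i).

Definition admissible_point z := exists2 S, S \in cones D & forall i, i \notin S -> z i != 0.

(** [cox_quotient] without charts. As 0 to any nonzero power, even a negative one, is 0,
    [monomial z m] is nonzero exactly when [m] is orthogonal to the rays where [z] vanishes, in
    agreement with the extension of [tval] by 0. *)
Definition quotient_point z x :=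
  (forall i, (i \in tcone x) = (z i == 0)) /\ forall m, tval x m = monomial z m.

Lemma monomial_neq0 z m :
  (monomial z m != 0) = in_perp [set i | z i == 0]%SET m.
Proof.
apply/idP/in_perpP => [mz i|mz].
  rewrite inE => /eqP zi; apply/eqP; apply: contraNT mz => mi.
  by rewrite /monomial (bigD1 i) //= zi exp0rz (negPf mi) mul0r.
apply/prodf_neq0 => i _; have [zi|zi] := eqVneq (z i) 0.
  by rewrite mz ?expr0z ?oner_eq0 // inE zi.
by rewrite expfz_neq0.
Qed.

Lemma admissible_smooth z : admissible_point z -> exists S mu,
  [/\ S \in cones D, dual_basis S mu & forall i, i \notin S -> z i != 0].
Proof.
move=> [S0 S0D zS0]; have [S [SD [mu muE]] /fintype.subsetP S0S] := cone_in_smooth smooth S0D.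
exists S, mu; split=> // i iS; apply: zS0; apply: contra iS; exact: S0S.
Qed.

Lemma quotient_point_exists z : admissible_point z -> exists x, quotient_point z x.
Proof.
move=> /admissible_smooth[S [mu [SD Smu zS]]].
have zD : [set i | z i == 0]%SET \in cones D.
  apply: (subset_smooth_cone SD Smu); apply/fintype.subsetP => i; rewrite inE.
  by apply: contraTT => /zS.
have f0 m : in_perp [set i | z i == 0]%SET m -> monomial z m != 0.
  by rewrite monomial_neq0.
have fM m m' : in_perp [set i | z i == 0]%SET m ->
    in_perp [set i | z i == 0]%SET m' ->
    monomial z (m + m') = monomial z m * monomial z m'.
  move=> /in_perpP mz /in_perpP m'z; rewrite /monomial -big_split.
  apply: eq_bigr => i _ /=; rewrite pairing_addl.
  have [zi|zi] := eqVneq (z i) 0; last by rewrite expfzDr.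
  by rewrite mz ?m'z ?inE ?zi // addr0 expr0z mulr1.
exists (mkpoint zD f0 fM); split=> [i|m] /=; first by rewrite inE.
case: ifP => // mz; apply/esym/eqP; rewrite -[_ == _]negbK.
by rewrite monomial_neq0 mz.
Qed.

Lemma quotient_point_uniq z x y : quotient_point z x -> quotient_point z y -> x = y.
Proof.
move=> [xz xE] [yz yE]; apply: toric_point_eq => [|m]; last by rewrite xE yE.
by apply/setP => i; rewrite xz yz.
Qed.

Lemma quotient_point_chart z x S mu : S \in cones D -> dual_basis S mu ->
  (forall i, i \notin S -> z i != 0) -> tcone x \subset S ->
  (forall m, in_dual S m -> tval x m = monomial z m) -> quotient_point z x.
Proof.
move=> SD Smu zS xS xE.
have [y yz] : exists y, quotient_point z y.
  by apply: quotient_point_exists; exists S.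
suff -> : x = y by [].
apply: (toric_point_ext SD Smu) => // [|m mS].
  apply/fintype.subsetP => i; have [-> _] := yz; apply: contraTT; exact: zS.
by have [_ ->] := yz; exact: xE.
Qed.

(** A section over a smooth chart: the characters of the dual basis on the rays of [S], and 1
    elsewhere. *)
Lemma quotient_point_surj x : exists2 z, admissible_point z & quotient_point z x.
Proof.
have [S [SD [mu Smu]] xS] := cone_in_smooth smooth (tcone_in x).
have [muE _] := Smu; pose s : toric_index D := exist _ S SD.
exists (fun i => if i \in S then tval x (mu i) else 1).
  by exists S => // i /negPf ->; exact: oner_neq0.
have mud i : i \in S -> in_dual S (mu i).
  by move=> iS; apply/in_dualP => k kS; rewrite muE //; case: eqP.
apply: (quotient_point_chart SD Smu) => // [i /negPf ->|m mS]; first exact: oner_neq0.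
rewrite /monomial (bigID (mem S)) /= [X in _ * X]big1 => [|i /negPf ->]; last first.
  by rewrite exp1rz.
rewrite mulr1 {1}(smooth_pairing_sum m Smu).
have H (P : pred 'I_(nrays D)) (r : seq 'I_(nrays D)) :
    in_dual S (\sum_(i <- r | i \in S) pairing m (ray D i) *: mu i) /\
    tval x (\sum_(i <- r | i \in S) pairing m (ray D i) *: mu i) =
    \prod_(i <- r | i \in S)
      (if i \in S then tval x (mu i) else 1) ^ pairing m (ray D i).
  elim: r => [|i r [IHd IHr]].
    by rewrite !big_nil tval0; split=> //; apply: in_perp_dual; exact: in_perp0.
  rewrite !big_cons; case: ifP => iS; last by [].
  have mi : 0 <= pairing m (ray D i) by exact: (in_dualP _ _ mS).
  have id1 : in_dual S (pairing m (ray D i) *: mu i).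
    apply/in_dualP => k kS; rewrite pairingZl mulr_ge0 //.
    exact: (in_dualP _ _ (mud i iS)).
  split.
    apply/in_dualP => k kS; rewrite pairing_addl addr_ge0 //.
      exact: (in_dualP _ _ id1).
    exact: (in_dualP _ _ IHd).
  rewrite (@tvalD _ _ _ _ s) // IHr; congr (_ * _).
  case: (pairing m (ray D i)) mi => // k _.
  elim: k => [|k IHk]; first by rewrite scale0r tval0 expr0z.
  have -> : k.+1%:Z *: mu i = mu i + k%:Z *: mu i by rewrite intS scalerDl scale1r.
  rewrite (@tvalD _ _ _ _ s) //.
  - by rewrite IHk -!exprnP exprS.
  - exact: mud.
  - apply/in_dualP => j jS; rewrite pairingZl mulr_ge0 //.
    exact: (in_dualP _ _ (mud i iS)).
exact: (H (mem S) _).2.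
Qed.

Lemma cox_admissible (z : cox_space C D) : admissible_point (cox_coord z).
Proof.
case: z => z zP; have [S SD /prodf_neq0 zS] := zP.
by exists S => // i iS; exact: zS.
Qed.

Definition mk_cox z (zP : admissible_point z) : cox_space C D.
Proof.
exists (\row_i z i); case: zP => S SD zS; exists S => //.
by apply/prodf_neq0 => i /zS; rewrite mxE.
Defined.

Lemma mk_coxE z zP i : cox_coord (@mk_cox z zP) i = z i.
Proof. by rewrite /cox_coord mxE. Qed.

Lemma cox_quotientP (z : cox_space C D) x :
  cox_quotient z x <-> quotient_point (cox_coord z) x.
Proof.
split=> [zx|[xz xE] s zs].
  have [S [mu [SD Smu zS]]] := admissible_smooth (cox_admissible z).
  have [sx xE] := zx (exist _ S SD) zS.
  exact: (quotient_point_chart SD Smu zS sx).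
split=> [|m _]; last exact: xE.
by apply/fintype.subsetP => i; rewrite xz; apply: contraTT => /zs.
Qed.

End CoxQuotient.

Section Substitution.
Variables (C : closedFieldType) (r N : nat).

Definition subst (F : 'I_r -> mpoly N C) (p : mpoly r C) : mpoly N C :=
  comp_mpoly [tuple F i | i < r] p.

Lemma meval_subst F p v : meval v (subst F p) = meval (fun i => meval v (F i)) p.
Proof.
rewrite /subst comp_mpoly_meval; congr meval; apply/funext => i.
by rewrite tnth_mktuple.
Qed.

Lemma mpoly_eq (a b : mpoly N C) : (forall v, meval v a = meval v b) -> a = b.
Proof. by move=> ab; apply: (@dense_eq _ _ 1); rewrite ?oner_eq0. Qed.

Lemma mord_monic_prime p (a : mpoly N C) : ~ monic_prime p -> mord p a = 0%N.
Proof.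
move=> np; apply/eqP; rewrite -leqn0 leqNgt mord_gt0; apply/negP => /mfactors_monic.
exact: np.
Qed.

Lemma prime_associate_monic (p : mpoly N C) : prime_element p ->
  exists q, monic_prime q /\ forall a, divides p a <-> divides q a.
Proof.
move=> pp; have [p0 _ _] := pp; have := mfactorsE p => pE.
have l0 : leadc p != 0 by rewrite leadc_eq0.
have [q qp pq] : exists2 q, q \in mfactors p & divides p q.
  apply: (prime_divides_prod pp).
  exists (mpolyC N (leadc p)^-1); rewrite mul_mpolyC [X in _ *: X]pE scalerA mulVf //.
  by rewrite scale1r.
exists q; split; first exact: mfactors_monic qp.
move=> a; split; last exact: divides_trans.
apply: divides_trans; apply/mord_divides => //; first exact: mfactors_monic qp.
by rewrite mord_gt0.
Qed.

End Substitution.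

(** * Polynomial lifts of regular maps to the toric variety *)

Section Lifts.
Variables (C : closedFieldType) (R : realType) (n : nat) (D : fan R n).
Implicit Types (S T : {set 'I_(nrays D)}) (m : 'rV[int]_n).
Hypothesis smooth : smooth_complete D.

Local Notation X := (toric_variety C D).
Local Notation r := (nrays D).

(* Off a set of codimension 2, F maps into the complement of the zero set of
   the irrelevant ideal. *)
Definition admissible_polys N (F : 'I_r -> mpoly N C) :=
  (forall i, F i != 0) /\ forall p, prime_element p ->
    exists2 S, S \in cones D & forall i, i \notin S -> ~ divides p (F i).

Definition evalF N (F : 'I_r -> mpoly N C) (v : 'I_N -> C) i := meval v (F i).

Definition monoF N (F : 'I_r -> mpoly N C) m : laurent N C :=
  [seq (F i, pairing m (ray D i)) | i <- index_enum 'I_r].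

Lemma leval_monoF N (F : 'I_r -> mpoly N C) m v :
  leval v (monoF F m) = monomial (evalF F v) m.
Proof. by rewrite /leval /monoF big_map. Qed.

(** This turns orders into lattice vectors: along [p], one vector of N gives the orders of all
    characters composed with [F]. *)
Lemma lord_monoF N (F : 'I_r -> mpoly N C) m p :
  lord p (monoF F m) = pairing m (ray_sum (fun i => mord p (F i))).
Proof.
rewrite /lord /monoF big_map /ray_sum pairing_sumr; apply: eq_bigr => i _.
by rewrite pairingZr mulrC.
Qed.

Lemma lneq0_monoF N (F : 'I_r -> mpoly N C) m : (forall i, F i != 0) ->
  lneq0 (monoF F m).
Proof. by move=> F0; apply/allP => _ /mapP[i _ ->] /=. Qed.

Lemma admissible_supported N (F : 'I_r -> mpoly N C) p : admissible_polys F ->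
  supported (fun i => mord p (F i)).
Proof.
move=> [F0 FP]; have [pp|np] := pselect (monic_prime p).
  have [S SD iS] := FP p (proj1 pp); exists S => // i /iS ndv.
  apply/eqP; rewrite -leqn0 leqNgt; apply/negP => pF; apply: ndv.
  exact/(mord_divides pp).
exists finset.set0; first exact: set0_cones.
by move=> i _; exact: mord_monic_prime.
Qed.

Lemma pairing_inj (x y : 'rV[int]_n) : (forall m, pairing m x = pairing m y) -> x = y.
Proof.
by move=> xy; apply/rowP => k; have := xy (delta_mx 0 k); rewrite !pairing_delta.
Qed.

Lemma monomialM (z t : 'I_r -> C) m :
  monomial (fun i => z i * t i) m = monomial z m * monomial t m.
Proof. by rewrite /monomial -big_split; apply: eq_bigr => i _; rewrite expfzMl. Qed.

(** Equal characters have equal orders, so both tuples give the same lattice vector along every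
    prime. By [ray_sum_inj] the orders of [F i] and [G i] agree, and factoriality leaves constants;
    monomials compared where no [G i] vanishes put these constants in K. *)
Theorem lift_unique N (F G : 'I_r -> mpoly N C) h :
  admissible_polys F -> admissible_polys G -> h != 0 ->
  (forall v, meval v h != 0 -> forall m, monomial (evalF F v) m = monomial (evalF G v) m) ->
  exists2 k, pic_dual (D := D) k & forall i, F i = k i *: G i.
Proof.
move=> Fa Ga h0 FG; have [F0 _] := Fa; have [G0 _] := Ga.
have FGord p : (fun i => mord p (F i)) =1 (fun i => mord p (G i)).
  apply: (ray_sum_inj smooth (admissible_supported p Fa) (admissible_supported p Ga)).
  apply: pairing_inj => m; rewrite -!lord_monoF.
  apply: (laurent_ord h0); try exact: lneq0_monoF.
  by move=> v vh; rewrite !leval_monoF FG.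
have /choice[k kP] : forall i, exists k, k != 0 /\ F i = k *: G i.
  move=> i; have [k k0 E] := mord_eq (F0 i) (G0 i) (fun p => FGord p i).
  by exists k.
exists k; last by move=> i; case: (kP i).
split=> [i|m]; first by case: (kP i).
have hG0 : h * \prod_i G i != 0 by rewrite mulf_neq0 //; apply/prodf_neq0.
have [v] := meval_neq0 hG0; rewrite mevalM mulf_eq0 negb_or => /andP[vh].
rewrite (rmorph_prod (meval v)) => /prodf_neq0 vG.
have GM : monomial (evalF G v) m != 0.
  by apply/prodf_neq0 => i _; rewrite expfz_neq0 // vG.
apply: (mulIf GM); rewrite mul1r -[RHS](FG v vh m) -monomialM.
congr (monomial _ m); apply/funext => i.
by rewrite /evalF; case: (kP i) => _ ->; rewrite mevalZ.
Qed.

Lemma admissible_zero N (F : 'I_r -> mpoly N C) p : admissible_polys F ->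
  prime_element p -> exists v, meval v p = 0 /\ admissible_point (D := D) (evalF F v).
Proof.
move=> [F0 FP] pp; have [S SD iS] := FP p pp.
have [v [vp vF]] : exists v, meval v p = 0 /\ meval v (\prod_(i | i \notin S) F i) != 0.
  by apply: prime_zero => // /(prime_divides_prodI pp)[i /iS].
exists v; split=> //; exists S => // i iS'.
by move: vF; rewrite (rmorph_prod (meval v)) => /prodf_neq0; apply.
Qed.

(** A prime has a zero [v] that [F] sends into V - Z, and [P] keeps it there; the components of the
    composite that are nonzero at [v] are not divisible by the prime. *)
Lemma admissible_comp N (P : 'I_r -> mpoly r C) (F : 'I_r -> mpoly N C) :
  (forall z, admissible_point (D := D) z -> admissible_point (D := D) (evalF P z)) ->
  admissible_polys F -> (forall i, subst F (P i) != 0) ->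
  admissible_polys (fun i => subst F (P i)).
Proof.
move=> PP Fa PF0; split=> // p pp.
have [v [vp /PP[S SD iS]]] := admissible_zero Fa pp; exists S => // i /iS.
rewrite /evalF -meval_subst => + [c cE]; rewrite cE mevalM vp mulr0 eqxx; done.
Qed.

Lemma admissible_iso N (F : 'I_r -> mpoly N C) (f g : {rmorphism mpoly N C -> mpoly N C}) :
  cancel f g -> cancel g f -> admissible_polys F -> admissible_polys (fun i => f (F i)).
Proof.
move=> fK gK [F0 FP]; split=> [i|p pp].
  by rewrite -(rmorph0 f) (can_eq fK).
have [S SD iS] := FP (g p) (prime_iso gK fK pp); exists S => // i /iS nd pd.
apply: nd; rewrite -(fK (F i)); exact: divides_morph.
Qed.

Lemma admissible_scale N (F : 'I_r -> mpoly N C) (t : 'I_r -> C) :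
  (forall i, t i != 0) -> admissible_polys F -> admissible_polys (fun i => t i *: F i).
Proof.
move=> t0 [F0 FP]; split=> [i|p pp].
  by rewrite -mul_mpolyC mulf_neq0 ?mpolyC_eq0.
have [S SD iS] := FP p pp; exists S => // i /iS nd [c cE]; apply: nd.
by exists ((t i)^-1 *: c); rewrite -scalerAl -cE scalerA mulVf // scale1r.
Qed.

Section LiftExistence.
Variables (N : nat) (W : set ('I_N -> C)) (f : ('I_N -> C) -> X).

(* The third hypothesis expresses that f is regular on W. *)
Hypotheses (Wdense : exists2 h : mpoly N C, h != 0 & forall w, meval w h != 0 -> W w)
  (ftorus : exists2 w, W w & tcone (f w) = finset.set0)
  (freg : forall w S m, W w -> S \in cones D -> tcone (f w) \subset S -> in_dual S m ->
    exists c d, meval w d != 0 /\ forall w', W w' -> meval w' d != 0 ->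
      tcone (f w') \subset S /\ tval (f w') m = meval w' c / meval w' d).

Lemma generic_torus : exists (h : mpoly N C) (c d : 'I_n -> mpoly N C), [/\ h != 0,
  forall k, c k != 0, forall k, d k != 0 &
  forall w, meval w h != 0 -> [/\ W w, tcone (f w) = finset.set0 &
    forall m, tval (f w) m = \prod_k (meval w (c k) / meval w (d k)) ^ m 0 k]].
Proof.
have [h h0 hW] := Wdense; have [w0 Ww0 w0T] := ftorus.
have loc m : exists cd : mpoly N C * mpoly N C, [/\ meval w0 cd.1 != 0,
    meval w0 cd.2 != 0 & forall w', W w' -> meval w' cd.2 != 0 ->
      tcone (f w') = finset.set0 /\ tval (f w') m = meval w' cd.1 / meval w' cd.2].
  have md : in_dual (finset.set0 : {set 'I_r}) m by exact: in_dual_set0.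
  have ts : tcone (f w0) \subset (finset.set0 : {set 'I_r}) by rewrite w0T.
  have [c [d [dw H]]] := freg Ww0 (set0_cones D) ts md.
  exists (c, d); split=> //=.
    have [_ tE] := H w0 Ww0 dw; have : tval (f w0) m != 0.
      by rewrite tval_neq0 w0T; exact: in_perp_set0.
    by rewrite tE mulf_eq0 negb_or => /andP[].
  move=> w' Ww' dw'; have [+ ->] := H w' Ww' dw'.
  by rewrite finset.subset0 => /eqP ->.
have [cd cdP] := choice loc.
have nz (a : mpoly N C) : meval w0 a != 0 -> a != 0.
  by apply: contraNneq => ->; rewrite meval0.
pose c k := (cd (delta_mx 0 k)).1; pose d k := (cd (delta_mx 0 k)).2.
have c0 k : c k != 0 by apply: nz; case: (cdP (delta_mx 0 k)).
have d0 k : d k != 0 by apply: nz; case: (cdP (delta_mx 0 k)).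
have d00 : (cd 0).2 != 0 by apply: nz; case: (cdP 0).
exists (h * ((cd 0).2 * \prod_k d k)), c, d; split=> //.
  by rewrite !mulf_neq0 //; apply/prodf_neq0.
move=> w; rewrite !mevalM !mulf_eq0 !negb_or (rmorph_prod (meval w)).
move=> /andP[/hW Ww /andP[wd0 /prodf_neq0 wd]].
have [_ _ H0] := cdP 0; have [wT _] := H0 w Ww wd0; split=> // m.
have pT a : in_perp (tcone (f w)) a by rewrite wT; exact: in_perp_set0.
rewrite {1}(row_sum_delta m) (tval_sum _ _).1 => [|k _]; last exact: pT.
apply: eq_bigr => k _; rewrite tvalZ //; congr (_ ^ _).
by have [_ _ Hk] := cdP (delta_mx 0 k); have [_ ->] := Hk w Ww (wd k isT).
Qed.

(* v p collects the orders along p of the characters composed with f, and al p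
   writes it as a combination of the rays of one cone. *)
Lemma lift_generic : exists (F : 'I_r -> mpoly N C) (h : mpoly N C),
  [/\ admissible_polys F, h != 0 & forall w, meval w h != 0 ->
    [/\ W w, tcone (f w) = finset.set0, forall i, meval w (F i) != 0 &
        forall m, monomial (evalF F w) m = tval (f w) m]].
Proof.
have [h [c [d [h0 c0 d0 hP]]]] := generic_torus.
pose v p : 'rV[int]_n := \row_k ((mord p (c k))%:Z - (mord p (d k))%:Z).
have /choice[al alP] : forall p, exists a, supported (D := D) a /\ v p = ray_sum a.
  by move=> p; have [a asup aE] := ray_sum_exists smooth (v p); exists a.
pose ps := undup (mfactors (\prod_k c k * \prod_k d k)).
have cd0 : \prod_k c k * \prod_k d k != 0 by rewrite mulf_neq0 //; apply/prodf_neq0.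
have psP p : p \in ps -> monic_prime p by rewrite mem_undup => /mfactors_monic.
(* Off the finite list [ps] the vector [v p] is 0, hence so are its coefficients, and a finite
   product realises all prescribed orders. *)
have al0 p : p \notin ps -> forall i, al p i = 0%N.
  rewrite mem_undup -mord_gt0 -leqNgt leqn0 mordM; try by apply/prodf_neq0.
  rewrite addn_eq0 !mord_prod // !sum_nat_eq0 => /andP[/forallP pc /forallP pd].
  have [asup aE] := alP p.
  apply: (ray_sum_inj smooth asup (b := fun=> 0%N)).
    by exists finset.set0 => //; exact: set0_cones.
  rewrite -aE /ray_sum big1 => [|i _]; last by rewrite scale0r.
  apply/rowP => k; rewrite !mxE.
  by have /eqP -> := pc k; have /eqP -> := pd k.
pose G i := \prod_(p <- ps) p ^+ al p i.
have ps0 p : p \in ps -> p != 0 by move=> /psP /monic_prime_neq0.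
have G0 i : G i != 0.
  by rewrite prodf_seq_neq0; apply/allP => p /ps0 p0; rewrite expf_neq0.
have Gord q : monic_prime q -> forall i, mord q (G i) = al q i.
  move=> qm i; have GE : G i = \prod_(p <- ps) (if p \in ps then p ^+ al p i else 1).
    by rewrite /G; apply: eq_big_seq => p ->.
  rewrite GE mord_prod => [|p]; last first.
    by case: ifP => [/ps0 p0|_]; rewrite ?expf_neq0 ?oner_eq0.
  have E p : p \in ps ->
      mord q (if p \in ps then p ^+ al p i else 1) = (al p i * (p == q))%N.
    by move=> pps; rewrite pps mordX ?ps0 // mord_monic //; exact: psP.
  rewrite (eq_big_seq _ E); have [qs|qs] := boolP (q \in ps).
    rewrite (bigD1_seq q) ?undup_uniq //= eqxx muln1 big1 ?addn0 // => p /negPf ->.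
    by rewrite muln0.
  rewrite al0 // big_seq big1 // => p pps; case: eqP => [pq|_]; last by rewrite muln0.
  by rewrite -pq pps in qs.
pose cdl m : laurent N C := [seq (c k, m 0 k) | k <- index_enum 'I_n] ++
  [seq (d k, - m 0 k) | k <- index_enum 'I_n].
have cdl0 m : lneq0 (cdl m).
  by rewrite /lneq0 all_cat; apply/andP; split; apply/allP => _ /mapP[k _ ->] /=.
have lordE m q : lord q (monoF G m) = lord q (cdl m).
  have [qm|qn] := pselect (monic_prime q); last first.
    by rewrite /lord !big1 // => x _; rewrite mord_monic_prime // mulr0.
  rewrite lord_monoF (_ : ray_sum _ = v q).
    rewrite /lord /cdl big_cat !big_map /= -big_split /pairing /=.
    by apply: eq_bigr => k _; rewrite mxE; ring.
  have [_ ->] := alP q; rewrite /ray_sum; apply: eq_bigr => i _.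
  by rewrite Gord.
pose h1 := h * ((\prod_k c k * \prod_k d k) * \prod_i G i).
have h10 : h1 != 0 by rewrite !mulf_neq0 //; apply/prodf_neq0.
have h1P w : meval w h1 != 0 -> [/\ meval w h != 0, forall k, meval w (c k) != 0,
    forall k, meval w (d k) != 0 & forall i, meval w (G i) != 0].
  rewrite /h1 !mevalM !mulf_eq0 !negb_or !(rmorph_prod (meval w)).
  move=> /andP[-> /andP[/andP[/prodf_neq0 wc /prodf_neq0 wd] /prodf_neq0 wG]].
  by split=> // k; [exact: wc|exact: wd|exact: wG].
have levalcd w m : meval w h1 != 0 -> leval w (cdl m) = tval (f w) m.
  move=> /h1P[wh wc wd wG]; have [_ _ ->] := hP w wh.
  rewrite /leval /cdl big_cat !big_map /= -big_split; apply: eq_bigr => k _ /=.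
  by rewrite expfzMl exprz_inv.
(* Equal orders along all primes leave a constant, which may depend on [m]. *)
have levalP m : exists ka, forall w, meval w h1 != 0 ->
    monomial (evalF G w) m = ka * tval (f w) m.
  have [ka _ kaP] := laurent_const (lneq0_monoF m G0) (cdl0 m) (lordE m).
  exists ka => w wh1; have [wh wc wd wG] := h1P w wh1.
  rewrite -levalcd // -leval_monoF kaP //; apply: lneg_meval.
    by move=> _ /mapP[i _ ->] _ /=.
  by move=> x; rewrite mem_cat => /orP[] /mapP[k _ ->] _ /=.
have [w1 w1h] := meval_neq0 h10; have [w1h0 _ _ w1G] := h1P w1 w1h.
have [_ w1T _] := hP w1 w1h0.
have [z _ [zT zE]] := quotient_point_surj smooth (f w1).
have z0 i : z i != 0 by rewrite -zT w1T finset.in_set0.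
have t0 i : z i / meval w1 (G i) != 0 by rewrite mulf_neq0 ?invr_eq0.
(* Rescaling gives the tuple at [w1] the value [z], a vector of Cox coordinates of [f w1], and this
   forces all the constants to be 1. *)
exists (fun i => (z i / meval w1 (G i)) *: G i), h1; split=> //.
  apply: admissible_scale => //; split=> // p pp.
  have [q [qm pq]] := prime_associate_monic pp.
  have [[S SD aS] _] := alP q; exists S => // i /aS ai /pq.
  by rewrite mord_divides // Gord // ai.
move=> w wh1; have [wh wc wd wG] := h1P w wh1; have [Ww wT _] := hP w wh.
split=> // [i|m]; first by rewrite mevalZ mulf_neq0.
have [ka kaP] := levalP m.
have scaleE w' : monomial (evalF (fun i => (z i / meval w1 (G i)) *: G i) w') m =
    monomial (fun i => z i / meval w1 (G i)) m * monomial (evalF G w') m.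
  by rewrite -monomialM; congr (monomial _ m); apply/funext => i; rewrite /evalF mevalZ.
have w1E : monomial (fun i => z i / meval w1 (G i)) m * ka = 1.
  have tw1 : tval (f w1) m != 0 by rewrite tval_neq0 w1T; exact: in_perp_set0.
  apply: (mulIf tw1); rewrite mul1r -mulrA -kaP // -scaleE zE.
  congr (monomial _ m); apply/funext => i; by rewrite /evalF mevalZ divfK.
by rewrite scaleE kaP // mulrA w1E mul1r.
Qed.

(** At a point [w] of [W], take a smooth cone [S] containing the cone of [f w]. The characters in
    the dual of [S] are regular at [w], so they have order at least 0 along the primes vanishing at
    [w]; the lattice vectors of these primes then lie in [S]. Hence no [F i] with [i] outside [S]
    vanishes at [w], and the generic identity extends to [w]. *)
Theorem lift_exists : exists F : 'I_r -> mpoly N C, admissible_polys F /\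
  forall w, W w -> admissible_point (D := D) (evalF F w) /\
    quotient_point (evalF F w) (f w).
Proof.
have [F [h [Fa h0 hP]]] := lift_generic; exists F; split=> // w Ww.
have [F0 _] := Fa.
have [S [SD [mu Smu]] wS] := cone_in_smooth smooth (tcone_in (f w)).
have [muE muS] := Smu.
have loc m : in_dual S m -> exists c d, [/\ c != 0, d != 0, meval w d != 0,
    tval (f w) m = meval w c / meval w d &
    forall w', meval w' (h * d) != 0 ->
      leval w' (monoF F m) = leval w' [:: (c, 1); (d, -1)]].
  move=> md; have [c [d [wd H]]] := freg Ww SD wS md.
  have d0 : d != 0 by apply: contraNneq wd => ->; rewrite meval0.
  have E w' : meval w' (h * d) != 0 -> leval w' (monoF F m) = meval w' c / meval w' d.
    rewrite mevalM mulf_eq0 negb_or => /andP[/hP[Ww' w'T w'F w'm] w'd].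
    by rewrite leval_monoF w'm; have [_ ->] := H w' Ww' w'd.
  exists c, d; split=> //.
  - have [w1 w1hd] := meval_neq0 (mulf_neq0 h0 d0).
    have := E w1 w1hd; move: w1hd; rewrite mevalM mulf_eq0 negb_or => /andP[w1h _].
    have [_ w1T _ w1m] := hP w1 w1h; rewrite leval_monoF w1m => w1E.
    have : tval (f w1) m != 0 by rewrite tval_neq0 w1T; exact: in_perp_set0.
    by rewrite w1E; apply: contraNneq => ->; rewrite meval0 mul0r.
  - by have [_ ->] := H w Ww wd.
  - move=> w' w'hd; rewrite E // /leval !big_cons big_nil mulr1 expr1z.
    by rewrite -exprN1.
have nonneg p : meval w p = 0 -> forall m, in_dual S m ->
    0 <= pairing m (ray_sum (fun i => mord p (F i))).
  move=> wp m md; have [c [d [c0 d0 wd _ E]]] := loc m md.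
  rewrite -lord_monoF (laurent_ord (mulf_neq0 h0 d0) _ _ E).
  - rewrite /lord !big_cons big_nil /= (meval_ord0 wp wd) mulr0 !addr0 mul1r.
    by [].
  - exact: lneq0_monoF.
  - by rewrite /lneq0 /= c0 d0.
have ordS p : meval w p = 0 -> forall i, i \notin S -> mord p (F i) = 0%N.
  (* [be] gives the coordinates of the lattice vector in the basis of rays of [S]; uniqueness
     identifies them with the orders of the [F i]. *)
  move=> wp; pose be i := if i \in S then
    `|pairing (mu i) (ray_sum (fun i => mord p (F i)))|%N else 0%N.
  have beS i : i \notin S -> be i = 0%N by rewrite /be => /negPf ->.
  have mud i : i \in S -> in_dual S (mu i).
    by move=> iS; apply/in_dualP => k kS; rewrite muE //; case: eqP.
  have E : (fun i => mord p (F i)) =1 be.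
    apply: (ray_sum_inj smooth (admissible_supported p Fa)); first by exists S.
    rewrite (ray_sum_smooth beS) [LHS]muS; apply: eq_bigr => i iS.
    by rewrite /be iS gez0_abs // nonneg // mud.
  by move=> i iS; rewrite E beS.
have FS i : i \notin S -> meval w (F i) != 0.
  move=> iS; apply/eqP => /(meval_eq0_factor (F0 i))[p [_ wp]].
  by rewrite ordS.
split; first by exists S.
apply: (quotient_point_chart smooth SD Smu) => // m md.
have [c [d [c0 d0 wd -> E]]] := loc m md; rewrite -leval_monoF.
have l0 : lneq0 [:: (c, 1 : int); (d, -1)] by rewrite /lneq0 /= c0 d0.
rewrite (laurent_eval (mulf_neq0 h0 d0) (lneq0_monoF m F0) l0 E).
- by rewrite /leval !big_cons big_nil mulr1 expr1z -exprN1.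
- apply: lneg_meval => _ /mapP[i _ ->] /= mi; apply: FS; apply: contraTN mi => iS.
  by rewrite -leNgt; exact: (in_dualP _ _ md).
- by apply: lneg_meval => x; rewrite !inE => /orP[] /eqP -> //=.
Qed.

End LiftExistence.

End Lifts.

Lemma meval_prod N (C : comNzRingType) (v : 'I_N -> C) (I : Type) (s : seq I)
    (P : pred I) (F : I -> mpoly N C) :
  meval v (\prod_(i <- s | P i) F i) = \prod_(i <- s | P i) meval v (F i).
Proof. exact: rmorph_prod. Qed.

(** * The quotient map and lifts of self-maps of the toric variety *)

Section QuotientMap.
Variables (C : closedFieldType) (R : realType) (n : nat) (D : fan R n).
Implicit Types (S T : {set 'I_(nrays D)}) (m : 'rV[int]_n).
Hypothesis smooth : smooth_complete D.

Local Notation X := (toric_variety C D).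
Local Notation V := (cox_space C D).
Local Notation r := (nrays D).

Lemma cox_inj (z w : V) : (forall i, cox_coord z i = cox_coord w i) -> z = w.
Proof. exact: sub_affine_inj. Qed.

Definition quotient_map (z : V) : X :=
  projT1 (cid (quotient_point_exists smooth (cox_admissible z))).

Lemma quotient_mapP z : quotient_point (cox_coord z) (quotient_map z).
Proof. exact: (projT2 (cid (quotient_point_exists smooth (cox_admissible z)))). Qed.

Lemma quotient_mapE z x : quotient_point (cox_coord z) x -> quotient_map z = x.
Proof. by move=> zx; exact: quotient_point_uniq (quotient_mapP z) zx. Qed.

Lemma quotient_map_surj x : exists z, quotient_map z = x.
Proof.
have [z za zx] := quotient_point_surj smooth x; exists (mk_cox za).
by apply: quotient_mapE; congr (quotient_point _ x): zx; apply/funext => i; rewrite mk_coxE.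
Qed.

Lemma quotient_map_chart (s : toric_index D) z :
  toric_chart s (quotient_map z) <-> forall i, i \notin sval s -> cox_coord z i != 0.
Proof.
have [zx _] := quotient_mapP z; split=> [/fintype.subsetP H i|H].
  by rewrite -zx; apply: contra; exact: H.
by apply/fintype.subsetP => i; rewrite zx; apply: contraTT => /H.
Qed.

Lemma regular_quotient_map : regular_map quotient_map.
Proof.
have oc (s : toric_index D) : open (quotient_map @^-1` (toric_chart s)).
  have := @open_principal _ _ (irrelevant_compl (D := D))
    (\prod_(i | i \notin sval s) mpolyX C (mnm1 i)).
  congr open; apply/seteqP; split=> z /=.
    rewrite meval_prod => /prodf_neq0 H.
    by apply/quotient_map_chart => i /H; rewrite mevalXU.
  move=> /quotient_map_chart H; rewrite meval_prod; apply/prodf_neq0.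
  by move=> i /H; rewrite mevalXU.
apply: regular_into_glued; rewrite ?openT //.
- by move=> s; rewrite setTI; exact: oc.
- move=> s c [l [/allP ls cE]]; rewrite setTI.
  apply: (regular_ext (oc s) (f := fun z => \sum_(p <- l | in_dual (sval s) p.2)
    p.1 * \prod_i cox_coord z i ^ pairing p.2 (ray D i))).
    move=> z sz; rewrite /= cE // big_seq_cond [RHS]big_seq.
    apply: eq_big => [p|p _]; last by have [_ ->] := quotient_mapP z.
    by case: (boolP (p \in l)) => // /ls ->.
  apply: regular_sum => // p /in_dualP ps; apply: regular_mul => //.
    exact: regular_cst.
  apply: regular_prod => // i _; apply: regular_expz => //; last exact: regular_coordinate.
  have [iS|iS] := boolP (i \in sval s); first by left; exact: ps.
  by right => z /quotient_map_chart; apply.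
- move=> z _; exists (@exist _ (fun S => S \in cones D) _ (tcone_in (quotient_map z))).
  exact: toric_chart_self.
Qed.

Section SubAffineLift.
Variables (N : nat) (S : set 'rV[C]_N) (W : set (sub_affine S)) (f : sub_affine S -> X).
Hypotheses (Sdense : exists2 h : mpoly N C, h != 0 &
    forall v, meval v h != 0 -> S (\row_i v i))
  (fW : regular_map_on W f) (ftorus : exists2 w, W w & tcone (f w) = finset.set0).

Theorem lift_sub_affine : exists F : 'I_r -> mpoly N C, admissible_polys F /\
  forall w, W w -> admissible_point (D := D) (evalF F (coordinate w)) /\
    quotient_point (evalF F (coordinate w)) (f w).
Proof.
have [w0 Ww0 w0T] := ftorus; have oW := regular_map_on_open fW.
pose f' v : X := if pselect (exists w : sub_affine S, coordinate w = v) is left H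
  then f (projT1 (cid H)) else f w0.
have f'E w : f' (coordinate w) = f w.
  rewrite /f'; case: pselect => [H|[]]; last by exists w.
  by congr f; apply: sub_affine_inj => i; rewrite (projT2 (cid H)).
pose W' v := exists2 w : sub_affine S, W w & coordinate w = v.
have [|||F [Fa FP]] := @lift_exists C R n D smooth N W' f'.
- have [h h0 hS] := Sdense; have [p [pw0 pW]] := sub_affine_openP oW Ww0.
  have p0 : p != 0 by apply: contraNneq pw0 => ->; rewrite meval0.
  exists (h * p); first by rewrite mulf_neq0.
  move=> v; rewrite mevalM mulf_eq0 negb_or => /andP[/hS vS vp].
  have vE : coordinate (exist _ _ vS : sub_affine S) = v.
    by apply/funext => i; rewrite /coordinate mxE.
  exists (exist _ _ vS) => //; apply: pW; by rewrite vE.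
- by exists (coordinate w0); [exists w0|rewrite f'E].
- move=> _ T m [w Ww <-]; rewrite f'E => TD wT mT.
  pose s : toric_index D := exist _ T TD.
  have oc := @toric_chart_open C _ _ _ s.
  have [oV rV] := fW oc; have rm := rV _ (@regular_tval C R n D s m mT).
  have Vw : (W `&` f @^-1` toric_chart s) w by split.
  have [c [d [wd H]]] := sub_affine_regularP oV rm Vw.
  exists c, d; split=> // _ [w' _ <-] w'd; rewrite f'E.
  by have [[_ sw'] E] := H w' w'd.
exists F; split=> // w Ww; rewrite -(f'E w).
by apply: FP; exists w.
Qed.

End SubAffineLift.

Definition coordinate_polys (i : 'I_r) : mpoly r C := mpolyX C (mnm1 i).

Lemma eval_coordinate_polys z : evalF coordinate_polys z = z.
Proof. by apply/funext => i; rewrite /evalF mevalXU. Qed.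

Lemma prime_divides_variable N (p : mpoly N C) i : prime_element p ->
  divides p (mpolyX C (mnm1 i)) -> exists2 c, c != 0 & mpolyX C (mnm1 i) = c *: p.
Proof.
move=> [p0 pU _] [a aE].
have X0 : mpolyX C (mnm1 i) != 0 :> mpoly N C.
  by apply/eqP => /(congr1 (mcoeff (mnm1 i))) /eqP; rewrite mcoeffX eqxx mcoeff0 oner_eq0.
have a0 : a != 0 by apply: contraNneq X0 => z; rewrite aE z mul0r.
have sp : (1 < msize p)%N.
  rewrite ltnNge; apply: contra pU => sp; have pE := msize1_polyC sp.
  by rewrite mpoly_unitE p0 pE mcoeffC eqxx mulr1 eqxx.
have sa : (msize a <= 1)%N.
  have := congr1 (fun q : mpoly N C => msize q) aE.
  rewrite /= msizeM // msizeX mdeg1 => E.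
  by move: (msize a) (msize p) sp E => x y; lia.
have aC := msize1_polyC sa; exists (mcoeff mnm0 a).
  by apply: contraNneq a0 => z; rewrite aC z mpolyC0.
by rewrite aE {1}aC mul_mpolyC.
Qed.

(** No prime divides two different variables, and the zero cone and the cones with one ray belong to
    the fan. *)
Lemma admissible_coordinate_polys : admissible_polys (D := D) coordinate_polys.
Proof.
split=> [i|p pp].
  by apply/eqP => /(congr1 (mcoeff (mnm1 i))) /eqP; rewrite mcoeffX eqxx mcoeff0 oner_eq0.
have [[i /(prime_divides_variable pp)[c c0 ci]]|H] :=
    pselect (exists i, divides p (coordinate_polys i)); last first.
  exists finset.set0; first exact: set0_cones.
  by move=> i _ pi; apply: H; exists i.
exists (finset.set1 i); first exact: cones_ray.
move=> j; rewrite finset.in_set1 => ji /(prime_divides_variable pp)[d d0 dj].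
have := congr1 (mcoeff (mnm1 j)) ci; rewrite mcoeffX mcoeffZ.
rewrite (_ : (mnm1 i == mnm1 j) = false); last first.
  apply/negP => /eqP /(congr1 (fun m : multinom r => m i)) /eqP.
  by rewrite !mnm1E eqxx (negPf ji).
move=> /esym/eqP; rewrite mulf_eq0 (negPf c0) /= => /eqP pj.
have := congr1 (mcoeff (mnm1 j)) dj; rewrite mcoeffX eqxx mcoeffZ pj mulr0.
by move/eqP; rewrite oner_eq0.
Qed.

Lemma generic_admissible z : meval z (\prod_i coordinate_polys i) != 0 ->
  admissible_point (D := D) z.
Proof.
rewrite meval_prod => /prodf_neq0 H.
by exists finset.set0; [exact: set0_cones|move=> i _; have := H i isT; rewrite mevalXU].
Qed.

Lemma prod_coordinate_neq0 : \prod_i coordinate_polys i != 0.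
Proof. by apply/prodf_neq0 => i _; case: admissible_coordinate_polys. Qed.

(** Admissibility is part of the data so that [lift_unique] applies to any two lifts of the same
    map. *)
Definition cox_lift (a : X -> X) (A : 'I_r -> mpoly r C) :=
  admissible_polys (D := D) A /\
  forall z, admissible_point (D := D) z -> admissible_point (D := D) (evalF A z) /\
    forall x, quotient_point z x -> quotient_point (evalF A z) (a x).

Lemma cox_lift_id : cox_lift id coordinate_polys.
Proof.
split; first exact: admissible_coordinate_polys.
by move=> z za; rewrite eval_coordinate_polys.
Qed.

Lemma quotient_point_scale (t z : 'I_r -> C) (x : X) : pic_dual (D := D) t -> quotient_point z x ->
  quotient_point (fun i => t i * z i) x.
Proof.
move=> [t0 tP] [zx xE]; split=> [i|m]; first by rewrite zx mulf_eq0 (negPf (t0 i)).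
by rewrite monomialM xE -[monomial t m]/(\prod_i _) tP mul1r.
Qed.

Lemma cox_lift_scale a A t : pic_dual (D := D) t -> cox_lift a A ->
  cox_lift a (fun i => t i *: A i).
Proof.
move=> tP [Aa AP]; have [t0 _] := tP; split; first exact: admissible_scale.
move=> z za; have [[S SD zS] AQ] := AP z za.
have -> : evalF (fun i => t i *: A i) z = fun i => t i * evalF A z i.
  by apply/funext => i; rewrite /evalF mevalZ.
split; first by exists S => // i /zS zi; rewrite mulf_neq0.
by move=> x /AQ; exact: quotient_point_scale.
Qed.

(** A point sent into the torus by the composite shows that no component of the substituted tuple is
    identically 0. *)
Lemma cox_lift_comp a b A B : (exists x, tcone (a (b x)) = finset.set0) ->
  cox_lift a A -> cox_lift b B -> cox_lift (a \o b) (fun i => subst B (A i)).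
Proof.
move=> [x xT] [Aa AP] [Ba BP].
have E z : evalF (fun i => subst B (A i)) z = evalF A (evalF B z).
  by apply/funext => i; rewrite /evalF meval_subst.
have Q z : admissible_point (D := D) z ->
    admissible_point (D := D) (evalF A (evalF B z)) /\
    forall x, quotient_point z x -> quotient_point (evalF A (evalF B z)) (a (b x)).
  move=> za; have [Bza BQ] := BP z za; have [ABza AQ] := AP _ Bza.
  by split=> // y /BQ /AQ.
split; last by move=> z za; rewrite E; exact: Q.
apply: admissible_comp => // [z za|i]; first by case: (AP z za).
have [z za zx] := quotient_point_surj smooth x.
have [_ /(_ x zx)[zT _]] := Q z za.
have := zT i; rewrite xT finset.in_set0 -E => /esym/negbT.
by apply: contra => /eqP H; rewrite /evalF H meval0.
Qed.

Lemma cox_lift_unique a A B : cox_lift a A -> cox_lift a B ->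
  exists2 k, pic_dual (D := D) k & forall i, A i = k i *: B i.
Proof.
move=> [Aa AP] [Ba BP]; apply: (lift_unique smooth Aa Ba prod_coordinate_neq0).
move=> z /generic_admissible za m; have [x zx] := quotient_point_exists smooth za.
have [_ /(_ x zx)[_ <-]] := AP z za.
by have [_ /(_ x zx)[_ <-]] := BP z za.
Qed.

Lemma cox_lift_exists (a : X -> X) : regular_map a -> (exists x, tcone (a x) = finset.set0) ->
  exists A, cox_lift a A.
Proof.
move=> ra [x xT]; have [z0 z0x] := quotient_map_surj x.
have [|||A [Aa AP]] := @lift_sub_affine r (irrelevant_compl (D := D)) setT (a \o quotient_map).
- exists (\prod_i coordinate_polys i); first exact: prod_coordinate_neq0.
  move=> v /generic_admissible[S SD vS]; exists S => //.
  by apply/prodf_neq0 => i /vS; rewrite mxE.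
- exact: (regular_map_on_comp regular_quotient_map ra).
- by exists z0; rewrite //= z0x.
exists A; split=> // z za; have [Aza zA] := AP (mk_cox za) I.
have zE : coordinate (mk_cox za) = z by apply/funext => i; rewrite /coordinate mxE.
rewrite zE in Aza zA; split=> // y zy.
suff <- : quotient_map (mk_cox za) = y by [].
by apply: quotient_mapE; move: zy; rewrite -{1}zE.
Qed.

Definition cox_map A (AP : forall z, admissible_point (D := D) z ->
    admissible_point (D := D) (evalF A z)) (z : V) : V :=
  mk_cox (AP _ (cox_admissible z)).

Lemma cox_mapE A AP z i : cox_coord (@cox_map A AP z) i = meval (cox_coord z) (A i).
Proof. by rewrite mk_coxE. Qed.

Lemma regular_cox_map A AP : regular_map (@cox_map A AP).
Proof.
apply: regular_into_sub_affine; first exact: openT.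
move=> i; apply: (regular_ext openT (f := fun z => meval (coordinate z) (A i))).
  by move=> z _; exact: (esym (cox_mapE _ _ _)).
exact: regular_polynomial.
Qed.

End QuotientMap.

(** * From versality to a splitting *)

Section RegularRepresentation.
Variables (C : closedFieldType) (gT : finGroupType).

Let N := #|{: gT}|.
Local Notation Y := (affine_space C N).

(** A vector is a function on the group; the inverse makes [regular_rep] a left action. *)
Definition translate (g : gT) (i : 'I_N) : 'I_N := enum_rank (g^-1 * enum_val i)%g.

Definition regular_rep (g : gT) (y : Y) : Y :=
  aff_point (fun i => coordinate y (translate g i)).

Lemma regular_repE g y i : coordinate (regular_rep g y) i = coordinate y (translate g i).
Proof. exact: aff_pointE. Qed.

Lemma translate1 i : translate 1 i = i.
Proof. by rewrite /translate invg1 mul1g enum_valK. Qed.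

Lemma translateM g h i : translate (g * h) i = translate h (translate g i).
Proof. by rewrite /translate enum_rankK invMg mulgA. Qed.

Lemma faithful_regular_rep : faithful_variety regular_rep.
Proof.
split.
- exact: variety_affine_space.
- move=> g; apply: regular_into_sub_affine; first exact: openT.
  move=> i; apply: (regular_ext openT (f := fun y => coordinate y (translate g i))).
    by move=> y _; exact: (esym (regular_repE _ _ _)).
  exact: regular_coordinate.
- by move=> y; apply: sub_affine_inj => i; rewrite regular_repE translate1.
- by move=> g h y; apply: sub_affine_inj => i; rewrite !regular_repE translateM.
move=> g gy; pose e : Y := aff_point (fun i => (i == enum_rank 1%g)%:R).
have := congr1 (fun y => coordinate y (enum_rank 1%g)) (gy e).
rewrite regular_repE !aff_pointE eqxx /translate enum_rankK mulg1.
case: eqP => [/enum_rank_inj/eqP|_ /esym/eqP]; last by rewrite oner_eq0.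
by rewrite invg_eq1 => /eqP.
Qed.

Definition pullback_rep g (p : mpoly N C) : mpoly N C :=
  subst (fun i => mpolyX C (mnm1 (translate g i))) p.

Lemma meval_pullback_rep g v p :
  meval v (pullback_rep g p) = meval (fun i => v (translate g i)) p.
Proof. by rewrite meval_subst; congr meval; apply/funext => i; rewrite mevalXU. Qed.

Definition pullback_rep_morph g : {rmorphism mpoly N C -> mpoly N C} :=
  GRing.RMorphism.clone _ _
    (comp_mpoly [tuple mpolyX C (mnm1 (translate g i)) | i < N]) _.

Lemma pullback_repK g : cancel (pullback_rep_morph g) (pullback_rep_morph g^-1).
Proof.
move=> p; apply: mpoly_eq => v.
rewrite -[LHS]/(meval v (pullback_rep g^-1 (pullback_rep g p))).
rewrite !meval_pullback_rep; congr meval; apply/funext => i.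
by rewrite -translateM mulgV translate1.
Qed.

End RegularRepresentation.

Section VersalSplits.
Variables (C : closedFieldType) (R : realType) (n : nat) (D : fan R n).
Variables (gT : finGroupType) (act : gT -> toric_variety C D -> toric_variety C D).
Hypotheses (smooth : smooth_complete D) (act_faithful : faithful_variety act).

Local Notation X := (toric_variety C D).
Local Notation V := (cox_space C D).
Local Notation r := (nrays D).
Local Notation N := #|{: gT}|.

Lemma act_inverse g x : act g (act g^-1%g x) = x.
Proof. by rewrite -(gvariety_actM act_faithful) mulgV (gvariety_act1 act_faithful). Qed.

Definition torus : set X := [set x | tcone x = finset.set0].

Lemma torus_open : open torus.
Proof.
have := @toric_chart_open C _ _ D (exist _ finset.set0 (set0_cones D)).
congr open; apply/seteqP; split=> x xT; first by apply/eqP; rewrite -finset.subset0.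
by rewrite /toric_chart /= xT; exact: fintype.subxx.
Qed.

Lemma torus_nonempty : exists x : X, torus x.
Proof. by exists (torus_point D (fun k : 'I_n => oner_neq0 C)). Qed.

Lemma act_torus g : exists x, tcone (act g x) = finset.set0.
Proof.
by have [x xT] := torus_nonempty; exists (act g^-1%g x); rewrite act_inverse.
Qed.

Definition stable_torus : set X := [set x | forall g, torus (act g x)].

Lemma stable_torus_open : open stable_torus /\ stable_torus !=set0.
Proof.
have [|oH nH] := irreducible_finite_meet (s := enum gT)
    (O := fun g => act g @^-1` torus) (variety_irreducible (gvariety_variety act_faithful)).
  move=> g _; split; last exact: act_torus.
  by have [+ _] := gvariety_regular act_faithful g torus_open; rewrite setTI.
have <- : [set x | forall g, g \in enum gT -> torus (act g x)] = stable_torus; last by [].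
  apply/seteqP; split=> x /= xP g; last by [].
  by apply: xP; rewrite mem_enum.
Qed.

Lemma stable_torus_invariant g x : stable_torus x -> stable_torus (act g x).
Proof. by move=> xT h; rewrite -(gvariety_actM act_faithful); exact: xT. Qed.

Section Lift.
Variables (A : set (affine_space C N)) (f : affine_space C N -> X).
Hypothesis fA : equivariant_rational_map (@regular_rep C gT) act stable_torus A f.

Local Notation actY := (@regular_rep C gT).

(** If [P] lifts [act g], both F o g and P o F lift the map f o g = g o f; they differ by an element
    of K, which is absorbed into [P]. Translation by g is a ring automorphism, so F o g is still
    admissible. *)
Lemma normalized_lifts : exists (F : 'I_r -> mpoly N C) (s : gT -> 'I_r -> mpoly r C),
  [/\ forall i, F i != 0, forall g, cox_lift (act g) (s g) &
      forall g i, subst F (s g i) = pullback_rep g (F i)].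
Proof.
have [[oA [y0 Ay0]] rf fU feq] := fA.
have [||F [Fa FP]] := @lift_sub_affine C R n D smooth N _ A f _ rf.
- by exists 1; rewrite ?oner_eq0 // => v _.
- exists y0 => //; have := fU y0 Ay0 1%g.
  by rewrite (gvariety_act1 act_faithful).
have [F0 _] := Fa; exists F.
suff /choice[s sP] : forall g, exists s, cox_lift (act g) s /\
    forall i, subst F (s i) = pullback_rep g (F i).
  by exists s; split=> // g; case: (sP g).
move=> g; have [P PL] := cox_lift_exists smooth (gvariety_regular act_faithful g) (act_torus g).
have [Pa PP] := PL.
have PFQ y : A y -> quotient_point (evalF P (evalF F (coordinate y))) (act g (f y)).
  move=> Ay; have [Fy Fyq] := FP y Ay.
  by have [_ /(_ _ Fyq)] := PP _ Fy.
have evalPF v : evalF (fun i => subst F (P i)) v = evalF P (evalF F v).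
  by apply/funext => i; rewrite /evalF meval_subst.
have PF0 i : subst F (P i) != 0.
  have [zT _] := PFQ y0 Ay0; have := zT i; rewrite (fU y0 Ay0 g) finset.in_set0.
  rewrite -evalPF => /esym/negbT; apply: contra => /eqP H.
  by rewrite /evalF H meval0.
have PFa : admissible_polys (D := D) (fun i => subst F (P i)).
  by apply: admissible_comp => // z za; case: (PP z za).
have Fga : admissible_polys (D := D) (fun i => pullback_rep g (F i)).
  apply: (@admissible_iso C R n D N F (pullback_rep_morph C g)
    (pullback_rep_morph C g^-1%g)) => //; first exact: pullback_repK.
  by have := @pullback_repK C gT g^-1%g; rewrite invgK.
have [p [py0 pA]] := sub_affine_openP oA Ay0.
have p0 : p != 0 by apply: contraNneq py0 => ->; rewrite meval0.
have gp0 : pullback_rep g p != 0.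
  rewrite -[pullback_rep g p]/(pullback_rep_morph C g p).
  by rewrite -(rmorph0 (pullback_rep_morph C g)) (can_eq (@pullback_repK C gT g)).
(* Where [p] is nonzero at [v] and at its translate, both points lie in [A] and equivariance of [f]
   compares the two tuples. *)
have [|k kP kE] := lift_unique smooth Fga PFa (mulf_neq0 p0 gp0).
  move=> v; rewrite mevalM mulf_eq0 negb_or meval_pullback_rep => /andP[vp vgp] m.
  pose y : affine_space C N := aff_point v.
  have yE : coordinate y = v by apply/funext => i; rewrite aff_pointE.
  have gyE : coordinate (actY g y) = fun i => v (translate g i).
    by apply/funext => i; rewrite regular_repE yE.
  have Ay : A y by apply: pA; rewrite yE.
  have Agy : A (actY g y) by apply: pA; rewrite gyE.
  have [_ <-] : quotient_point (evalF (fun i => subst F (P i)) v) (act g (f y)).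
    by rewrite evalPF -yE; exact: PFQ.
  rewrite -feq //; have [_ [_ ->]] := FP _ Agy; rewrite gyE.
  by congr (monomial _ m); apply/funext => i; rewrite /evalF meval_pullback_rep.
exists (fun i => k i *: P i); split; first exact: cox_lift_scale.
by move=> i; rewrite kE /subst comp_mpolyZ.
Qed.

End Lift.

Theorem versal_splits : versal act -> cox_ext_splits act.
Proof.
move=> [_ vX]; have [oU nU] := stable_torus_open.
have [A [f fA]] := vX _ _ (faithful_regular_rep C gT) _ oU nU stable_torus_invariant.
have [F [s [F0 sL sF]]] := normalized_lifts fA.
have sFE g v i : meval (evalF F v) (s g i) = evalF F (fun i => v (translate g i)) i.
  by rewrite /evalF -meval_subst sF meval_pullback_rep.
have [v0 v0P] : exists v, forall i, meval v (F i) != 0.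
  have [|v] := @meval_neq0 _ _ (\prod_i F i); first exact/prodf_neq0.
  by rewrite meval_prod => /prodf_neq0 H; exists v => i; exact: H.
(* The two lifts differ by an element of K, and no coordinate of F vanishes
   identically. *)
have rigid a (P Q : 'I_r -> mpoly r C) : cox_lift a P -> cox_lift a Q ->
    (forall i v, meval (evalF F v) (P i) = meval (evalF F v) (Q i)) ->
    (exists v, forall i, meval (evalF F v) (Q i) != 0) -> P = Q.
  move=> PL QL PQ [v vQ]; have [k _ kE] := cox_lift_unique smooth PL QL.
  apply/funext => i; rewrite kE; suff -> : k i = 1 by rewrite scale1r.
  by apply: (mulIf (vQ i)); rewrite mul1r -[RHS]PQ kE mevalZ.
have act1 : act 1%g = id by apply/funext => x; exact: (gvariety_act1 act_faithful).
have actM g h : act (g * h)%g = act g \o act h.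
  by apply/funext => x; exact: (gvariety_actM act_faithful).
have F_trans g : exists v, forall i, evalF F (fun j => v (translate g j)) i != 0.
  exists (fun j => v0 (translate g^-1%g j)) => i.
  rewrite (_ : (fun j => _) = v0); first exact: v0P.
  by apply/funext => j; rewrite -translateM mulgV translate1.
have s1 : s 1%g = @coordinate_polys C R n D.
  apply: (rigid id); first by rewrite -act1.
  - exact: cox_lift_id.
  - move=> i v; rewrite sFE -[RHS]/(evalF (@coordinate_polys C R n D) (evalF F v) i).
    rewrite eval_coordinate_polys; congr (evalF F _ i).
    by apply/funext => j; rewrite translate1.
  - exists v0 => i; rewrite -[meval _ _]/(evalF (@coordinate_polys C R n D) _ i).
    by rewrite eval_coordinate_polys; exact: v0P.
have sM g h : s (g * h)%g = fun i => subst (s h) (s g i).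
  apply/esym; apply: (rigid (act (g * h)%g)) => //.
  - have := act_torus (g * h)%g; rewrite actM => ghT.
    by apply: cox_lift_comp.
  - move=> i v; rewrite meval_subst sFE.
    have -> : (fun i => meval (evalF F v) (s h i)) = evalF F (fun j => v (translate h j)).
      by apply/funext => j; rewrite sFE.
    rewrite sFE; congr (evalF F _ i).
    by apply/funext => j; rewrite translateM.
  - by have [v vP] := F_trans (g * h)%g; exists v => i; rewrite sFE.
have sA g z : admissible_point (D := D) z -> admissible_point (D := D) (evalF (s g) z).
  by move=> za; have [_ /(_ z za)[]] := sL g.
pose sg g : V -> V := cox_map (@sA g).
have sgM g h z : sg (g * h)%g z = sg g (sg h z).
  apply: cox_inj => i; rewrite !cox_mapE sM meval_subst.
  by congr meval; apply/funext => j; rewrite cox_mapE.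
have sg1 z : sg 1%g z = z.
  apply: cox_inj => i; rewrite cox_mapE s1.
  by rewrite -[LHS]/(evalF (@coordinate_polys C R n D) _ i) eval_coordinate_polys.
have sgP g : aut_proj (sg g) (act g).
  move=> z x /(cox_quotientP smooth) zx; apply/(cox_quotientP smooth).
  have [_ /(_ _ (cox_admissible z))[_ /(_ x zx)]] := sL g.
  by congr quotient_point; apply/funext => i; rewrite cox_mapE.
(* The conjugate of an element of K lifts the identity, so by uniqueness of lifts it is again in
   K. *)
have Kconj g k : K_action k -> K_action (sg g \o k \o sg g^-1%g).
  move=> [t tP tE].
  have tL : cox_lift (act g^-1%g) (fun i => t i *: s g^-1%g i) by exact: cox_lift_scale.
  have kL : cox_lift id (fun i => subst (fun i => t i *: s g^-1%g i) (s g i)).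
    have := cox_lift_comp smooth _ (sL g) tL; rewrite -actM mulgV act1; apply.
    by have [x xT] := torus_nonempty; exists x; rewrite act_inverse.
  have [u uP uE] := cox_lift_unique smooth kL (@cox_lift_id C R n D).
  exists u => // z i; rewrite /= cox_mapE.
  have -> : cox_coord (k (sg g^-1%g z)) =
      evalF (fun i => t i *: s g^-1%g i) (cox_coord z).
    by apply/funext => j; rewrite tE cox_mapE /evalF mevalZ.
  rewrite -[LHS]meval_subst uE mevalZ; congr (_ * _).
  by rewrite -[LHS]/(evalF (@coordinate_polys C R n D) _ i) eval_coordinate_polys.
exists sg; split=> //; last by move=> g h; apply/funext => z; exact: sgM.
move=> g; split; last by exists g.
exists (sg g^-1%g); split.
- by split; exact: regular_cox_map.
- by split=> z; rewrite -sgM ?mulgV ?mulVg sg1.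
- move=> k Kk; split; first exact: Kconj.
  by have := Kconj g^-1%g k Kk; rewrite invgK.
Qed.

End VersalSplits.

(** * From a splitting to versality *)

Section Hartogs.
Variables (C : closedFieldType) (R : realType) (n : nat) (D : fan R n).

Local Notation V := (cox_space C D).
Local Notation r := (nrays D).

Lemma cox_dense_eq (a b : mpoly r C) : (forall z : V,
  meval (cox_coord z) a = meval (cox_coord z) b) -> a = b.
Proof.
move=> ab; apply: (dense_eq (@prod_coordinate_neq0 C R n D)) => v vX.
have := ab (mk_cox (generic_admissible vX)).
by have -> : cox_coord (mk_cox (generic_admissible vX)) = v
  by apply/funext => i; rewrite mk_coxE.
Qed.

(* A denominator of minimal length is constant: each of its prime factors
   vanishes somewhere outside the irrelevant locus. *)
Theorem regular_cox_polynomial (f : V -> C) : regular setT f ->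
  exists p, forall z, f z = meval (cox_coord z) p.
Proof.
move=> rf; pose rep (z : V) (c d : mpoly r C) := meval (cox_coord z) d != 0 /\
  forall y : V, meval (cox_coord y) d != 0 ->
    f y = meval (cox_coord y) c / meval (cox_coord y) d.
have repP z : exists c d, rep z c d.
  have [c [d [dz H]]] := sub_affine_regularP openT rf (I : setT z).
  by exists c, d; split=> // y /H[].
have repE z c d z' c' d' : rep z c d -> rep z' c' d' -> c * d' = c' * d.
  move=> [dz cd] [dz' cd'].
  have nz w (e : mpoly r C) : meval w e != 0 -> e != 0.
    by apply: contraNneq => ->; rewrite meval0.
  apply/eqP; rewrite -subr_eq0; have dd0 := mulf_neq0 (nz _ _ dz) (nz _ _ dz').
  rewrite -(mulrI_eq0 _ (mulfI dd0)); apply/eqP/cox_dense_eq => y.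
  rewrite meval0 !mevalM mevalB !mevalM.
  have [->|dy] := eqVneq (meval (cox_coord y) d) 0; first by rewrite !mul0r.
  have [->|d'y] := eqVneq (meval (cox_coord y) d') 0; first by rewrite mulr0 !mul0r.
  have := cd y dy; rewrite cd' // => /eqP; rewrite eqr_div // => /eqP <-.
  by rewrite subrr mulr0.
have one_adm : admissible_point (D := D) (fun=> 1 : C).
  by exists finset.set0 => [|i _]; [exact: set0_cones|exact: oner_neq0].
(* The invariant is one fraction [a / b] that agrees with every local representation of [f];
   cancelling a prime factor of [b] preserves it. *)
suff key (a b : mpoly r C) : b != 0 -> (forall z c d, rep z c d -> a * d = c * b) ->
    exists p, forall z, f z = meval (cox_coord z) p.
  have [c0 [d0 r0]] := repP (mk_cox one_adm); have [d0z _] := r0.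
  apply: (key c0 d0) => [|z c d rz]; last exact: repE r0 rz.
  by apply: contraNneq d0z => ->; rewrite meval0.
have [k] := ubnP (size (mfactors b)); elim: k a b => // k IHk a b kb b0 ab.
case E : (mfactors b) => [|p s].
  exists ((leadc b)^-1 *: a) => z; have [c [d rz]] := repP z.
  have [dz cd] := rz; have := congr1 (meval (cox_coord z)) (ab _ _ _ rz).
  have l0 : leadc b != 0 by rewrite leadc_eq0.
  rewrite {1}[b]mfactorsE E big_nil -mul_mpolyC mulr1 !mevalM mevalC => adE.
  rewrite mevalZ cd //; apply: (mulIf dz); rewrite divfK // -mulrA adE.
  by rewrite mulrC mulfK.
have pm : monic_prime p by apply: (@mfactors_monic _ _ b); rewrite E mem_head.
have [p0 _ pP] := proj1 pm.
have [b' bE] : divides p b by apply/(mord_divides pm) => //; rewrite mord_gt0 E mem_head.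
have [v [vp vadm]] := admissible_zero (@admissible_coordinate_polys C R n D) (proj1 pm).
rewrite eval_coordinate_polys in vadm; pose z := mk_cox vadm.
have zE : cox_coord z = v by apply/funext => i; rewrite mk_coxE.
have [c [d rz]] := repP z; have [dz _] := rz.
(* [p] vanishes at [z] and [d] does not, so [p] must divide [a]. *)
have [[a' aE]|[e dE]] : divides p a \/ divides p d.
- by apply: pP; rewrite (ab _ _ _ rz) bE; exists (c * b'); rewrite mulrA.
- have b'0 : b' != 0 by apply: contraNneq b0 => b'0; rewrite bE b'0 mul0r.
  apply: (IHk a' b') => // [|y c' d' ry].
    have := perm_size (mfactorsM b'0 p0); rewrite size_cat -bE => sE.
    have : (0 < size (mfactors p))%N.
      by have := mord_monic p pm; rewrite eqxx /mord; case: (mfactors p).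
    move: kb; rewrite sE; move: (size (mfactors b')) (size (mfactors p)) => x y.
    lia.
  apply: (mulIf p0); have := ab _ _ _ ry; rewrite aE bE => abE.
  by rewrite mulrAC abE mulrA.
- by move: dz; rewrite dE mevalM zE vp mulr0 eqxx.
Qed.

End Hartogs.

(** * Weights, dilations and polynomial group actions *)

Section Weights.
Variables (C : closedFieldType) (r : nat).
Implicit Types (b : 'I_r -> nat) (p : mpoly r C) (v : 'I_r -> C) (t : C).

Definition weight b (m : multinom r) := (\sum_i b i * m i)%N.

Definition homogeneous b w p := forall m, m \in msupp p -> weight b m = w.

Definition dilate b t v i := t ^+ b i * v i.

Lemma exp_inj_generic (k l : nat) : (forall t, t != 0 -> t ^+ k = t ^+ l :> C) -> k = l.
Proof.
move=> kl; apply: contrapT => /eqP nkl.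
have q0 : ('X^k - 'X^l) * 'X != 0 :> {poly C}.
  rewrite mulf_neq0 ?polyX_eq0 // subr_eq0; apply: contra nkl => /eqP E.
  have := congr1 (fun q : {poly C} => q`_k) E; rewrite !coefXn eqxx.
  by case: eqP => // _ /eqP; rewrite oner_eq0.
have [t] := closed_nonrootP _ q0; rewrite rootE hornerM hornerX mulf_eq0 negb_or.
by move=> /andP[+ /kl E]; rewrite hornerD hornerN !hornerXn E subrr eqxx.
Qed.

(** Comparing coefficients, t to the power of the weight is the same for all monomials of [p] and
    every t other than 0; a closed field has enough such t to make the weights equal. *)
Lemma homogeneous_eigen b p (tau : C -> C) : p != 0 ->
  (forall t, t != 0 -> forall v, meval (dilate b t v) p = tau t * meval v p) ->
  exists w, homogeneous b w p /\ forall t, t != 0 -> tau t = t ^+ w.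
Proof.
move=> p0 H.
have E t m : t != 0 -> m \in msupp p -> tau t = t ^+ weight b m.
  move=> t0 mp; pose q := \sum_(m <- msupp p) (t ^+ weight b m * mcoeff m p) *: mpolyX C m.
  have qE : q = tau t *: p.
    apply: mpoly_eq => v; rewrite mevalZ -H // /q mevalS (mevalE _ p).
    apply: eq_bigr => m' _; rewrite mevalZ mevalX mulrAC mulrC; congr (_ * _).
    rewrite /weight -prodrXr -big_split; apply: eq_bigr => i _ /=.
    by rewrite /dilate exprMn exprM.
  have := congr1 (mcoeff m) qE; rewrite mcoeffZ /q raddf_sum /=.
  rewrite (bigD1_seq m) ?msupp_uniq //= mcoeffZ mcoeffX eqxx mulr1 big1 ?addr0.
    by move/mulIf => -> //; rewrite -mcoeff_msupp.
  by move=> m' /negPf mm'; rewrite mcoeffZ mcoeffX mm' mulr0.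
have lp : mlead p \in msupp p by exact: mlead_supp.
exists (weight b (mlead p)); split=> [m mp|t t0]; last exact: E.
by apply: exp_inj_generic => t t0; rewrite -!E.
Qed.

Lemma meval_homogeneous b w p t v : homogeneous b w p ->
  meval (dilate b t v) p = t ^+ w * meval v p.
Proof.
move=> pw; rewrite !mevalE mulr_sumr; apply: eq_big_seq => m mp.
rewrite mulrCA; congr (_ * _); rewrite -(pw m mp) /weight -prodrXr -big_split.
by apply: eq_bigr => i _; rewrite /= /dilate exprMn exprM.
Qed.

(* For b > 0, a b-homogeneous polynomial is affine in the variables of its own
   weight, the other variables occurring in it having smaller weight. *)
Lemma homogeneous_affine b w p (J : finType) (c : J -> C) (x : J -> 'I_r -> C) :
  (forall i, 0 < b i)%N -> (0 < w)%N -> homogeneous b w p -> \sum_j c j = 1 ->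
  (forall i j j', (b i < w)%N -> x j i = x j' i) ->
  meval (fun i => \sum_j c j * x j i) p = \sum_j c j * meval (x j) p.
Proof.
move=> b0 w0 pw c1 xE; rewrite mevalE.
under [RHS]eq_bigr do rewrite mevalE mulr_sumr; rewrite exchange_big /=.
apply: eq_big_seq => m mp; under [RHS]eq_bigr do rewrite mulrCA.
rewrite -mulr_sumr; congr (_ * _).
have [[i [bi mi]]|H] := pselect (exists i, (w <= b i)%N /\ (0 < m i)%N).
  have mw := pw m mp; rewrite /weight (bigD1 i) //= in mw.
  have bm : (b i * m i <= b i * 1)%N.
    by rewrite muln1 (leq_trans _ bi) // -mw leq_addr.
  have mi1 : m i = 1%N by apply/eqP; rewrite eqn_leq mi andbT -(leq_pmul2l (b0 i)).
  have m0 k : k != i -> m k = 0%N.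
    move=> ki; have : (b k * m k <= \sum_(k | k != i) b k * m k)%N.
      by rewrite (bigD1 k) //= leq_addr.
    have -> : (\sum_(k | k != i) b k * m k = 0)%N.
      apply/eqP; rewrite -leqn0 -(leq_add2l (b i)) addn0.
      by rewrite mi1 muln1 in mw; rewrite mw.
    by rewrite leqn0 muln_eq0 -leqn0 leqNgt b0 => /eqP.
  have one v : \prod_k v k ^+ m k = v i.
    rewrite (bigD1 i) //= mi1 expr1 big1 ?mulr1 // => k ki.
    by rewrite m0 // expr0.
  by rewrite one; apply: eq_bigr => j _; rewrite one.
have [j0 _] : exists j : J, True.
  apply: contrapT => K; have /eqP := c1; rewrite big1 => [|j _].
    by rewrite eq_sym oner_eq0.
  by case: K; exists j.
have xj j : \prod_k x j k ^+ m k = \prod_k x j0 k ^+ m k.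
  apply: eq_bigr => k _; have [->|mk] := eqVneq (m k) 0%N; first by rewrite !expr0.
  congr (_ ^+ _); apply: xE; rewrite ltnNge; apply/negP => wk; apply: H.
  by exists k; rewrite lt0n.
under [RHS]eq_bigr do rewrite xj; rewrite -mulr_suml c1 mul1r.
apply: eq_bigr => k _; have [->|mk] := eqVneq (m k) 0%N; first by rewrite !expr0.
have kw : (b k < w)%N.
  rewrite ltnNge; apply/negP => wk; apply: H.
  by exists k; rewrite lt0n.
by congr (_ ^+ _); rewrite (eq_bigr _ (fun j _ => congr1 _ (xE k j j0 kw))) -mulr_suml c1 mul1r.
Qed.

Variables (gT : finGroupType) (s : gT -> 'I_r -> mpoly r C).

Definition point_action g v : 'I_r -> C := fun i => meval v (s g i).

Local Notation E := point_action.

Definition polynomial_action :=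
  (forall v, E 1%g v = v) /\ forall g h v, E (g * h)%g v = E g (E h v).

(* Averaging the conjugates of the dilation by a over the group yields a
   dilation that commutes with the group. *)
Theorem invariant_weights (a : 'I_r -> nat) : polynomial_action ->
  (forall i, 0 < a i)%N ->
  (forall g t, t != 0 -> exists tau, forall v i, E g (dilate a t v) i = tau i * E g v i) ->
  exists b, (forall i, 0 < b i)%N /\ forall g i, homogeneous b (b i) (s g i).
Proof.
move=> [E1 EM] a0 H.
have surj g v : E g (E g^-1%g v) = v by rewrite -EM mulgV E1.
have s0 g i : s g i != 0.
  apply/eqP => z; have := surj g (fun=> 1); move/(congr1 (fun f => f i)).
  by rewrite /point_action z meval0 => /eqP; rewrite eq_sym oner_eq0.
have /choice[w wP] : forall gi : gT * 'I_r, exists w, homogeneous a w (s gi.1 gi.2).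
  move=> [g i] /=; have H' t : exists tau, t != 0 -> forall v,
      meval (dilate a t v) (s g i) = tau * meval v (s g i).
    have [->|t0] := eqVneq t 0; first by exists 0.
    by have [tau tauP] := H g t t0; exists (tau i) => _ v; exact: tauP.
  have [tau tauP] := choice H'.
  by have [w [wP _]] := homogeneous_eigen (s0 g i) tauP; exists w.
have EW g t v : E g (dilate a t v) = dilate (fun i => w (g, i)) t (E g v).
  by apply/funext => i; rewrite /point_action (meval_homogeneous _ _ (wP (g, i))).
(* All [a i] being positive, a component of weight 0 would be constant, but every [E g] is
   surjective. *)
have w0 g i : (0 < w (g, i))%N.
  rewrite lt0n; apply/eqP => wz.
  have m0 m : m \in msupp (s g i) -> m = mnm0.
    move=> /(wP (g, i)); rewrite wz => /eqP; rewrite sum_nat_eq0 => /forallP mz.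
    apply/mnmP => k; rewrite mnm0E; apply/eqP.
    by have := mz k; rewrite muln_eq0 -leqn0 leqNgt a0.
  have const v v' : E g v i = E g v' i.
    rewrite /point_action !mevalE; apply: eq_big_seq => m /m0 ->.
    by congr (_ * _); apply: eq_bigr => k _; rewrite mnm0E !expr0.
  have := const (E g^-1%g (fun=> 0)) (E g^-1%g (fun=> 1)).
  by rewrite !surj => /eqP; rewrite eq_sym oner_eq0.
pose b i := (\sum_(g : gT) w (g, i))%N; exists b; split.
  by move=> i; rewrite /b (bigD1 1%g) //= ltn_addr.
(* The conjugate by [g] of the dilation by [a] has weights [w (g, i)]. Conjugation by [h] replaces
   [g] by [h * g], so the product of all these dilations, whose weights are [b], commutes with the
   action. *)
have conj h g t v : E h (dilate (fun i => w (g, i)) t v) =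
    dilate (fun i => w ((h * g)%g, i)) t (E h v).
  by rewrite -{1}(surj g v) -EW -EM EW EM surj.
have seqP h (l : seq gT) t v :
    E h (dilate (fun i => (\sum_(g <- l) w (g, i))%N) t v) =
    dilate (fun i => (\sum_(g <- l) w ((h * g)%g, i))%N) t (E h v).
  elim: l v => [|g l IHl] v.
    have dil0 u : dilate (fun i => (\sum_(g <- [::]) w (g, i))%N) t u = u.
      by apply/funext => i; rewrite /dilate big_nil expr0 mul1r.
    rewrite dil0; apply/funext => i; by rewrite /dilate big_nil expr0 mul1r.
  have dilS (f : gT -> 'I_r -> nat) u : dilate (fun i => (\sum_(g <- g :: l) f g i)%N) t u =
      dilate (f g) t (dilate (fun i => (\sum_(g <- l) f g i)%N) t u).
    by apply/funext => i; rewrite /dilate big_cons exprD mulrA.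
  by rewrite (dilS (fun g i => w (g, i))) conj IHl -(dilS (fun g i => w ((h * g)%g, i))).
have bE h t v : E h (dilate b t v) = dilate b t (E h v).
  rewrite /b seqP; congr dilate; apply/funext => i.
  by rewrite [RHS](reindex_inj (mulgI h)).
move=> h i; have [|wt [wtP tE]] := homogeneous_eigen (b := b) (tau := fun t => t ^+ b i) (s0 h i).
  by move=> t t0 v; have := congr1 (fun f => f i) (bE h t v).
by have -> : b i = wt by apply: exp_inj_generic => t /tE.
Qed.

End Weights.

(** * Equivariant partitions of unity and equivariant maps *)

Section FreeOrbit.
Variables (C : closedFieldType) (gT : finGroupType).
Variables (Y : fspace C) (actY : gT -> Y -> Y).
Hypothesis Yf : faithful_variety actY.

(** Separatedness gives, near (y, g y), a sum of products of functions of the two variables that is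
    nonzero there and vanishes on the diagonal; its pullback by x to (x, g x) cuts out the
    neighbourhood. *)
Lemma moved_open g : g != 1%g ->
  open [set y | actY g y <> y] /\ [set y | actY g y <> y] !=set0.
Proof.
move=> g1; split; last first.
  apply: contrapT => H; case/eqP: g1; apply: (gvariety_faithful Yf) => y.
  by apply: contrapT => gy; apply: H; exists y.
apply: open_local => y gy.
have [U [V [h [[oU Uy] [oV Vgy] [k [f [f' [fU f'V hE]]]] hy hW]]]] :=
  variety_separated (gvariety_variety Yf) (x := y) (y := actY g y) (fun e => gy (esym e)).
have [og rg] := gvariety_regular Yf g oV; rewrite setTI in og rg.
have oN : open (U `&` actY g @^-1` V) by exact: openI.
exists ((U `&` actY g @^-1` V) `&` [set x | h x (actY g x) != 0]); split=> //.
  apply: open_nonvanishing => //.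
  apply: (regular_ext oN (f := fun x => \sum_i f i x * f' i (actY g x))).
    by move=> x _; rewrite hE.
  apply: regular_sum => // i _; apply: regular_mul => //.
    by apply: (regular_res oU) => // x [].
  by apply: (regular_res og) => //; exact: rg.
move=> x [[Ux Vgx] hx] /= e; exact: (hW x (actY g x)).
Qed.

(* Lagrange interpolation on a free orbit inside an affine chart, averaged. *)
Lemma equivariant_partition : exists (A : set Y) (y0 : Y) (e : gT -> Y -> C),
  [/\ open A, forall g y, A y -> A (actY g y), A y0 &
    [/\ forall g, regular A (e g), forall y, A y -> \sum_g e g y = 1,
      forall g h y, e (g * h)%g y = e h (actY g^-1%g y) &
      forall g, e g y0 = (g == 1%g)%:R]].
Proof.
have [irrY [k [cover [cov_aff covP]]] _] := gvariety_variety Yf.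
have [[yy _] _] := irrY; have [i0 yi0] := covP yy.
have [N [J [f [f' [rf rf' fK _]]]]] := cov_aff i0; pose U0 := cover i0.
have oU0 : open U0 by exact: regular_map_on_open rf.
have act1 := gvariety_act1 Yf; have actM := gvariety_actM Yf.
have oact g : open (actY g @^-1` U0).
  by have [+ _] := gvariety_regular Yf g oU0; rewrite setTI.
have actK g y : actY g^-1%g (actY g y) = y by rewrite -actM mulVg act1.
have actKV g y : actY g (actY g^-1%g y) = y by rewrite -actM mulgV act1.
have [oB nB] := irreducible_finite_meet (s := enum gT)
  (O := fun g => actY g @^-1` U0) irrY (fun g _ => conj (oact g)
    (ex_intro _ (actY g^-1%g yy) (eq_ind_r U0 yi0 (actKV g yy)))).
pose B := [set y | forall g, U0 (actY g y)].
have BE : [set y | forall g, g \in enum gT -> (actY g @^-1` U0) y] = B.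
  by apply/seteqP; split=> y H g //=; apply: H; rewrite mem_enum.
rewrite BE in oB nB.
have Binv g y : B y -> B (actY g y) by move=> By h; rewrite -actM; exact: By.
have [oM nM] := irreducible_finite_meet (s := [seq g <- enum gT | g != 1%g])
  (O := fun g => [set y | actY g y <> y]) irrY
  (fun g gs => moved_open (proj1 (andP (eq_ind _ is_true gs _ (mem_filter _ _ _))))).
have [_ irr] := irrY.
have [||y0 [_ [By0 My0]]] := irr _ _ oB oM.
- by case: nB => y By; exists y.
- by case: nM => y My; exists y.
have free g : g != 1%g -> actY g y0 <> y0.
  by move=> g1; apply: My0; rewrite mem_filter g1 mem_enum.
have oB0 : B `<=` U0 by move=> y /(_ 1%g); rewrite act1.
have /choice[ph phP] : forall g : gT, exists p : Y -> C, [/\ regular U0 p, p y0 = 1 &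
    g != 1%g -> p (actY g y0) = 0].
  move=> g; have [->|g1] := eqVneq g 1%g.
    by exists (fun=> 1); split=> //; exact: regular_cst.
  have [j fj] : exists j, coordinate (f y0) j != coordinate (f (actY g y0)) j.
    apply: contrapT => H; apply: (free g g1).
    rewrite -(fK _ (By0 g)) -[RHS](fK _ (oB0 _ By0)).
    congr f'; apply: sub_affine_inj => j; apply: contrapT => /eqP fj.
    by apply: H; exists j; rewrite eq_sym.
  pose c := coordinate (f y0) j - coordinate (f (actY g y0)) j.
  have c0 : c != 0 by rewrite subr_eq0.
  exists (fun y => (coordinate (f y) j - coordinate (f (actY g y0)) j) * c^-1); split.
  - apply: regular_mul => //; last exact: regular_cst.
    apply: regular_add => //; last exact: regular_cst.
    have [_ rT] := rf setT openT.
    have := rT _ (@regular_coordinate _ _ _ setT j).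
    by rewrite preimage_setT setIT.
  - by rewrite mulfV.
  - by rewrite subrr mul0r.
(* The product is 1 at [y0] and 0 at the other points of its orbit. *)
pose h0 y := \prod_g ph g y.
have rh0 : regular U0 h0 by apply: regular_prod => // g _; case: (phP g).
have h01 : h0 y0 = 1 by rewrite /h0 big1 // => g _; case: (phP g).
have h00 g : g != 1%g -> h0 (actY g y0) = 0.
  by move=> g1; rewrite /h0 (bigD1 g) //=; case: (phP g) => _ _ -> //; rewrite mul0r.
have rhg g : regular B (fun y => h0 (actY g y)).
  have [_ /(_ _ rh0)] := gvariety_regular Yf g oU0; rewrite setTI.
  by apply: regular_res => // y; apply.
(* [H] is invariant and equals 1 at [y0]; dividing by it normalises the sum to 1 without dividing by
   the order of the group. *)
pose H y := \sum_g h0 (actY g^-1%g y).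
have Hinv k' y : H (actY k' y) = H y.
  rewrite /H (reindex_inj (mulgI k')) /=; apply: eq_bigr => g _.
  by rewrite -actM invMg mulgKV.
have Hy0 : H y0 = 1.
  rewrite /H (bigD1 1%g) //= invg1 act1 h01 big1 ?addr0 // => g g1.
  by rewrite h00 // invg_eq1.
have rH : regular B H by apply: regular_sum => // g _; exact: rhg.
exists (B `&` [set y | H y != 0]), y0, (fun g y => h0 (actY g^-1%g y) * (H y)^-1).
have oA : open (B `&` [set y | H y != 0]) by exact: open_nonvanishing.
split=> //.
- by move=> g y [By Hy]; split; [exact: Binv|rewrite /= Hinv].
- by split=> //=; rewrite Hy0 oner_neq0.
split=> [g|y [_ Hy]|g h y|g].
- apply: regular_mul => //; first by apply: (regular_res oB) => // y [].
  apply: regular_inv => // [y []//|].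
  by apply: (regular_res oB) => // y [].
- by rewrite -mulr_suml mulfV.
- by rewrite Hinv -actM invMg.
- rewrite Hy0 invr1 mulr1; have [->|g1] := eqVneq g 1%g; first by rewrite invg1 act1.
  by rewrite h00 // invg_eq1.
Qed.

(* Coordinates of weight at most k are equivariant after k averaging steps. *)
Theorem polynomial_action_equivariant_map r (s : gT -> 'I_r -> mpoly r C) b (x0 : 'I_r -> C) :
  polynomial_action s -> (forall i, 0 < b i)%N ->
  (forall g i, homogeneous b (b i) (s g i)) ->
  exists (A : set Y) (F : Y -> 'I_r -> C),
    [/\ open A, exists2 y0, A y0 & F y0 = x0, forall g y, A y -> A (actY g y),
        forall i, regular A (fun y => F y i) &
        forall g y, A y -> F (actY g y) = point_action s g (F y)].
Proof.
move=> [E1 EM] b0 sb.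
have [A [y0 [e [oA Ainv Ay0 [re e1 eM ey0]]]]] := equivariant_partition.
have act1 := gvariety_act1 Yf; have actM := gvariety_actM Yf.
(* For a linear action one average would be equivariant at once; here each pass settles the
   coordinates of one more weight. At [y0] only the term of the identity survives, so the value
   there is kept. *)
pose avg (F : Y -> 'I_r -> C) y i :=
  \sum_g e g y * point_action s g (F (actY g^-1%g y)) i.
pose F k := iter k avg (fun=> x0).
have reg k i : regular A (fun y => F k y i).
  elim: k i => [|k IHk] i; first exact: regular_cst.
  apply: regular_sum => // g _; apply: regular_mul => //.
  apply: regular_meval => // j.
  have [_ /(_ _ (IHk j))] := gvariety_regular Yf g^-1%g oA; rewrite setTI.
  apply: regular_res => //; last by move=> y Ay; exact: Ainv.
  by have [+ _] := gvariety_regular Yf g^-1%g oA; rewrite setTI.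
have Fy0 k : F k y0 = x0.
  elim: k => [//|k IHk]; apply/funext => i; rewrite /F /= -/(F k) /avg.
  rewrite (bigD1 1%g) //= ey0 eqxx mul1r E1 invg1 act1 IHk big1 ?addr0 // => g g1.
  by rewrite ey0 (negPf g1) mul0r.
have equi k i : (b i <= k)%N -> forall g y, A y ->
    point_action s g (F k (actY g^-1%g y)) i = F k y i.
  elim: k i => [|k IHk] i; first by rewrite leqNgt b0.
  move=> bi g y Ay; rewrite /F /= -/(F k) {2}/avg.
  pose y' := actY g^-1%g y; have Ay' : A y' by exact: Ainv.
  pose x c := point_action s c (F k (actY c^-1%g y')).
  have -> : avg (F k) y' = fun i => \sum_c e c y' * x c i by [].
  (* By induction the coordinates of [x c] lighter than [b i] do not depend on [c], so the action
     passes through the average; the summation index is then shifted by [g]. *)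
  rewrite {1}/point_action (homogeneous_affine b0 (b0 i) (sb g i) (e1 _ Ay')).
    rewrite [RHS](reindex_inj (mulgI g)) /=; apply: eq_bigr => c _.
    rewrite eM -/y'; congr (_ * _); rewrite EM /x /y' -actM invMg.
    by [].
  move=> j c c' bj; have bjk : (b j <= k)%N by rewrite -ltnS (leq_trans bj).
  by rewrite /x !IHk.
(* The sum of all weights bounds each of them, so this number of passes settles every coordinate. *)
exists A, (F (\sum_i b i)%N); split=> //; first by exists y0.
move=> g y Ay; apply/funext => i.
have bi : (b i <= \sum_i b i)%N by rewrite (bigD1 i) //= leq_addr.
rewrite -(equi _ i bi g (actY g y)); last exact: Ainv.
by rewrite -actM mulVg act1.
Qed.

End FreeOrbit.

Section SplitsVersal.
Variables (C : closedFieldType) (R : realType) (n : nat) (D : fan R n).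
Variables (gT : finGroupType) (act : gT -> toric_variety C D -> toric_variety C D).
Hypotheses (smooth : smooth_complete D) (act_faithful : faithful_variety act).

Local Notation X := (toric_variety C D).
Local Notation V := (cox_space C D).
Local Notation r := (nrays D).

(** By completeness, minus the sum of the rays is a natural combination of rays with coefficients
    [c]. Adding each ray once gives a relation with coefficients [(c i).+1], that is, a positive
    cocharacter of K. *)
Lemma positive_pic_dual : exists a : 'I_r -> nat, (forall i, 0 < a i)%N /\
  forall t : C, t != 0 -> pic_dual (D := D) (fun i => t ^+ a i).
Proof.
have [c _ cE] := ray_sum_exists smooth (- \sum_i ray D i).
exists (fun i => (c i).+1); split=> // t t0; split=> [i|m]; first by rewrite expf_neq0.
have aE : \sum_i (c i).+1%:Z *: ray D i = 0.
  under eq_bigr do rewrite intS scalerDl scale1r.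
  by rewrite big_split /= -[X in _ + X]/(ray_sum c) -cE subrr.
transitivity (t ^ pairing m (\sum_i (c i).+1%:Z *: ray D i)); last first.
  by rewrite aE pairing0r expr0z.
rewrite pairing_sumr (big_morph (fun z => t ^ z) (op1 := *%R) (id1 := 1)) //.
  by apply: eq_bigr => i _; rewrite pairingZr exprnP exprz_exp.
by move=> x y; rewrite expfzDr.
Qed.

Section Splitting.
Variable s : gT -> V -> V.
Hypotheses (s_aut : forall g, aut_tilde (s g))
  (sM : forall g h, s (g * h)%g = s g \o s h).

Lemma splitting1 z : s 1%g z = z.
Proof.
have [psi [_ [can _] _]] := s_aut 1%g; apply: (can_inj can).
by have := sM 1%g 1%g; rewrite mulg1 => /(congr1 (fun f => f z)).
Qed.

(** Regular functions on V - Z are polynomials, so the splitting extends to V; the group laws extend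
    by density. *)
Lemma splitting_polynomial : exists p : gT -> 'I_r -> mpoly r C,
  polynomial_action p /\
  forall g z, cox_coord (s g z) = point_action p g (cox_coord z).
Proof.
have /choice[p pE] : forall gi : gT * 'I_r, exists p : mpoly r C, forall z,
    cox_coord (s gi.1 z) gi.2 = meval (cox_coord z) p.
  move=> [g i] /=; apply: regular_cox_polynomial.
  have [psi [[rs _] _ _]] := s_aut g; have [_ rT] := rs setT openT.
  have := rT _ (@regular_coordinate _ _ _ setT i).
  by rewrite preimage_setT setIT.
pose q g i := p (g, i); exists q.
have qE g z : cox_coord (s g z) = point_action q g (cox_coord z).
  by apply/funext => i; rewrite (pE (g, i)).
split=> //; split=> [v|g h v]; apply/funext => i.
  rewrite /point_action (_ : q 1%g i = mpolyX C (mnm1 i)) ?mevalXU //.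
  apply: cox_dense_eq => z; rewrite mevalXU.
  by have := congr1 (fun f => f i) (qE 1%g z); rewrite splitting1.
have -> : point_action q g (point_action q h v) i = meval v (subst (q h) (q g i)).
  by rewrite meval_subst.
rewrite /point_action (_ : q (g * h)%g i = subst (q h) (q g i)) //.
apply: cox_dense_eq => z; rewrite meval_subst.
have := congr1 (fun f => f i) (qE (g * h)%g z); rewrite sM /= !qE => e.
exact: (esym e).
Qed.

(** The dilations of the cocharacter lie in K, which every [s g] normalises; this is what
    [invariant_weights] requires. *)
Lemma splitting_weights p : polynomial_action p ->
  (forall g z, cox_coord (s g z) = point_action p g (cox_coord z)) ->
  exists b, (forall i, 0 < b i)%N /\ forall g i, homogeneous b (b i) (p g i).
Proof.
move=> pA pE; have [a [a0 aP]] := positive_pic_dual.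
apply: (invariant_weights pA a0) => g t t0.
have tz (z : V) : admissible_point (D := D) (fun i => t ^+ a i * cox_coord z i).
  have [S SD zS] := cox_admissible z; exists S => // i /zS zi.
  by rewrite mulf_neq0 ?expf_neq0.
pose k z := mk_cox (tz z).
have Kk : K_action k.
  by exists (fun i => t ^+ a i); [exact: aP|move=> z i; rewrite mk_coxE].
have [psi [_ [can _] /(_ k Kk)[[tau _ tauE] _]]] := s_aut g.
exists tau => v i; rewrite /point_action.
have -> : meval (dilate a t v) (p g i) =
    meval v (subst (fun i => t ^+ a i *: mpolyX C (mnm1 i)) (p g i)).
  rewrite meval_subst; congr meval; apply/funext => j.
  by rewrite mevalZ mevalXU.
rewrite -mevalZ; congr meval; apply: cox_dense_eq => z.
rewrite meval_subst mevalZ.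
have := tauE (s g z) i; rewrite /= can => E.
have := congr1 (fun f => f i) (pE g (k z)); rewrite E pE => e.
transitivity (point_action p g (cox_coord (k z)) i); last exact: esym.
by congr meval; apply/funext => j; rewrite mevalZ mevalXU mk_coxE.
Qed.

End Splitting.

Theorem splits_versal : cox_ext_splits act -> versal act.
Proof.
move=> [s [sext sM sP]]; split=> // Y actY Yf U oU nU Uinv.
have s_aut g : aut_tilde (s g) by case: (sext g).
have [p [pA pE]] := splitting_polynomial s_aut sM.
have [b [b0 pb]] := splitting_weights s_aut pA pE.
have [x Ux] := nU; have [z0 z0x] := quotient_map_surj smooth x.
have [A [F [oA [y0 Ay0 Fy0] Ainv rF Fact]]] :=
  polynomial_action_equivariant_map Yf (cox_coord z0) pA b0 pb.
pose G y : V := if pselect (admissible_point (D := D) (F y)) is left H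
  then mk_cox H else z0.
have GE y : admissible_point (D := D) (F y) -> cox_coord (G y) = F y.
  move=> Fy; rewrite /G; case: pselect => // H.
  by apply/funext => i; rewrite mk_coxE.
(* The polynomial action lives on all of V; [B] keeps the points that [F] sends into V - Z. It
   contains [y0], whose value lies above a point of [U]. *)
pose B := A `&` [set y | admissible_point (D := D) (F y)].
have oB : open B.
  apply: open_local => y [Ay [S SD FS]].
  exists (A `&` [set y | \prod_(i | i \notin S) F y i != 0]); split.
  - by apply: open_nonvanishing => //; apply: regular_prod.
  - by split=> //=; apply/prodf_neq0.
  - move=> y' [Ay' /prodf_neq0 Fy']; split=> //; exists S => // i; exact: Fy'.
have rG : regular_map_on B G.
  apply: regular_into_sub_affine => // i.
  apply: (regular_ext oB (f := fun y => F y i)).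
    by move=> y [_ Fy]; rewrite -GE.
  by apply: (regular_res oA) => // y [].
have rq := regular_quotient_map (C := C) smooth.
have rf := regular_map_on_comp rG rq.
have oE : open (B `&` (quotient_map smooth \o G) @^-1` U) by have [] := rf U oU.
have qs g z : quotient_map smooth (s g z) = act g (quotient_map smooth z).
  apply: quotient_mapE; apply/(cox_quotientP smooth).
  by apply: sP; apply/(cox_quotientP smooth); exact: quotient_mapP.
have Gy0 : G y0 = z0.
  apply: cox_inj => i; rewrite GE ?Fy0 //; exact: cox_admissible.
exists (B `&` (quotient_map smooth \o G) @^-1` U), (quotient_map smooth \o G); split.
- split=> //; exists y0; split; last by rewrite /= Gy0 z0x.
  by split=> //=; rewrite Fy0; exact: cox_admissible.
- by apply: regular_map_on_res rf oE _ => y [].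
- by move=> y [].
- move=> g y [[Ay Fy] _] [[_ Fgy] _]; rewrite /= -qs; congr (quotient_map smooth _).
  by apply: cox_inj => i; rewrite GE // Fact // pE GE.
Qed.

End SplitsVersal.

Theorem theorem3p2 (R : realType) (n : nat) (D : fan R n) (gT : finGroupType)
    (act : gT -> toric_variety R[i] D -> toric_variety R[i] D) :
  complete (toric_variety R[i] D) ->
  nonsingular (toric_variety R[i] D) ->
  faithful_variety act ->
  (versal act <-> cox_ext_splits act).
Proof.
move=> Xc Xn Xf; have smooth := smooth_complete_fan (C := R[i]) Xc Xn.
by split; [exact: versal_splits | exact: splits_versal].
Qed.
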